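(* There exist universal constants $c,C_1,C_2>0$ such that for every $d\ge1$, every positive definite $\Sigma\in\mathbb R^{d\times d}$, every $\sigma>0$, every $n\ge1$ and every $\boldsymbol\lambda\in[0,1]^n$ with $m_d(\boldsymbol\lambda):=\min_{t\in[0,1]}\big(t^2+\frac d{N(t)}\big)\le c$, \[ \frac{C_1\sigma^2}{\sqrt d}\,m_d(\boldsymbol\lambda)\le L_{\mathsf{reg}}(\boldsymbol\lambda,\mathcal D(\Sigma,\sigma^2))\le C_2\sigma^2\,m_d(\boldsymbol\lambda). \] Moreover, with $t^*\in\arg\min_{t\in[0,1]}\big(t^2+\frac d{N(t)}\big)$, the estimator $\hat\beta_{\mathsf S}(\mathbf Z,t^* )$ satisfies $\Pr[\|\hat\beta_{\mathsf S}(\mathbf Z,t^* )-\beta_P\|_\Sigma^2\ge C_2\sigma^2 m_d(\boldsymbol\lambda)]\le1/5$ for every $P\in\mathcal D(\Sigma,\sigma^2)$ and every adversary.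
   Context: $\mathcal D(\Sigma,\sigma^2)$ is the family of distributions of $(W,Y)\in\mathbb R^d\times\mathbb R$ with $W\sim\mathcal N(0,\Sigma)$ and, conditionally on $W$, $Y\sim\mathcal N(W^\top\beta,\sigma^2)$, for some $\beta\in\mathbb R^d$; $\beta_P$ denotes this $\beta$. $\|x\|_\Sigma=\sqrt{x^\top\Sigma x}$. $\boldsymbol\lambda$-contamination: $Z_i=(1-B_i)X_i+B_i\tilde X_i$ with $X_i=(W_i,Y_i)$ i.i.d. from $P$, $B_i\sim\mathrm{Bernoulli}(\lambda_i)$ independent and independent of the $X_i$, outliers drawn from an arbitrary joint distribution (adversary) that may depend on all $X_j,B_j$; write $Z_i=(\hat W_i,\hat Y_i)$, $\mathbf Z\sim_{\boldsymbol\lambda}P$. $L_{\mathsf{reg}}(\boldsymbol\lambda,\mathcal D)=\inf\{s:\inf_M\sup\Pr[\|M(\mathbf Z)-\beta_P\|_\Sigma^2>s]\le1/5\}$, infimum over estimators, supremum over $P\in\mathcal D$ and all adversaries. $N(t)=|\{i:\lambda_i\le t\}|$ with $d/0=+\infty$. Weighted regression depth $D_w(\eta,\mathbf Z)=\min_{v\in\mathbb S^{d-1}}\sum_iw_i\mathbb I\{(\hat Y_i-\eta^\top\hat W_i)(v^\top\hat W_i)\ge0\}$ for $w$ in the probability simplex, $\hat\beta_{\mathsf{TC}}(\mathbf Z,w)\in\arg\max_\eta D_w(\eta,\mathbf Z)$; threshold weights $w(t)_i=\mathbb I\{\lambda_i\le t\}/N(t)$ and $\hat\beta_{\mathsf S}(\mathbf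 Z,t)=\hat\beta_{\mathsf{TC}}(\mathbf Z,w(t))$. *)

(* Defs.v *)
From HB Require Import structures.
From mathcomp Require Import all_boot all_order all_algebra.
From mathcomp Require Import all_classical all_reals all_analysis.
From mathcomp Require Import Rstruct Rstruct_topology.
Set Implicit Arguments. Unset Strict Implicit. Unset Printing Implicit Defensive.
Import Order.TTheory GRing.Theory Num.Theory.
Local Open Scope classical_set_scope.
Local Open Scope ring_scope.

Section Defs.
Context {R : realType}.

Definition dotv (d : nat) (a b : 'rV[R]_d) : R := (a *m b^T) 0 0.

Definition sqnormS (d : nat) (S : 'M[R]_d) (x : 'rV[R]_d) : R :=
  (x *m S *m x^T) 0 0.

Definition posdef (d : nat) (S : 'M[R]_d) : Prop :=
  S^T = S /\ forall x : 'rV[R]_d, x != 0 -> 0 < sqnormS S x.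

Definition sample (n d : nat) := 'I_n -> 'rV[R]_d * R.

Definition Ncount (n : nat) (lam : 'I_n -> R) (t : R) : nat :=
  #|[set i : 'I_n | lam i <= t]|.

Definition mobj (n d : nat) (lam : 'I_n -> R) (t : R) : \bar R :=
  ((t ^+ 2)%:E + (if Ncount lam t == 0%N then +oo
                  else ((d%:R : R) / (Ncount lam t)%:R)%:E))%E.

Definition md (n d : nat) (lam : 'I_n -> R) : \bar R :=
  ereal_inf [set mobj d lam t | t in `[0, 1]%classic].

Definition wthr (n : nat) (lam : 'I_n -> R) (t : R) (i : 'I_n) : R :=
  (if lam i <= t then 1 else 0) / (Ncount lam t)%:R.

Definition depthw (n d : nat) (w : 'I_n -> R) (eta : 'rV[R]_d) (z : sample n d)
  : R :=
  inf [set \sum_(i < n) w i *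
          (if 0 <= ((z i).2 - dotv eta (z i).1) * dotv v (z i).1 then 1 else 0)
       | v in [set v : 'rV[R]_d | dotv v v = 1]].

Definition is_TC (n d : nat) (w : 'I_n -> R) (z : sample n d) (eta : 'rV[R]_d)
  : Prop :=
  forall eta' : 'rV[R]_d, depthw w eta' z <= depthw w eta z.

Definition outerP (d0 : measure_display) (T : measurableType d0)
  (mu : probability T R) (A : set T) : \bar R :=
  ereal_inf [set mu E | E in [set E | measurable E /\ A `<=` E]].

(* The lambda-contamination model for P in D(Sigma, sigma^2) with regression
   vector beta, realised on a probability space (T, mu).  The sample Z is
   given by
     X_i = (W_i, Y_i),  W_i = G_i S^T  (G_i with iid N(0,1) entries, S S^T = Sigma,
                                          so W_i ~ N(0, Sigma)),
     Y_i = W_i . beta + sigma * xi_i   (xi_i ~ N(0,1)),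
     B_i ~ Bernoulli(lambda_i),
   all the G_ij, xi_i, B_i mutually independent, and outliers
   Xt_i = (Wt_i, Yt_i) arbitrary measurable random variables on T (hence with
   an arbitrary joint law, possibly depending on all X_j, B_j);
     Z_i = (1 - B_i) X_i + B_i Xt_i. *)
Definition contam_model (n d : nat) (Sigma : 'M[R]_d) (sigma : R)
  (lam : 'I_n -> R) (beta : 'rV[R]_d)
  (d0 : measure_display) (T : measurableType d0) (mu : probability T R)
  (Z : T -> sample n d) : Prop :=
  exists (G : 'I_n -> 'I_d -> T -> R) (xi : 'I_n -> T -> R)
         (B : 'I_n -> T -> bool)
         (Wt : 'I_n -> 'I_d -> T -> R) (Yt : 'I_n -> T -> R) (S : 'M[R]_d),
  [/\ S *m S^T = Sigma,
      (forall i j, measurable_fun setT (G i j)) /\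
      (forall i, measurable_fun setT (xi i)) /\
      (forall i, measurable_fun setT (B i)) /\
      (forall i j, measurable_fun setT (Wt i j)) /\
      (forall i, measurable_fun setT (Yt i)),
      (forall i j A, measurable A -> mu (G i j @^-1` A) = normal_prob 0 1 A) /\
      (forall i A, measurable A -> mu (xi i @^-1` A) = normal_prob 0 1 A) /\
      (forall i A, measurable A -> mu (B i @^-1` A) = bernoulli_prob (lam i) A),
      (forall (AG : 'I_n -> 'I_d -> set R) (Axi : 'I_n -> set R)
              (AB : 'I_n -> set bool),
         (forall i j, measurable (AG i j)) -> (forall i, measurable (Axi i)) ->
         (forall i, measurable (AB i)) ->
         fine (mu [set w | (forall i j, AG i j (G i j w)) /\
                           (forall i, Axi i (xi i w)) /\
                           (forall i, AB i (B i w))]) =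
         (\prod_(i < n) \prod_(j < d) fine (mu (G i j @^-1` AG i j))) *
         (\prod_(i < n) fine (mu (xi i @^-1` Axi i))) *
         (\prod_(i < n) fine (mu (B i @^-1` AB i))))
    & forall w i, Z w i =
        if B i w then (\row_j Wt i j w, Yt i w)
        else let W := (\row_j G i j w) *m S^T in
             (W, dotv W beta + sigma * xi i w)].

(* sup over P in D(Sigma,sigma^2) (i.e. over beta) and over all adversaries
   (all probability spaces realising the model) of
   Pr[ ||M(Z) - beta_P||_Sigma^2 > s ] *)
Definition worst_risk (n d : nat) (Sigma : 'M[R]_d) (sigma : R)
  (lam : 'I_n -> R) (M : sample n d -> 'rV[R]_d) (s : R) : \bar R :=
  ereal_sup [set p | exists (beta : 'rV[R]_d) (d0 : measure_display)
                        (T : measurableType d0) (mu : probability T R)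
                        (Z : T -> sample n d),
               contam_model Sigma sigma lam beta mu Z /\
               p = outerP mu [set w | s < sqnormS Sigma (M (Z w) - beta)]].

Definition Lreg (n d : nat) (Sigma : 'M[R]_d) (sigma : R) (lam : 'I_n -> R)
  : \bar R :=
  ereal_inf [set s%:E | s in
    [set s : R | (ereal_inf [set worst_risk Sigma sigma lam M s
                             | M in [set: sample n d -> 'rV[R]_d]]
                  <= (1 / 5 : R)%:E)%E]].

End Defs.

(* Main.v *)
(* Upper bound. Keep the samples with lambda_i <= t. On the clean blocks (G_i, xi_i), chaining over
   lattice nets shows that with high probability, simultaneously for all unit vectors u, the signs
   of xi_i <u, G_i> are balanced up to O(sqrt(d N)), and at least c rho N of the blocks satisfy
   0 <= xi_i <u, G_i> < rho <u, G_i>^2; by Markov's inequality O(t N) samples are contaminated.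
   So beta has depth at least N/2 - O(sqrt(d N) + t N), while a candidate at distance rho sigma
   loses an extra c rho N in the direction of its error, and is beaten once rho is a large
   multiple of t + sqrt(d / N).

   Lower bound. Take theta_b with k ~ sqrt(d) coordinates +-eps, and t^2 = m_d / 4. A sample with
   lambda_i > t can be given a density that does not depend on b, because (1 - lambda_i) times the
   clean density is dominated, by convexity of exp, by a mixture of one-coordinate exponentials of
   squares; the other samples are left with the clean law. The second moments of the remaining
   likelihood ratios are exp(O(k)) with a small constant, so an estimator that is accurate for most
   b would put too many sign vectors in a single small Hamming ball. *)
Require Import Defs.
From HB Require Import structures.
From mathcomp Require Import Rstruct Rstruct_topology.
From mathcomp Require Import all_boot all_order all_algebra.
From mathcomp Require Import all_classical all_reals all_analysis measurable_realfun.
From mathcomp Require Import ring lra zify.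
Set Implicit Arguments. Unset Strict Implicit. Unset Printing Implicit Defensive.
Import Order.TTheory GRing.Theory Num.Theory.
Import numFieldNormedType.Exports.
Local Open Scope classical_set_scope.
Local Open Scope ring_scope.

(** * Product measures and Gaussian blocks *)

(** The factor [sqrt d] is the price of the domination step. A density that ignores the sign vector
    has to absorb the l^1 size of the regression vector: [k] coordinates of size [eps] cost a
    contamination rate of order [k eps], so [eps] is of order [t / k] and the squared separation
    [k eps^2] is of order [t^2 / k]. The samples with small rate must also stay uninformative, which
    asks for [N eps^2] bounded. As [N t^2 <= d / 3] when [t^2 = m_d / 4], this holds once
    [k^2 >= d], and the smallest such [k] is about [sqrt d]. In the upper bound, a union bound over
    one net fine enough to reach every direction would pay [d log (1 / q)] with [q = sqrt (d / N)]
    and lose a logarithm in the sign balance. Chaining avoids it because the signs along two nearby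
    directions rarely disagree, so the increments have small variance. The good event concerns the
    clean blocks only: it is built once on a canonical product space and transported to every
    realisation of the model, where the adversary enters through the number of corrupted samples
    alone. *)

Section pushforward_probability.
Context {d1 d2} {T1 : measurableType d1} {T2 : measurableType d2} {R : realType}.

Definition pushp (P : {measure set T1 -> \bar R}) (f : T1 -> T2)
    (mf : measurable_fun [set: T1] f) : set T2 -> \bar R :=
  fun A => P (f @^-1` A).

Section measure.
Context (P : {measure set T1 -> \bar R}) (f : T1 -> T2) (mf : measurable_fun [set: T1] f).

Let pushp0 : pushp P mf set0 = 0%E.
Proof. by rewrite /pushp preimage_set0 measure0. Qed.

Let pushp_ge0 A : (0 <= pushp P mf A)%E.
Proof. exact: measure_ge0. Qed.

Let pushp_sigma_additive : semi_sigma_additive (pushp P mf).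
Proof.
move=> F mF tF mUF; rewrite /pushp preimage_bigcup.
apply: measure_semi_sigma_additive.
- by move=> n; rewrite -[X in measurable X]setTI; exact: mf.
- apply/trivIsetP => /= i j _ _ ij; rewrite -preimage_setI.
  by move/trivIsetP : tF => /(_ _ _ _ _ ij) ->//; rewrite preimage_set0.
- by rewrite -preimage_bigcup -[X in measurable X]setTI; exact: mf.
Qed.

HB.instance Definition _ := isMeasure.Build _ _ _
  (pushp P mf) pushp0 pushp_ge0 pushp_sigma_additive.

Lemma integral_pushp (g : T2 -> \bar R) : measurable_fun [set: T2] g ->
  (forall y, 0 <= g y)%E ->
  (\int[pushp P mf]_y g y = \int[P]_x g (f x))%E.
Proof.
move=> mg g0.
have := ge0_integral_pushforward mf P measurableT mg (fun y _ => g0 y).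
by rewrite preimage_setT.
Qed.

End measure.

Section probability.
Context (P : probability T1 R) (f : T1 -> T2) (mf : measurable_fun [set: T1] f).

Let pushp_setT : pushp P mf setT = 1%E.
Proof. by rewrite /pushp preimage_setT; exact: (@probability_setT _ _ _ P). Qed.

HB.instance Definition _ :=
  @Measure_isProbability.Build _ _ R (pushp P mf) pushp_setT.

End probability.

End pushforward_probability.

Section iid.
Context {d} {T : measurableType d} {R : realType} (P : probability T R).

Definition constup n (x : T * n.-tuple T) : n.+1.-tuple T := [tuple of x.1 :: x.2].

Lemma measurable_constup n : measurable_fun [set: T * n.-tuple T] (@constup n).
Proof.
exact: (measurable_cons measurable_fst measurable_snd).
Qed.

(** The recursion peels off the head of the tuple, so that Tonelli reduces every integral over [n]
    samples to an induction on [n]. *)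
Fixpoint iid n : probability (n.-tuple T) R :=
  match n with
  | 0 => dirac [tuple]
  | n'.+1 => pushp (P \x iid n')%E (@measurable_constup n')
  end.

Lemma integral_iid0 (f : 0.-tuple T -> \bar R) :
  (\int[iid 0]_t f t = f [tuple])%E.
Proof.
rewrite /= integral_dirac ?diracT ?mul1e//.
(* The type of 0-tuples has one point, so a preimage is either everything or empty; this makes an
   arbitrary [f] measurable. *)
move=> _ Y _; have [fY|fY] := pselect (Y (f [tuple])).
  rewrite (_ : _ `&` _ = setT) ?setTI//; last first.
  by apply/seteqP; split=> // t _ /=; rewrite (tuple0 t).
rewrite (_ : _ `&` _ = set0)//.
by apply/seteqP; split=> // t [_ /=]; rewrite (tuple0 t).
Qed.

Lemma integral_iidS n (f : n.+1.-tuple T -> \bar R) :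
  measurable_fun [set: n.+1.-tuple T] f -> (forall t, 0 <= f t)%E ->
  (\int[iid n.+1]_t f t = \int[P]_x \int[iid n]_t f [tuple of x :: t])%E.
Proof.
move=> mf f0; rewrite /= integral_pushp//.
rewrite (fubini_tonelli1 (fun x => f (constup x)))//.
exact: (measurableT_comp mf (@measurable_constup n)).
Qed.

Lemma measurable_prod_tnth n (f : 'I_n -> T -> R) :
  (forall i, measurable_fun [set: T] (f i)) ->
  measurable_fun [set: n.-tuple T] (fun t => \prod_(i < n) f i (tnth t i)).
Proof.
move=> mf; apply: (@measurable_prod _ _ _ _ _ _ (fun i t => f i (tnth t i))) => i _.
exact: (measurableT_comp (mf i) (measurable_tnth i)).
Qed.

Lemma integral_iid_prod n (f : 'I_n -> T -> R) :
  (forall i, measurable_fun [set: T] (f i)) -> (forall i x, 0 <= f i x) ->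
  (\int[iid n]_t (\prod_(i < n) f i (tnth t i))%:E =
   \prod_(i < n) \int[P]_x (f i x)%:E)%E.
Proof.
elim: n f => [|n IH] f mf f0; first by rewrite integral_iid0 !big_ord0.
rewrite integral_iidS; last 2 first.
  by apply/measurable_EFinP; exact: measurable_prod_tnth.
  by move=> t; rewrite lee_fin prodr_ge0.
under eq_integral => x _.
  under eq_integral => t _.
    rewrite big_ord_recl tnth0 EFinM.
    under eq_bigr => i _ do rewrite tnthS.
    over.
  rewrite ge0_integralZl//; last 3 first.
    by apply/measurable_EFinP; exact: (measurable_prod_tnth (fun i => mf (lift ord0 i))).
    by move=> t _; rewrite lee_fin prodr_ge0.
    by rewrite lee_fin.
  rewrite (IH (fun i => f (lift ord0 i)))//.
  over.
rewrite big_ord_recl ge0_integralZr//; first exact/measurable_EFinP.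
- by move=> x _; rewrite lee_fin.
- by apply: prode_ge0 => i _; apply: integral_ge0 => x _; rewrite lee_fin.
Qed.

Lemma measurable_rect n (A : 'I_n -> set T) : (forall i, measurable (A i)) ->
  measurable [set t : n.-tuple T | forall i, A i (tnth t i)].
Proof.
move=> mA; rewrite (_ : [set _ | _] = \bigcap_(i in [set: 'I_n]) ((@tnth n T ^~ i) @^-1` (A i))).
  apply: fin_bigcap_measurable => // i _; rewrite -[X in measurable X]setTI.
  exact: measurable_tnth.
by apply/seteqP; split=> t /=; [move=> h i _; exact: h|move=> h i; exact: (h i I)].
Qed.

Lemma iid_rect n (A : 'I_n -> set T) : (forall i, measurable (A i)) ->
  iid n [set t | forall i, A i (tnth t i)] = (\prod_(i < n) P (A i))%E.
Proof.
move=> mA; rewrite (eq_bigr (fun i => \int[P]_x (\1_(A i) x)%:E)%E); last first.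
  by move=> i _; rewrite integral_indic// setIT.
rewrite -(integral_iid_prod (f := fun i => \1_(A i)))//.
have mr := measurable_rect mA.
rewrite -[X in iid n X]setIT -integral_indic//.
apply: eq_integral => t _; congr EFin; rewrite indicE.
have [h|h] := pselect (forall i, A i (tnth t i)).
  by rewrite mem_set// big1// => i _; rewrite indicE mem_set.
rewrite memNset//; move/existsNP : h => [i Ai].
by rewrite (bigD1 i)//= indicE memNset// mul0r.
Qed.

Definition rects n (G : set (set T)) : set (set (n.-tuple T)) :=
  [set [set t | forall i, A i (tnth t i)] | A in [set A : 'I_n -> set T | forall i, G (A i)]].

Arguments rects : clear implicits.

(** The nontrivial inclusion says that the identity, out of the sigma-algebra generated by the
    rectangles, is measurable. This is checked coordinate by coordinate: the slab over [B] in
    coordinate [i] is itself a rectangle, because [setT] belongs to [G]. *)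
Lemma measurable_tuple_rects n (G : set (set T)) : G setT ->
  @measurable _ T = <<s G >> -> @measurable _ (n.-tuple T) = <<s rects n G >>.
Proof.
move=> GT mG; apply/seteqP; split=> [E mE|]; last first.
  apply: smallest_sub; first exact: sigma_algebra_measurable.
  move=> _ [A GA <-]; apply: measurable_rect => i; rewrite mG; exact: sub_gen_smallest.
pose X := g_sigma_algebraType (rects n G).
have mid : measurable_fun [set: X] (fun x : X => x : n.-tuple T).
  apply/(measurable_fun_tnthP (fun x : X => x : n.-tuple T)) => i.
  apply: (measurability G) => // _ [B GB <-]; rewrite setTI.
  apply: sub_gen_smallest => /=.
  exists (fun j => if j == i then B else setT) => [j|]; first by case: eqP.
  apply/seteqP; split=> t /= => [/(_ i)|Bt j]; first by rewrite eqxx.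
  by case: eqP => // ->.
by have := mid measurableT E mE; rewrite setTI.
Qed.

Lemma setI_closed_rects n (G : set (set T)) : setI_closed G -> setI_closed (rects n G).
Proof.
move=> GI _ _ [A GA <-] [B GB <-]; exists (fun i => A i `&` B i).
  by move=> i; exact: GI.
apply/seteqP; split=> t /= => [h|[h1 h2] i]; last by split.
by split=> i; have [] := h i.
Qed.

(** Uniqueness of measures on a generating pi-system, here the rectangles with sides in [G]. It
    recognises the law of the clean blocks from product formulas. *)
Lemma iid_unique n (G : set (set T)) (nu : {measure set (n.-tuple T) -> \bar R}) :
  G setT -> setI_closed G -> @measurable _ T = <<s G >> ->
  (forall A : 'I_n -> set T, (forall i, G (A i)) ->
    nu [set t | forall i, A i (tnth t i)] = (\prod_(i < n) P (A i))%E) ->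
  forall E, measurable E -> nu E = iid n E.
Proof.
move=> GT GI mG nuG E mE.
have GTT : rects n G setT.
  by exists (fun=> setT) => //; apply/seteqP; split.
apply: (measure_unique (rects n G) (fun=> setT)) => //.
- exact: measurable_tuple_rects.
- exact: setI_closed_rects.
- by rewrite bigcup_const//; exists 0%N.
- move=> _ [A GA <-]; rewrite nuG//; apply/esym/iid_rect => i.
  by rewrite mG; exact: sub_gen_smallest.
- move=> _; case: GTT => A GA <-; rewrite nuG//.
  rewrite -iid_rect; last by move=> i; rewrite mG; exact: sub_gen_smallest.
  by rewrite (le_lt_trans (probability_le1 _ _)) ?ltry//;
    apply: measurable_rect => i; rewrite mG; exact: sub_gen_smallest.
Qed.

End iid.
Arguments rects {d T} n G.

Section blocks.
Context {R : realType}.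
Local Notation RR := (measurableTypeR R).

(* [gV d] is the law of the rows [G_i], and [gB d] that of the blocks [(G_i, xi_i)], of the
   contamination model. *)
Definition gN : probability RR R := normal_prob 0 1.
Definition gV d : probability (d.-tuple RR) R := iid gN d.
Definition gB d : probability (d.-tuple RR * RR)%type R := (gV d \x gN)%E.

Definition block_rects d : set (set (d.-tuple RR * RR)) :=
  [set C `*` B | C in rects d measurable & B in measurable].

Lemma sigma_measurable d (T : measurableType d) : @measurable _ T = <<s @measurable _ T >>.
Proof. by rewrite sigma_algebra_id//; exact: sigma_algebra_measurable. Qed.

Lemma measurable_block_rects d :
  @measurable _ (d.-tuple RR * RR)%type = <<s @block_rects d >>.
Proof.
have mV : @measurable _ (d.-tuple RR) = <<s rects d (@measurable _ RR) >>.
  exact/measurable_tuple_rects/sigma_measurable.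
apply/seteqP; split=> [E mE|]; last first.
  apply: smallest_sub; first exact: sigma_algebra_measurable.
  move=> _ [C rC [B mB <-]]; apply: measurableX => //.
  by rewrite mV; exact: sub_gen_smallest.
pose X := g_sigma_algebraType (@block_rects d).
have mid : measurable_fun [set: X] (fun x : X => x : (d.-tuple RR * RR)%type).
  apply/measurable_fun_pairP; split.
    apply: (measurability (rects d (@measurable _ RR))) => // _ [C rC <-]; rewrite setTI.
    apply: sub_gen_smallest; exists C => //; exists setT => //.
    by apply/seteqP; split=> [[x y] []|[x y]].
  move=> _ B mB; rewrite setTI.
  apply: sub_gen_smallest; exists setT.
    by exists (fun=> setT) => //; apply/seteqP; split.
  exists B => //.
  by apply/seteqP; split=> [[x y] []|[x y]].
by have := mid measurableT E mE; rewrite setTI.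
Qed.

Definition blocks n d (T : Type) (G : 'I_n -> 'I_d -> T -> R) (xi : 'I_n -> T -> R)
    (w : T) : n.-tuple (d.-tuple RR * RR) :=
  [tuple ([tuple G i j w | j < d], xi i w) | i < n].

Lemma measurable_blocks n d (d0 : measure_display) (T : measurableType d0)
    (G : 'I_n -> 'I_d -> T -> R) (xi : 'I_n -> T -> R) :
  (forall i j, measurable_fun setT (G i j)) ->
  (forall i, measurable_fun setT (xi i)) -> measurable_fun [set: T] (blocks G xi).
Proof.
move=> mG mxi; apply/measurable_fun_tnthP => i.
rewrite (_ : _ \o _ = fun w => ([tuple G i j w | j < d], xi i w)); last first.
  by apply/funext => w /=; rewrite tnth_mktuple.
apply: measurable_fun_pair; last exact: mxi.
apply/measurable_fun_tnthP => j.
rewrite (_ : _ \o _ = G i j); first exact: mG.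
by apply/funext => w /=; rewrite tnth_mktuple.
Qed.

(** The contamination model only gives a product formula for scalar events. This upgrades it to the
    full joint law of the clean blocks, so that an event built once under [iid (gB d) n] can be
    pulled back to any realisation of the model. *)
Lemma blocks_law n d (d0 : measure_display) (T : measurableType d0)
    (mu : probability T R) (G : 'I_n -> 'I_d -> T -> R) (xi : 'I_n -> T -> R)
    (mG : forall i j, measurable_fun setT (G i j))
    (mxi : forall i, measurable_fun setT (xi i)) :
  (forall i j A, measurable A -> mu (G i j @^-1` A) = normal_prob 0 1 A) ->
  (forall i A, measurable A -> mu (xi i @^-1` A) = normal_prob 0 1 A) ->
  (forall (AG : 'I_n -> 'I_d -> set R) (Axi : 'I_n -> set R),
     (forall i j, measurable (AG i j)) -> (forall i, measurable (Axi i)) ->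
     fine (mu [set w | (forall i j, AG i j (G i j w)) /\ (forall i, Axi i (xi i w))]) =
     (\prod_(i < n) \prod_(j < d) fine (mu (G i j @^-1` AG i j))) *
     (\prod_(i < n) fine (mu (xi i @^-1` Axi i)))) ->
  forall E, measurable E -> mu [set w | E (blocks G xi w)] = iid (gB d) n E.
Proof.
move=> lG lxi ind E mE.
have mb := measurable_blocks mG mxi.
apply: (iid_unique (P := gB d) (G := @block_rects d) (nu := pushp mu mb)) => //.
- exists setT; first by exists (fun=> setT) => //; apply/seteqP; split.
  by exists setT => //; apply/seteqP; split.
- move=> _ _ [C1 rC1 [B1 mB1 <-]] [C2 rC2 [B2 mB2 <-]].
  exists (C1 `&` C2); first by apply: setI_closed_rects => //; exact: measurableI.
  exists (B1 `&` B2); first exact: measurableI.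
  by rewrite setXI.
- exact: measurable_block_rects.
move=> A rA.
have /choice[CB hCB] : forall i, exists CB : ('I_d -> set R) * set R,
    [/\ forall j, measurable (CB.1 j), measurable CB.2 &
        A i = [set t | forall j, CB.1 j (tnth t j)] `*` CB.2].
  by move=> i; have [_ [C mC <-] [B mB <-]] := rA i; exists (C, B).
pose AG i j := (CB i).1 j; pose Axi i := (CB i).2.
have mAG i j : measurable (AG i j) by have [h _ _] := hCB i; exact: h.
have mAxi i : measurable (Axi i) by have [_ h _] := hCB i; exact: h.
have AE i : A i = [set t | forall j, AG i j (tnth t j)] `*` Axi i by have [_ _ h] := hCB i; exact: h.
rewrite /= /pushp (_ : _ @^-1` _ =
   [set w | (forall i j, AG i j (G i j w)) /\ (forall i, Axi i (xi i w))]); last first.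
  apply/seteqP; split=> w /=.
    move=> h; split=> i; have := h i; rewrite tnth_mktuple AE => -[] //= + _ j.
    by move=> /(_ j); rewrite tnth_mktuple.
  move=> [h1 h2] i; rewrite tnth_mktuple AE; split=> //= j.
  by rewrite tnth_mktuple.
have mpre (f : T -> R) B : measurable_fun setT f -> measurable B -> measurable (f @^-1` B).
  by move=> mf mB; rewrite -[X in measurable X]setTI; exact: mf.
have mS : measurable [set w | (forall i j, AG i j (G i j w)) /\ (forall i, Axi i (xi i w))].
  rewrite (_ : [set w | _] = (\bigcap_(i in [set: 'I_n]) \bigcap_(j in [set: 'I_d]) (G i j @^-1` AG i j))
    `&` (\bigcap_(i in [set: 'I_n]) (xi i @^-1` Axi i))).
    apply: measurableI; apply: fin_bigcap_measurable => // i _; last exact: mpre.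
    by apply: fin_bigcap_measurable => // j _; exact: mpre.
  apply/seteqP; split=> w /= [h1 h2]; split.
  - by move=> i _ j _; exact: h1.
  - by move=> i _; exact: h2.
  - by move=> i j; exact: (h1 i I j I).
  - by move=> i; exact: (h2 i I).
rewrite -[LHS]fineK ?fin_num_measure// ind// EFinM -!prodEFin.
rewrite [X in (X * _)%E](eq_bigr (fun i => (\prod_(j < d) gN (AG i j))%E)); last first.
  move=> i _; rewrite -prodEFin; apply: eq_bigr => j _.
  by rewrite fineK ?fin_num_measure//; [rewrite lG|exact: mpre].
rewrite [X in (_ * X)%E](eq_bigr (fun i => gN (Axi i))); last first.
  by move=> i _; rewrite fineK ?fin_num_measure//; [rewrite lxi|exact: mpre].
rewrite -big_split; apply: eq_bigr => i _ /=.
have mr := measurable_rect (mAG i : forall j, measurable (AG i j : set RR)).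
rewrite AE; apply/esym; apply: (etrans (product_measure1E (gV d) gN mr (mAxi i))).
by congr (_ * _)%E; exact: (iid_rect gN (mAG i)).
Qed.
End blocks.

(** * Gaussian integrals *)

Section density.
Context {d} {T : measurableType d} {R : realType}.
Context (m nu : {measure set T -> \bar R}) (g : T -> R).
Context (mg : measurable_fun [set: T] g) (g0 : forall x, 0 <= g x).
Context (mE : forall A, measurable A -> m A = (\int[nu]_(x in A) (g x)%:E)%E).

Import HBNNSimple.

Let integral_density_nnsfun (f : {nnsfun T >-> R}) :
  (\int[m]_x (f x)%:E = \int[nu]_x ((f x)%:E * (g x)%:E))%E.
Proof.
under [LHS]eq_integral do rewrite fimfunE -fsumEFin//.
rewrite [LHS]ge0_integral_fsum//; last 2 first.
  - by move=> r; exact/measurable_EFinP/measurableT_comp.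
  - by move=> n x _; rewrite EFinM nnfun_muleindic_ge0.
under [RHS]eq_integral.
  move=> x xD; rewrite fimfunE -fsumEFin// muleC ge0_mule_fsumr; last first.
    by move=> r; rewrite EFinM nnfun_muleindic_ge0.
  over.
rewrite [RHS]ge0_integral_fsum//; last 2 first.
  - move=> r; apply: emeasurable_funM; first exact/measurable_EFinP.
    by apply/measurable_EFinP/measurable_funM => //; exact/measurable_indic.
  - move=> n x _; rewrite EFinM mule_ge0//; last by rewrite nnfun_muleindic_ge0.
    by rewrite lee_fin.
apply: eq_fsbigr => r /[!inE] -[t _ <-{r}].
rewrite integralZl_indic_nnsfun//= integral_indic// setIT mE//.
rewrite integral_mkcond -ge0_integralZl//; last 3 first.
- by apply/measurable_restrict => //; exact/measurable_EFinP/measurable_funTS.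
- by move=> x _; rewrite patchE; case: ifPn; rewrite ?lee_fin.
- by rewrite lee_fin.
apply: eq_integral => x _; rewrite patchE indicE.
case: ifPn => [xE|xE]; first by rewrite mulr1 muleC.
by rewrite mulr0 !mule0.
Qed.

(** The formula holds for simple functions by linearity, and passes to nonnegative measurable
    functions by monotone convergence on both sides. *)
Lemma integral_density (f : T -> \bar R) :
  measurable_fun [set: T] f -> (forall x, 0 <= f x)%E ->
  (\int[m]_x f x = \int[nu]_x (f x * (g x)%:E))%E.
Proof.
move=> mf f0; pose f_ := nnsfun_approx measurableT mf.
transitivity (lim (\int[m]_x (f_ n x)%:E @[n --> \oo])%E).
  rewrite -monotone_convergence//=.
  - apply: eq_integral => x _; apply/esym/cvg_lim => //=.
    exact: (cvg_nnsfun_approx measurableT mf (fun x _ => f0 x)).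
  - by move=> n; exact/measurable_EFinP/measurable_funTS.
  - by move=> n x _; rewrite lee_fin.
  - by move=> x _ a b ab; rewrite lee_fin; exact/lefP/nd_nnsfun_approx.
under eq_fun do rewrite integral_density_nnsfun.
rewrite -monotone_convergence//=.
- apply: eq_integral => x _; apply/cvg_lim => //=.
  apply: cvgeZr; first by [].
  exact: (cvg_nnsfun_approx measurableT mf (fun x _ => f0 x)).
- by move=> n; apply: emeasurable_funM; apply/measurable_EFinP/measurable_funTS.
- by move=> n x _; rewrite mule_ge0// lee_fin.
- move=> x _ a b ab; rewrite lee_wpmul2r// ?lee_fin//; exact/lefP/nd_nnsfun_approx.
Qed.

End density.

Section affine.
Context {R : realType}.
Local Notation RR := (measurableTypeR R).
Local Notation leb := (@lebesgue_measure R).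

Lemma measurable_affine (a b : R) : measurable_fun [set: RR] (fun x => a * x + b : RR).
Proof. by apply: measurable_funD => //; exact: measurable_funM. Qed.

(** Lebesgue measure is determined by its values on half-open intervals, where the scaling rule is a
    computation of lengths. *)
Lemma lebesgue_measure_affine (a b : R) (A : set RR) : 0 < a -> measurable A ->
  leb A = (a%:E * pushp leb (measurable_affine a b) A)%E.
Proof.
move=> a0 mA; have a0' : 0 <= a by exact: ltW.
apply: (@lebesgue_measure_unique _
  (mscale (NngNum a0') (pushp leb (measurable_affine a b)))) => // _ [[u v]] _ <-.
transitivity (a%:E * leb (`]((u - b) / a)%R, ((v - b) / a)%R]%classic : set RR))%E.
  rewrite !lebesgue_measure_itv/= !lte_fin ltr_pM2r ?invr_gt0// ltrD2r.
  case: ifPn => _; last by rewrite mule0.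
  rewrite -!EFinB -EFinM; congr EFin; field; exact: lt0r_neq0.
congr (_ * leb _)%E; apply/esym.
apply/seteqP; split=> x /=; rewrite !in_itv/= => /andP[h1 h2]; apply/andP; split.
- by rewrite ltr_pdivrMr// ltrBlDr mulrC.
- by rewrite ler_pdivlMr// lerBrDr mulrC.
- by move: h1; rewrite ltr_pdivrMr// ltrBlDr mulrC.
- by move: h2; rewrite ler_pdivlMr// lerBrDr mulrC.
Qed.

Lemma integral_affine (a b : R) (f : RR -> \bar R) : 0 < a ->
  measurable_fun [set: RR] f -> (forall x, 0 <= f x)%E ->
  (a%:E * \int[leb]_x f (a * x + b)%R = \int[leb]_x f x)%E.
Proof.
move=> a0 mf f0; have a0' : 0 <= a by exact: ltW.
rewrite -(integral_pushp _ (measurable_affine a b))//.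
rewrite -(@ge0_integral_mscale _ _ _ _ setT _ (NngNum a0'))//.
by apply: eq_measure_integral => A mA _; apply/esym/lebesgue_measure_affine.
Qed.

Lemma lebesgue_integralN (f : RR -> \bar R) :
  measurable_fun [set: RR] f -> (forall x, 0 <= f x)%E ->
  (\int[leb]_x f (- x)%R = \int[leb]_x f x)%E.
Proof.
move=> mf f0.
have mN : measurable_fun [set: RR] (fun x => - x : RR) by exact: oppr_measurable.
rewrite -(integral_pushp _ mN)//; apply: eq_measure_integral => A mA _.
exact: lebesgue_measureN.
Qed.

End affine.

Section normal.
Context {R : realType}.
Local Notation RR := (measurableTypeR R).
Local Notation leb := (@lebesgue_measure R).
Local Notation gN := (@gN R).

Definition npdf (x : R) : R := normal_peak 1 * expR (- x ^+ 2 / 2).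

Lemma npdfE x : npdf x = normal_peak 1 * expR (- x ^+ 2 / 2).
Proof. by []. Qed.

Lemma npdf_ge0 x : 0 <= npdf x.
Proof. by rewrite mulr_ge0 ?normal_peak_ge0 ?expR_ge0. Qed.

Lemma normal_pdf01 : normal_pdf 0 1 = npdf.
Proof.
rewrite normal_pdfE ?oner_neq0//; apply/funext => x.
by rewrite /npdf /normal_fun subr0 expr1n.
Qed.

Lemma measurable_npdf : measurable_fun [set: RR] npdf.
Proof. by rewrite -normal_pdf01; exact: measurable_normal_pdf. Qed.

Lemma integral_gN (f : RR -> \bar R) :
  measurable_fun [set: RR] f -> (forall x, 0 <= f x)%E ->
  (\int[gN]_x f x = \int[leb]_x (f x * (npdf x)%:E))%E.
Proof.
move=> mf f0; apply: integral_density => //.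
- exact: measurable_npdf.
- exact: npdf_ge0.
- by move=> A mA; rewrite -normal_pdf01.
Qed.

Lemma integral_npdf : (\int[leb]_x (npdf x)%:E = 1)%E.
Proof. by rewrite -normal_pdf01 integral_normal_pdf. Qed.

End normal.

Section normal_convolution.
Context {R : realType}.
Local Notation RR := (measurableTypeR R).
Local Notation leb := (@lebesgue_measure R).
Local Notation gN := (@gN R).
Local Notation npdf := (@npdf R).

Lemma measurable_EFin_npdf : measurable_fun [set: RR] (fun x => (npdf x)%:E).
Proof. by apply/measurable_EFinP; exact: measurable_npdf. Qed.

Lemma mfun_aff (f : RR -> \bar R) a b : measurable_fun [set: RR] f ->
  measurable_fun [set: RR] (fun x : RR => f (a * x + b)).
Proof. by move=> mf; exact: (measurableT_comp mf (measurable_affine a b)). Qed.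

Lemma mfun_scale (f : RR -> \bar R) a : measurable_fun [set: RR] f ->
  measurable_fun [set: RR] (fun x : RR => f (a * x)).
Proof.
move=> /(mfun_aff a 0); apply: eq_measurable_fun => x _; by rewrite addr0.
Qed.

Lemma integral_gN_opp (f : RR -> \bar R) :
  measurable_fun [set: RR] f -> (forall x, 0 <= f x)%E ->
  (\int[gN]_x f (- x)%R = \int[gN]_x f x)%E.
Proof.
move=> mf f0.
have mfN : measurable_fun [set: RR] (fun x : RR => f (- x)).
  by move/(mfun_scale (-1)) : mf; apply: eq_measurable_fun => x _; rewrite mulN1r.
rewrite !integral_gN// -[RHS]lebesgue_integralN.
- by apply: eq_integral => x _; rewrite !npdfE sqrrN.
- by apply: emeasurable_funM => //; exact: measurable_EFin_npdf.
- by move=> x; rewrite mule_ge0// lee_fin npdf_ge0.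
Qed.

Lemma integral_gN_scale (f : RR -> \bar R) a :
  measurable_fun [set: RR] f -> (forall x, 0 <= f x)%E ->
  (\int[gN]_x f (a * x)%R = \int[gN]_x f (`|a| * x)%R)%E.
Proof.
move=> mf f0; have [a0|a0] := leP 0 a; first by rewrite ger0_norm.
rewrite ltr0_norm//.
rewrite -[RHS]integral_gN_opp//; last exact: mfun_scale.
by apply: eq_integral => x _; rewrite mulNr mulrN opprK.
Qed.

(** Rotation invariance of the planar Gaussian. Here [k x z] is the joint density of [x] and
    [z = a x + b y]; after exchanging the integrals, integrating out [x] has to leave [npdf z]. *)
Lemma conv_unit (F : RR -> \bar R) (a b : R) :
  measurable_fun [set: RR] F -> (forall x, 0 <= F x)%E ->
  a ^+ 2 + b ^+ 2 = 1 -> 0 < b ->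
  (\int[gN]_x \int[gN]_y F (a * x + b * y)%R = \int[gN]_z F z)%E.
Proof.
move=> mF F0 ab1 b0.
have bn0 : b != 0 by exact: lt0r_neq0.
pose k (x z : R) := (npdf x * npdf ((z - a * x) / b) / b)%:E.
have k0 x z : (0 <= k x z)%E.
  by rewrite lee_fin; apply: divr_ge0; [apply: mulr_ge0; exact: npdf_ge0|exact: ltW].
have mk : measurable_fun [set: RR * RR] (fun xz => k xz.1 xz.2).
  apply/measurable_EFinP; apply: measurable_funM => //; apply: measurable_funM.
    exact: (measurableT_comp measurable_npdf measurable_fst).
  apply: (measurableT_comp measurable_npdf); apply: measurable_funM => //.
  apply: measurable_funB; first exact: measurable_snd.
  by apply: measurable_funM => //; exact: measurable_fst.
have mFk : measurable_fun [set: RR * RR] (fun xz => F xz.2 * k xz.1 xz.2)%E.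
  by apply: emeasurable_funM => //; exact: (measurableT_comp mF measurable_snd).
transitivity (\int[leb]_x \int[leb]_z (F z * k x z))%E.
  rewrite integral_gN; last 2 first.
    apply: (measurable_fun_fubini_tonelli_F (m2 := gN)
      (fun xy : RR * RR => F (a * xy.1 + b * xy.2)%R)) => //.
    apply: (measurableT_comp mF); apply: measurable_funD; apply: measurable_funM => //.
    by move=> x; apply: integral_ge0.
  apply: eq_integral => x _; rewrite integral_gN//; last first.
    by move: (mfun_aff b (a * x) mF); apply: eq_measurable_fun => y _; rewrite addrC.
  rewrite -ge0_integralZr//; last 3 first.
  - apply: emeasurable_funM; last exact: measurable_EFin_npdf.
    by move: (mfun_aff b (a * x) mF); apply: eq_measurable_fun => y _; rewrite addrC.
  - by move=> y _; rewrite mule_ge0// lee_fin npdf_ge0.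
  - by rewrite lee_fin npdf_ge0.
  rewrite -[RHS](@integral_affine _ b (a * x))//; last 2 first.
  - exact: (measurableT_comp mFk (measurable_pair1 x)).
  - by move=> z; rewrite mule_ge0.
  rewrite -ge0_integralZl//; last 3 first.
  - apply: (mfun_aff b (a * x) (f := fun z => F z * k x z)%E).
    exact: (measurableT_comp mFk (measurable_pair1 x)).
  - by move=> z _; rewrite mule_ge0.
  - by rewrite lee_fin ltW.
  apply: eq_integral => y _; rewrite /k (addrC (b * y)) addrAC subrr add0r.
  have -> : b * y / b = y by field.
  rewrite muleCA -!muleA; congr (_ * _)%E.
  by rewrite -!EFinM; congr EFin; field.
rewrite (fubini_tonelli (m1 := leb) (m2 := leb) (fun xz => F xz.2 * k xz.1 xz.2)%E)//; last first.
  by move=> [x z]; rewrite mule_ge0.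
rewrite integral_gN//; apply: eq_integral => z _ /=.
rewrite ge0_integralZl//; last exact: (measurableT_comp mk (measurable_pair2 z)).
congr (_ * _)%E.
(* Substituting [b x + a z] for [x] completes the rotation: [(b x + a z)^2 + (b z - a x)^2 = z^2 +
   x^2], so the kernel splits as [npdf z * npdf x]. *)
rewrite -(@integral_affine _ b (a * z))//; last exact: (measurableT_comp mk (measurable_pair2 z)).
transitivity (b%:E * \int[leb]_x ((npdf z / b)%:E * (npdf x)%:E))%E.
  congr (_ * _)%E; apply: eq_integral => x _; rewrite /k -EFinM; congr EFin.
  have -> : (z - a * (b * x + a * z)) / b = b * z - a * x.
    have -> : z - a * (b * x + a * z) = (1 - a ^+ 2) * z - a * b * x by ring.
    by rewrite -ab1 addrAC subrr add0r; field.
  rewrite [RHS]mulrAC; congr (_ / _).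
  rewrite !npdfE mulrACA [RHS]mulrACA; congr (_ * _); rewrite -!expRD; congr expR.
  have -> : - z ^+ 2 / 2 + - x ^+ 2 / 2 = - (a ^+ 2 + b ^+ 2) * (z ^+ 2 + x ^+ 2) / 2.
    by rewrite ab1; field.
  by field.
rewrite ge0_integralZl//; last 3 first.
- exact: measurable_EFin_npdf.
- by move=> x _; rewrite lee_fin npdf_ge0.
- by rewrite lee_fin divr_ge0// ?npdf_ge0// ltW.
by rewrite integral_npdf mule1 -EFinM; congr EFin; rewrite mulrC divfK.
Qed.
End normal_convolution.

Section normal_projection.
Context {R : realType}.
Local Notation RR := (measurableTypeR R).
Local Notation leb := (@lebesgue_measure R).
Local Notation gN := (@gN R).
Local Notation npdf := (@npdf R).

Lemma integral_probc d0 (T : measurableType d0) (P : probability T R) (c : \bar R) :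
  (\int[P]_x c = c)%E.
Proof.
rewrite integral_cst//; apply: etrans (mule1 c); congr (_ * _)%E.
exact: (@probability_setT _ _ _ P).
Qed.

Lemma conv_gN (F : RR -> \bar R) (a b : R) :
  measurable_fun [set: RR] F -> (forall x, 0 <= F x)%E -> 0 <= b ->
  (\int[gN]_x \int[gN]_y F (a * x + b * y)%R =
   \int[gN]_z F (Num.sqrt (a ^+ 2 + b ^+ 2) * z)%R)%E.
Proof.
move=> mF F0; rewrite le_eqVlt => /predU1P[<-|b0].
  rewrite expr0n addr0 sqrtr_sqr -integral_gN_scale//.
  apply: eq_integral => x _; under eq_integral do rewrite mul0r addr0.
  exact: integral_probc.
set s := Num.sqrt _.
have s2 : s ^+ 2 = a ^+ 2 + b ^+ 2.
  by rewrite sqr_sqrtr// addr_ge0// sqr_ge0.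
have s0 : 0 < s by rewrite sqrtr_gt0 ltr_wpDl ?sqr_ge0// exprn_gt0.
have sn0 : s != 0 by exact: lt0r_neq0.
rewrite -(@conv_unit _ (fun z => F (s * z)) (a / s) (b / s)).
- apply: eq_integral => x _; apply: eq_integral => y _.
  by congr F; field.
- exact: mfun_scale.
- by [].
- by rewrite !expr_div_n -mulrDl -s2 divff// expf_neq0.
- exact: divr_gt0.
Qed.

Definition dotT d (v : 'I_d -> R) (g : d.-tuple RR) : RR := \sum_(j < d) v j * tnth g j.
Definition nrm2 d (v : 'I_d -> R) : R := \sum_(j < d) v j ^+ 2.

Lemma nrm2_ge0 d (v : 'I_d -> R) : 0 <= nrm2 v.
Proof. by apply: sumr_ge0 => j _; exact: sqr_ge0. Qed.

Lemma measurable_dotT d (v : 'I_d -> R) : measurable_fun [set: d.-tuple RR] (dotT v).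
Proof.
apply: (@measurable_sum _ _ _ _ _ _ (fun j g => v j * tnth g j)) => j.
apply: measurable_funM => //; exact: measurable_tnth.
Qed.

(** Adding one coordinate at a time, [conv_gN] merges two independent Gaussians into one. All later
    estimates on projections of a block become one-dimensional through this lemma. *)
Lemma integral_gV_dot d (v : 'I_d -> R) (F : RR -> \bar R) :
  measurable_fun [set: RR] F -> (forall x, 0 <= F x)%E ->
  (\int[gV d]_g F (dotT v g) = \int[gN]_x F (Num.sqrt (nrm2 v) * x)%R)%E.
Proof.
elim: d v F => [|d IH] v F mF F0.
  rewrite /gV integral_iid0 /dotT /nrm2 !big_ord0 sqrtr0.
  under eq_integral do rewrite mul0r.
  by rewrite !integral_probc.
rewrite /gV integral_iidS//; last exact: (measurableT_comp mF (measurable_dotT v)).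
transitivity (\int[gN]_x \int[gN]_y
    F (v ord0 * x + Num.sqrt (nrm2 (fun j => v (lift ord0 j))) * y)%R)%E.
  apply: eq_integral => x _.
  rewrite -(IH (fun j => v (lift ord0 j)) (fun y => F (v ord0 * x + y)%R))//; last first.
    by move: (mfun_aff 1 (v ord0 * x) mF); apply: eq_measurable_fun => y _;
      rewrite mul1r addrC.
  apply: eq_integral => g _; congr F.
  by rewrite /dotT big_ord_recl tnth0; congr (_ + _); apply: eq_bigr => j _; rewrite tnthS.
rewrite conv_gN ?sqrtr_ge0// sqr_sqrtr ?nrm2_ge0//.
by rewrite /nrm2 big_ord_recl.
Qed.

(** The Cameron-Martin formula: completing the square turns a translation into an exponential
    weight. *)
Lemma integral_gN_shift (F : RR -> \bar R) (a : R) :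
  measurable_fun [set: RR] F -> (forall x, 0 <= F x)%E ->
  (\int[gN]_x F (x + a)%R = \int[gN]_x (F x * (expR (a * x - a ^+ 2 / 2))%:E))%E.
Proof.
move=> mF F0.
have mFa : measurable_fun [set: RR] (fun x : RR => F (x + a)).
  by move: (mfun_aff 1 a mF); apply: eq_measurable_fun => y _; rewrite mul1r.
have me : measurable_fun [set: RR] (fun x : RR => (expR (a * x - a ^+ 2 / 2))%:E).
  apply/measurable_EFinP; apply: measurableT_comp => //.
  by apply: measurable_funB => //; exact: measurable_funM.
have mp := @measurable_EFin_npdf R.
rewrite !integral_gN//; last 2 first.
- exact: emeasurable_funM.
- by move=> x; rewrite mule_ge0// lee_fin expR_ge0.
rewrite -[RHS](@integral_affine _ 1 a)//; last 2 first.
- by apply: emeasurable_funM => //; exact: emeasurable_funM.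
- by move=> x; rewrite !mule_ge0// lee_fin ?expR_ge0// npdf_ge0.
rewrite mul1e; apply: eq_integral => x _; rewrite mul1r -muleA; congr (_ * _)%E.
rewrite -EFinM; congr EFin; rewrite !npdfE mulrCA -expRD; congr (_ * expR _).
by field.
Qed.

Lemma integral_gN_expsq (c : R) : c < 1 / 2 ->
  (\int[gN]_x (expR (c * x ^+ 2))%:E = ((Num.sqrt (1 - 2 * c))^-1)%:E)%E.
Proof.
move=> c12; set s := Num.sqrt _.
have s0 : 0 < s by rewrite sqrtr_gt0; lra.
have s2 : s ^+ 2 = 1 - 2 * c by rewrite sqr_sqrtr//; lra.
have me : measurable_fun [set: RR] (fun x : RR => (expR (c * x ^+ 2))%:E).
  apply/measurable_EFinP; apply: measurableT_comp => //.
  by apply: measurable_funM => //; exact: measurable_funX.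
rewrite integral_gN//.
set I := (\int[leb]_x _)%E.
suff sI : (s%:E * I = 1)%E.
  have := congr1 (fun x => (s^-1)%:E * x)%E sI.
  by rewrite muleA -EFinM mulVf ?lt0r_neq0// mul1e mule1.
rewrite -(@integral_npdf R) -[RHS](@integral_affine _ s 0)//; last 2 first.
- exact: measurable_EFin_npdf.
- by move=> x; rewrite lee_fin npdf_ge0.
congr (_ * _)%E; apply: eq_integral => x _; rewrite addr0 -EFinM; congr EFin.
rewrite !npdfE mulrCA -expRD; congr (_ * expR _).
by rewrite exprMn s2; field.
Qed.
End normal_projection.

(** * Concentration for i.i.d. blocks *)

Section markov.
Context {d} {T : measurableType d} {R : realType} (P : probability T R).

Lemma markov_ineq (f : T -> R) (x : R) : measurable_fun [set: T] f ->
  (forall t, 0 <= f t) -> 0 < x ->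
  (P [set t | (x <= f t)%R] <= (x^-1)%:E * \int[P]_t (f t)%:E)%E.
Proof.
move=> mf f0 x0.
have mS : measurable [set t | x <= f t].
  have := mf measurableT `[x, +oo[%classic (measurable_itv _).
  by rewrite setTI; congr measurable; apply/seteqP; split=> t /=; rewrite in_itv/= andbT.
rewrite -ge0_integralZl//; last 3 first.
- exact/measurable_EFinP.
- by move=> t _; rewrite lee_fin.
- by rewrite lee_fin invr_ge0 ltW.
rewrite -[X in P X]setIT -integral_indic//.
apply: ge0_le_integral => //.
- by apply/measurable_EFinP; exact: measurable_indic.
- by apply/measurable_EFinP; exact: measurable_funM.
move=> t _; rewrite -EFinM lee_fin indicE.
have [|_]/= := boolP (t \in _); last by rewrite mulr_ge0// invr_ge0 ltW.
by rewrite inE/= => h; rewrite mulrC ler_pdivlMr// mul1r.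
Qed.

End markov.

Section chernoff.
Context {d} {T : measurableType d} {R : realType} (P : probability T R).

(** Markov's inequality for the exponential of the sum; samples outside [I] contribute the factor 1
    to the product. *)
Lemma chernoff_iid n (I : {set 'I_n}) (h : T -> R) (k x : R) :
  measurable_fun [set: T] h -> (\int[P]_t (expR (h t))%:E <= (expR k)%:E)%E ->
  (iid P n [set t | (x <= \sum_(i in I) h (tnth t i))%R] <= (expR (k *+ #|I| - x))%:E)%E.
Proof.
move=> mh hk.
pose f (i : 'I_n) (t : T) : R := if i \in I then expR (h t) else 1.
have mf i : measurable_fun [set: T] (f i).
  by rewrite /f; case: (i \in I) => //; exact: measurableT_comp.
have f0 i t : 0 <= f i t by rewrite /f; case: (i \in I) => //; exact: expR_ge0.
have fE t : \prod_(i < n) f i (tnth t i) = expR (\sum_(i in I) h (tnth t i)).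
  by rewrite expR_sum [RHS]big_mkcond/=; apply: eq_bigr => i _; rewrite /f.
have -> : [set t | x <= \sum_(i in I) h (tnth t i)] =
          [set t : n.-tuple T | expR x <= \prod_(i < n) f i (tnth t i)].
  by apply/seteqP; split=> t /=; rewrite fE ler_expR.
have f0' t : 0 <= \prod_(i < n) f i (tnth t i) by rewrite prodr_ge0.
apply: (le_trans (markov_ineq (iid P n) (measurable_prod_tnth mf) f0' (expR_gt0 x))).
rewrite integral_iid_prod// expRD mulrC EFinM -expRN; apply: lee_pmul => //.
- by apply: prode_ge0 => i _; apply: integral_ge0 => t _; rewrite lee_fin.
have -> : (expR (k *+ #|I|))%:E = (\prod_(i < n) (if i \in I then expR k else 1)%:E)%E.
  rewrite prodEFin; congr EFin.
  by rewrite -big_mkcond/= prodr_const -expRM_natr mulr_natr.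
(* Products of extended reals are monotone only on nonnegative factors, so the induction carries the
   sign along with the inequality. *)
pose K (x y : \bar R) := (0 <= x)%E /\ (x <= y)%E.
suff [] : K (\prod_(i < n) \int[P]_t (f i t)%:E)%E
            (\prod_(i < n) (if i \in I then expR k else 1)%:E)%E by [].
apply: (big_ind2 K) => //.
- move=> x1 x2 y1 y2 [p1 q1] [p2 q2]; split; [exact: mule_ge0|exact: lee_pmul].
move=> i _; split; first by apply: integral_ge0 => t _; rewrite lee_fin.
rewrite /f; case: (i \in I) => //.
by rewrite integral_probc.
Qed.
End chernoff.

Section normal_events.
Context {R : realType}.
Local Notation RR := (measurableTypeR R).
Local Notation leb := (@lebesgue_measure R).
Local Notation gN := (@gN R).
Local Notation gV := (@gV R).
Local Notation gB := (@gB R).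
Local Notation npdf := (@npdf R).

(** [normal_peak 1] is [1 / sqrt (2 pi)]; the crude bounds 1/2 and 1/3 follow from [2 <= pi < 4]. *)
Lemma peak_le : normal_peak (1 : R) <= 1 / 2.
Proof.
rewrite /normal_peak expr1n mul1r div1r lef_pV2 ?posrE ?sqrtr_gt0//; last first.
  by rewrite mulrn_wgt0// pi_gt0.
rewrite [X in X <= _](_ : 2 = Num.sqrt (2 ^+ 2)); last by rewrite sqrtr_sqr ger0_norm.
rewrite ler_sqrt; last by rewrite mulrn_wge0// pi_ge0.
by have := @pi_ge2 R; lra.
Qed.

Lemma peak_ge : 1 / 3 <= normal_peak (1 : R).
Proof.
rewrite /normal_peak expr1n !mul1r lef_pV2 ?posrE ?sqrtr_gt0//; last first.
  by rewrite mulrn_wgt0// pi_gt0.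
rewrite [X in _ <= X](_ : 3 = Num.sqrt (3 ^+ 2)); last by rewrite sqrtr_sqr ger0_norm.
by rewrite ler_sqrt//; have := @pihalf_lt2 R; lra.
Qed.

Lemma gN_density A : gN A = (\int[leb]_(x in A) (npdf x)%:E)%E.
Proof. by rewrite -normal_pdf01. Qed.

Lemma npdf_le x : npdf x <= 1 / 2.
Proof.
apply: le_trans peak_le; rewrite !npdfE ler_piMr ?normal_peak_ge0//.
rewrite expR_le1; have := sqr_ge0 x; lra.
Qed.

Lemma gN_itv_le (a b : R) : a <= b -> (gN `[a, b]%classic <= ((b - a) / 2)%:E)%E.
Proof.
move=> ab; rewrite gN_density.
apply: (@le_trans _ _ (\int[leb]_(x in `[a, b]) (1 / 2)%:E))%E.
  apply: ge0_le_integral => //.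
  - by move=> x _; rewrite lee_fin npdf_ge0.
  - by apply: measurable_funTS; exact: measurable_EFin_npdf.
  - by move=> x _; rewrite lee_fin npdf_le.
rewrite integral_cst//= lebesgue_measure_itv/= lte_fin.
case: ifPn => _; first by rewrite -EFinB -EFinM lee_fin; lra.
by rewrite mule0 lee_fin; lra.
Qed.

Lemma gN_itv_ge (a b M : R) : a <= b -> (forall x, a <= x <= b -> `|x| <= M) ->
  (((b - a) / 3 * expR (- M ^+ 2 / 2))%:E <= gN `[a, b]%classic)%E.
Proof.
move=> ab abM; rewrite gN_density.
apply: (@le_trans _ _ (\int[leb]_(x in `[a, b]) (1 / 3 * expR (- M ^+ 2 / 2))%:E))%E; last first.
  apply: ge0_le_integral => //.
  - by apply: measurable_funTS; exact: measurable_EFin_npdf.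
  - move=> x /= xab; rewrite lee_fin ler_pM ?expR_ge0 ?peak_ge//.
    rewrite ler_expR; have := abM x; rewrite in_itv/= in xab => /(_ xab) h.
    have : x ^+ 2 <= M ^+ 2 by rewrite -real_normK ?num_real// lerXn2r ?nnegrE// (le_trans _ h).
    lra.
rewrite integral_cst//= lebesgue_measure_itv/= lte_fin.
case: ifPn => [_|]; first by rewrite -EFinB -EFinM lee_fin; lra.
rewrite -leNgt => ba. have -> : b - a = 0 by lra. rewrite !mul0r. by rewrite mule0.
Qed.

Lemma gN_small (s : R) : 0 <= s -> (gN [set x | (`|x| <= s)%R] <= s%:E)%E.
Proof.
move=> s0; rewrite (_ : [set x | _] = `[- s, s]%classic); last first.
  by apply/seteqP; split=> x /=; rewrite in_itv/= ler_norml.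
by apply: (le_trans (gN_itv_le _)); rewrite ?lee_fin; lra.
Qed.

Lemma gV_dot_set d (v : 'I_d -> R) (S : set RR) : measurable S ->
  gV d [set g | S (dotT v g)] = gN [set x | S (Num.sqrt (nrm2 v) * x)].
Proof.
move=> mS.
have m1 : measurable [set g : d.-tuple RR | S (dotT v g)].
  by rewrite -[X in measurable X]setTI; exact: (measurable_dotT v).
have m2 : measurable [set x : RR | S (Num.sqrt (nrm2 v) * x)].
  rewrite -[X in measurable X]setTI.
  have : measurable_fun [set: RR] (fun x : RR => Num.sqrt (nrm2 v) * x : RR).
    exact: measurable_funM.
  by apply.
rewrite -[X in gV d X]setIT -[X in gN X]setIT -!integral_indic//.
have := @integral_gV_dot _ d v (fun x => (\1_S x)%:E).
rewrite /indic /= => -> //; first exact/measurable_EFinP/measurable_indic.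
Qed.

Lemma gB_fst d (S : set (d.-tuple RR)) : measurable S ->
  gB d [set z | S z.1] = gV d S.
Proof.
move=> mS; rewrite (_ : [set z | _] = S `*` setT).
  apply: (etrans (product_measure1E (gV d) gN mS measurableT)).
  apply: etrans (mule1 _); congr (_ * _)%E; exact: (@probability_setT _ _ _ gN).
by apply/seteqP; split=> z //= [].
Qed.

Lemma gB_snd d (S : set RR) : measurable S ->
  gB d [set z | S z.2] = gN S.
Proof.
move=> mS; rewrite (_ : [set z | _] = setT `*` S).
  apply: (etrans (product_measure1E (gV d) gN measurableT mS)).
  apply: etrans (mul1e _); congr (_ * _)%E; exact: (@probability_setT _ _ _ (gV d)).
by apply/seteqP; split=> z //= [].
Qed.

Lemma measurable_dot_le d (v : 'I_d -> R) s :
  measurable [set g : d.-tuple RR | `|dotT v g| <= s].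
Proof.
rewrite -[X in measurable X]setTI.
have m : measurable_fun [set: d.-tuple RR] (fun g => `|dotT v g|).
  by apply: measurableT_comp => //; exact: measurable_dotT.
by have := m measurableT `]-oo, s]%classic (measurable_itv _);
  congr measurable; apply/seteqP; split=> t /=; rewrite in_itv.
Qed.

(** The hypothesis [1 / 4 <= nrm2 v], recurring below, stands in for [nrm2 v = 1]: net points
    approximating a unit vector only have norm at least 1/2. *)
Lemma gV_small d (v : 'I_d -> R) s : 0 <= s -> 1 / 4 <= nrm2 v ->
  (gV d [set g | (`|dotT v g| <= s)%R] <= (2 * s)%:E)%E.
Proof.
move=> s0 v4; have mS : measurable [set x : RR | (`|x| <= s)%R].
  rewrite (_ : [set x | _] = `[- s, s]%classic); first exact: measurable_itv.
  by apply/seteqP; split=> x /=; rewrite in_itv/= ler_norml.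
rewrite (gV_dot_set v mS).
have r2 : 1 / 2 <= Num.sqrt (nrm2 v).
  rewrite [X in X <= _](_ : 1 / 2 = Num.sqrt ((1 / 2) ^+ 2)); last first.
    by rewrite sqrtr_sqr ger0_norm.
  by rewrite ler_sqrt ?nrm2_ge0//; apply: le_trans v4; lra.
apply: (@le_trans _ _ (gN [set x | (`|x| <= 2 * s)%R])); last by apply: gN_small; lra.
apply: le_measure; rewrite ?inE.
- rewrite -[X in measurable X]setTI.
  have : measurable_fun [set: RR] (fun x : RR => Num.sqrt (nrm2 v) * x : RR).
    exact: measurable_funM.
  by move/(_ measurableT _ mS).
- rewrite (_ : [set x | _] = `[- (2 * s), 2 * s]%classic); first exact: measurable_itv.
  by apply/seteqP; split=> x /=; rewrite in_itv/= ler_norml.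
- move=> x /=; rewrite normrM ger0_norm ?sqrtr_ge0// => h.
  have : 1 / 2 * `|x| <= Num.sqrt (nrm2 v) * `|x| by rewrite ler_wpM2r.
  lra.
Qed.

End normal_events.

Section sets.
Context {R : realType} {d0} {T : measurableType d0}.

Lemma measurable_set_le (f g : T -> R) : measurable_fun [set: T] f ->
  measurable_fun [set: T] g -> measurable [set t | f t <= g t].
Proof.
move=> mf mg; have m := measurable_funB mg mf.
have := m measurableT `[0, +oo[%classic (measurable_itv _); rewrite setTI.
by congr measurable; apply/seteqP; split=> t /=; rewrite in_itv/= andbT subr_ge0.
Qed.

Lemma measurable_set_lt (f g : T -> R) : measurable_fun [set: T] f ->
  measurable_fun [set: T] g -> measurable [set t | f t < g t].
Proof.
move=> mf mg; rewrite (_ : [set t | _] = ~` [set t | g t <= f t]).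
  exact/measurableC/measurable_set_le.
by apply/seteqP; split=> t /=; [move=> h; apply/negP; rewrite -ltNge|move/negP; rewrite -ltNge].
Qed.

Lemma integral_setb (mu : {measure set T -> \bar R}) (b : T -> bool) :
  measurable [set t | b t] -> (\int[mu]_t ((b t)%:R : R)%:E = mu [set t | b t])%E.
Proof.
move=> mb; rewrite -[in RHS](setIT [set t | b t]) -integral_indic//.
apply: eq_integral => t _; rewrite indicE.
by rewrite (_ : (t \in _) = b t)//; apply/idP/idP; rewrite inE.
Qed.

Lemma measurable_fun_setb (b : T -> bool) :
  measurable [set t | b t] -> measurable_fun [set: T] (fun t => (b t)%:R : R).
Proof.
move=> mb; have := @measurable_indic _ T R setT _ mb.
apply: eq_measurable_fun => t _; rewrite indicE.
by rewrite (_ : (t \in _) = b t)//; apply/idP/idP; rewrite inE.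
Qed.

End sets.

Section half_probability.
Context {R : realType} {d0} {T : measurableType d0} (P : probability T R).

Lemma probability_half (A A' Z : set T) : measurable A -> measurable Z ->
  P A = P A' -> A' = ~` A `|` Z -> ~` A `&` Z = set0 -> P Z = 0%E ->
  P A = (1 / 2)%:E.
Proof.
move=> mA mZ AA' A'E AZ PZ.
have h : P A' = P (~` A).
  rewrite A'E measureU//; last exact: measurableC.
  by rewrite -[RHS]adde0; congr (_ + _)%E.
move: h; rewrite -AA' probability_setC// -[P A]fineK; last exact: fin_num_measure.
rewrite -EFinB => -[] e; congr EFin; lra.
Qed.

End half_probability.

(** * Signs of a block along a direction: probabilities and exponential moments *)

Section block_signs.
Context {R : realType}.
Local Notation RR := (measurableTypeR R).
Local Notation leb := (@lebesgue_measure R).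
Local Notation gN := (@gN R).
Local Notation gV := (@gV R).
Local Notation gB := (@gB R).
Context (d : nat).
Local Notation U := (d.-tuple RR * RR)%type.
Implicit Types v : 'I_d -> R.

Lemma measurable_dotU v : measurable_fun [set: U] (fun z : U => dotT v z.1).
Proof. exact: (measurableT_comp (measurable_dotT v) measurable_fst). Qed.

Lemma measurable_sndU : measurable_fun [set: U] (fun z : U => z.2 : R).
Proof. exact: measurable_snd. Qed.

Lemma integral_gB (f : U -> \bar R) : measurable_fun [set: U] f ->
  (forall z, 0 <= f z)%E -> (\int[gB d]_z f z = \int[gV d]_g \int[gN]_y f (g, y))%E.
Proof. by move=> mf f0; exact: (fubini_tonelli1 f mf f0). Qed.

Lemma integral_gB_flip (f : U -> \bar R) : measurable_fun [set: U] f ->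
  (forall z, 0 <= f z)%E -> (\int[gB d]_z f (z.1, (- z.2)%R) = \int[gB d]_z f z)%E.
Proof.
move=> mf f0; rewrite (integral_gB mf f0) integral_gB; last by move=> z; exact: f0.
  apply: eq_integral => g _; rewrite -[RHS]integral_gN_opp//.
  exact: (measurableT_comp mf (measurable_pair1 g)).
apply: (measurableT_comp mf); apply: measurable_fun_pair; first exact: measurable_fst.
have mN : measurable_fun [set: RR] (fun y : RR => - y : RR) by exact: oppr_measurable.
exact: (measurableT_comp mN measurable_snd).
Qed.

(** For a clean sample and the true regression vector the residual is [sigma * xi], so this is the
    indicator summed by the regression depth, in whitened coordinates. *)
Definition sgnb v (z : U) : bool := 0 <= z.2 * dotT v z.1.

Lemma measurable_sgnb v : measurable [set z | sgnb v z].
Proof.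
apply: measurable_set_le => //; apply: measurable_funM; first exact: measurable_sndU.
exact: measurable_dotU.
Qed.

Lemma gB_sgn0 v : 0 < nrm2 v -> gB d [set z : U | z.2 * dotT v z.1 = 0] = 0%E.
Proof.
move=> v0; apply/eqP; rewrite eq_le measure_ge0 andbT.
have m0 : measurable [set x : RR | (`|x| <= 0)%R].
  by apply: measurable_set_le => //; apply: measurableT_comp.
have gN0 : gN [set x | (`|x| <= 0)%R] = 0%E.
  by apply/eqP; rewrite eq_le measure_ge0 andbT; exact: gN_small.
have m1 : measurable [set z : U | `|z.2| <= 0].
  by apply: measurable_set_le => //; apply: measurableT_comp => //; exact: measurable_sndU.
have m2' : measurable [set g : d.-tuple RR | `|dotT v g| <= 0].
  by apply: measurable_set_le => //; apply: measurableT_comp => //; exact: measurable_dotT.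
have m2 : measurable [set z : U | `|dotT v z.1| <= 0].
  by apply: measurable_set_le => //; apply: measurableT_comp => //; exact: measurable_dotU.
apply: (@le_trans _ _ (gB d ([set z : U | (`|z.2| <= 0)%R] `|` [set z : U | (`|dotT v z.1| <= 0)%R]))).
  apply: le_measure; rewrite ?inE.
  - rewrite (_ : [set z : U | z.2 * dotT v z.1 = 0] = [set z : U | `|z.2 * dotT v z.1| <= 0]).
      apply: measurable_set_le => //; apply: measurableT_comp => //; apply: measurable_funM; [exact: measurable_sndU|exact: measurable_dotU].
    by apply/seteqP; split=> z /=; rewrite normr_le0 => /eqP.
  - exact: measurableU.
  - by move=> z /= /eqP; rewrite mulf_eq0 !normr_le0 => /orP.
apply: (le_trans (measureU2 _ _ _)) => //.
have z1 : gB d [set z : U | (`|z.2| <= 0)%R] = 0%E by apply: (etrans (gB_snd d m0)).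
have z2 : gB d [set z : U | (`|dotT v z.1| <= 0)%R] = 0%E.
  apply: (etrans (gB_fst m2')); apply: (etrans (gV_dot_set v m0)).
  rewrite -gN0; congr (gN _).
  apply/seteqP; split=> x /=; rewrite !normr_le0.
    by rewrite mulf_eq0 gt_eqF//= sqrtr_gt0.
  by move/eqP=> ->; rewrite mulr0.
rewrite -[X in (_ <= X)%E](adde0 0%E); apply: leeD; rewrite le_eqVlt; apply/orP; left; apply/eqP.
  exact: z1.
exact: z2.
Qed.

(** Negating the noise preserves the law and turns the event into its complement, up to the null set
    where the product vanishes. *)
Lemma gB_half v : 0 < nrm2 v -> gB d [set z | sgnb v z] = (1 / 2)%:E.
Proof.
move=> v0.
set A := [set z | sgnb v z].
have mA : measurable A by exact: measurable_sgnb.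
set A' := [set z : U | z.2 * dotT v z.1 <= 0].
have mm : measurable_fun [set: U] (fun z : U => z.2 * dotT v z.1).
  by apply: measurable_funM; [exact: measurable_sndU|exact: measurable_dotU].
have mA' : measurable A' by exact: measurable_set_le.
have AA' : gB d A = gB d A'.
  have e1 : (\int[gB d]_z ((sgnb v z)%:R : R)%:E = gB d A)%E := integral_setb _ mA.
  have me1 : measurable_fun [set: U] (fun z => ((sgnb v z)%:R : R)%:E).
    by apply/measurable_EFinP; exact: measurable_fun_setb.
  have e1p z : (0 <= ((sgnb v z)%:R : R)%:E)%E by rewrite lee_fin.
  rewrite -e1 -(integral_gB_flip me1 e1p).
  pose b z := z.2 * dotT v z.1 <= 0.
  have e2 : (\int[gB d]_z ((b z)%:R : R)%:E = gB d A')%E := integral_setb _ mA'.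
  rewrite -e2; apply: eq_integral => z _; congr (_%:R)%:E.
  by rewrite /sgnb/= mulNr oppr_ge0.
have ZE : [set z : U | z.2 * dotT v z.1 = 0] = A `&` A'.
  apply/seteqP; split=> z; rewrite /A /A' /= /sgnb; first by move=> ->.
  by move=> [h1 h2]; apply/eqP; rewrite eq_le h1 h2.
have mZ : measurable [set z : U | z.2 * dotT v z.1 = 0].
  by rewrite ZE; exact: measurableI.
have A'E : A' = ~` A `|` [set z : U | z.2 * dotT v z.1 = 0].
  apply/seteqP; split=> z; rewrite /A' /A /= /sgnb.
    rewrite le_eqVlt => /predU1P[->|]; [by right|by left; apply/negP; rewrite -ltNge].
  by case=> [/negP|->//]; rewrite -ltNge => /ltW.
have AZ : ~` A `&` [set z : U | z.2 * dotT v z.1 = 0] = set0.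
  by rewrite ZE setIA setICl set0I.
exact: (probability_half mA mZ AA' A'E AZ (gB_sgn0 v0)).
Qed.
End block_signs.

Section block_moments.
Context {R : realType}.
Local Notation RR := (measurableTypeR R).
Local Notation gN := (@gN R).
Local Notation gV := (@gV R).
Local Notation gB := (@gB R).
Context (d : nat).
Local Notation U := (d.-tuple RR * RR)%type.
Implicit Types v : 'I_d -> R.

Lemma sqrt_half_inv_le : (Num.sqrt (1 - 2 * (1 / 4)) : R)^-1 <= 3 / 2.
Proof.
have h : (2 / 3 : R) <= Num.sqrt (1 - 2 * (1 / 4)).
  rewrite [X in X <= _](_ : 2 / 3 = Num.sqrt ((2 / 3) ^+ 2)); last first.
    by rewrite sqrtr_sqr ger0_norm.
  by rewrite ler_sqrt; lra.
rewrite (_ : 3 / 2 = (2 / 3)^-1); last by field.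
by rewrite lef_pV2 ?posrE//; lra.
Qed.

Lemma gN_exp4 : (\int[gN]_x (expR (1 / 4 * x ^+ 2))%:E <= (3 / 2)%:E)%E.
Proof. by rewrite integral_gN_expsq ?lee_fin ?sqrt_half_inv_le//; lra. Qed.

Lemma measurable_exp4 : measurable_fun [set: RR] (fun x : RR => (expR (1 / 4 * x ^+ 2))%:E).
Proof.
apply/measurable_EFinP; apply: measurableT_comp => //.
by apply: measurable_funM => //; exact: measurable_funX.
Qed.

(** Chebyshev's inequality. The second moment is bounded without computing it, from
    [x^2 <= 4 expR (x^2 / 4)] and [gN_exp4], whence the constant [6 = 4 * 3 / 2]. *)
Lemma gV_tail v (s : R) : 0 < s ->
  (gV d [set g | (s <= `|dotT v g|)%R] <= (6 * nrm2 v / s ^+ 2)%:E)%E.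
Proof.
move=> s0; have n0 := nrm2_ge0 v.
have mf : measurable_fun [set: d.-tuple RR] (fun g => dotT v g ^+ 2).
  by apply: measurable_funX; exact: measurable_dotT.
rewrite (_ : [set g | _] = [set g : d.-tuple RR | (s ^+ 2 <= dotT v g ^+ 2)%R]); last first.
  apply/seteqP; split=> g /=; rewrite -[dotT v g ^+ 2]real_normK ?num_real//.
    by move=> h; rewrite ler_sqr ?nnegrE// ltW.
  by rewrite ler_sqr ?nnegrE// ltW.
have s20 : 0 < s ^+ 2 by exact: exprn_gt0.
apply: (le_trans (markov_ineq (gV d) mf (fun g => sqr_ge0 _) s20)).
have -> : (\int[gV d]_g (dotT v g ^+ 2)%:E = \int[gN]_x ((Num.sqrt (nrm2 v) * x) ^+ 2)%:E)%E.
  apply: (@integral_gV_dot R d v (fun x => (x ^+ 2)%:E)).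
    by apply/measurable_EFinP; exact: measurable_funX.
  by move=> x; rewrite lee_fin sqr_ge0.
have h : (\int[gN]_x ((Num.sqrt (nrm2 v) * x) ^+ 2)%:E <= (6 * nrm2 v)%:E)%E.
  apply: (@le_trans _ _ (\int[gN]_x ((4 * nrm2 v)%:E * (expR (1 / 4 * x ^+ 2))%:E))%E).
    apply: ge0_le_integral => //.
    - by move=> x _; rewrite lee_fin sqr_ge0.
    - apply/measurable_EFinP; apply: measurable_funX; exact: measurable_funM.
    - by apply: emeasurable_funM => //; exact: measurable_exp4.
    - move=> x _; rewrite -EFinM lee_fin exprMn sqr_sqrtr//.
      have := expR_ge1Dx (1 / 4 * x ^+ 2); move=> e.
      have : nrm2 v * x ^+ 2 <= nrm2 v * (4 * expR (1 / 4 * x ^+ 2)).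
        by rewrite ler_wpM2l//; lra.
      lra.
  rewrite ge0_integralZl//; last 2 first.
  - exact: measurable_exp4.
  - by rewrite lee_fin mulr_ge0.
  apply: (@le_trans _ _ ((4 * nrm2 v)%:E * (3 / 2)%:E)%E).
    by apply: lee_wpmul2l; [rewrite lee_fin mulr_ge0|exact: gN_exp4].
  by rewrite -EFinM lee_fin; lra.
apply: (@le_trans _ _ (((s ^+ 2)^-1)%:E * (6 * nrm2 v)%:E)%E).
  by apply: lee_wpmul2l => //; rewrite lee_fin invr_ge0 ltW.
by rewrite -EFinM lee_fin mulrC.
Qed.

Lemma gV_exp v : (\int[gV d]_g (expR `|dotT v g|)%:E <= (expR (nrm2 v) * (3 / 2))%:E)%E.
Proof.
have n0 := nrm2_ge0 v.
have mabs : measurable_fun [set: RR] (fun x : RR => (expR `|x|)%:E).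
  by apply/measurable_EFinP; apply: measurableT_comp => //; exact: measurableT_comp.
have -> : (\int[gV d]_g (expR `|dotT v g|)%:E = \int[gN]_x (expR `|Num.sqrt (nrm2 v) * x|)%:E)%E.
  exact: (@integral_gV_dot R d v (fun x => (expR `|x|)%:E)).
apply: (@le_trans _ _ (\int[gN]_x ((expR (nrm2 v))%:E * (expR (1 / 4 * x ^+ 2))%:E))%E).
  apply: ge0_le_integral => //.
  - exact: (mfun_scale _ mabs).
  - by apply: emeasurable_funM => //; exact: measurable_exp4.
  - move=> x _; rewrite -EFinM lee_fin -expRD ler_expR normrM ger0_norm ?sqrtr_ge0//.
    have := sqr_ge0 (Num.sqrt (nrm2 v) - `|x| / 2).
    rewrite sqrrB sqr_sqrtr// expr_div_n real_normK ?num_real//.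
    by move=> h; nra.
rewrite ge0_integralZl//; last exact: measurable_exp4.
by rewrite EFinM; apply: lee_wpmul2l; [rewrite lee_fin expR_ge0|exact: gN_exp4].
Qed.

(** Signs along [v] and [v'] can differ only if the projection on [v] is at most [r] in absolute
    value (probability at most [2 r]) or the projection on [v' - v] is at least [r] (at most
    [6 r^4 / r^2 <= 6 r]). The fourth power balances the two. *)
Lemma gB_diff v v' (r : R) : 0 < r -> r <= 1 -> 1 / 4 <= nrm2 v ->
  nrm2 (fun j => v' j - v j) <= r ^+ 4 ->
  (gB d [set z | sgnb v' z != sgnb v z] <= (8 * r)%:E)%E.
Proof.
move=> r0 r1 v4 vv'.
pose D1 := [set g : d.-tuple RR | (`|dotT v g| <= r)%R].
pose D2 := [set g : d.-tuple RR | (r <= `|dotT (fun j => v' j - v j) g|)%R].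
have mD1 : measurable D1.
  by apply: measurable_set_le => //; apply: measurableT_comp => //; exact: measurable_dotT.
have mD2 : measurable D2.
  by apply: measurable_set_le => //; apply: measurableT_comp => //; exact: measurable_dotT.
have mU : measurable (D1 `|` D2) by exact: measurableU.
have mS : measurable [set z : U | (D1 `|` D2) z.1].
  by rewrite -[X in measurable X]setTI; exact: (measurable_fst).
have mD : measurable [set z : U | sgnb v' z != sgnb v z].
  rewrite (_ : [set z | _] = [set z : U | sgnb v' z] `\` [set z | sgnb v z] `|`
     ([set z : U | sgnb v z] `\` [set z | sgnb v' z])).
    by apply: measurableU; apply: measurableD; exact: measurable_sgnb.
  apply/seteqP; split=> z /=; case: (sgnb v' z); case: (sgnb v z) => //=; try by [left|right].
  - by case=> -[].
  - by case=> -[].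
apply: (@le_trans _ _ (gB d [set z : U | (D1 `|` D2) z.1])).
  apply: le_measure; rewrite ?inE// => z /= h.
  have dE : dotT v' z.1 = dotT v z.1 + dotT (fun j => v' j - v j) z.1.
    by rewrite /dotT -big_split/=; apply: eq_bigr => j _; rewrite mulrBl addrC subrK.
  rewrite /D1 /D2 /=; case: (leP `|dotT v z.1| r) => [|h1]; first by left.
  right; rewrite leNgt; apply/negP => h2; move: h; apply/negP; rewrite negbK /sgnb dE.
  set a := dotT v z.1 in h1 *; set b := dotT _ z.1 in h2 *.
  have [a0|a0] := ltP 0 a.
    have ab : 0 < a + b by move: h1 h2; rewrite gtr0_norm// ltr_norml => h1 /andP[h2 h3]; lra.
    by rewrite !pmulr_lge0.
  have a0' : a < 0.
    by rewrite lt_neqAle a0 andbT; apply/eqP => a00; rewrite a00 normr0 in h1; lra.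
  have ab : a + b < 0 by move: h1 h2; rewrite ltr0_norm// ltr_norml => h1 /andP[h2 h3]; lra.
  by rewrite !nmulr_lge0.
apply: (@le_trans _ _ (gV d (D1 `|` D2))).
  by rewrite le_eqVlt; apply/orP; left; apply/eqP; exact: (gB_fst mU).
apply: (le_trans (measureU2 _ mD1 mD2)).
apply: (@le_trans _ _ ((2 * r)%:E + (6 * nrm2 (fun j => v' j - v j) / r ^+ 2)%:E)%E).
  by apply: leeD; [apply: gV_small => //; exact: ltW|exact: gV_tail].
rewrite -EFinD lee_fin.
have : 6 * nrm2 (fun j => v' j - v j) / r ^+ 2 <= 6 * r ^+ 2.
  rewrite ler_pdivrMr ?exprn_gt0//.
  by rewrite (_ : 6 * r ^+ 2 * r ^+ 2 = 6 * r ^+ 4); [rewrite ler_wpM2l|ring].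
have : r ^+ 2 <= r by rewrite expr2 ler_piMr// ltW.
lra.
Qed.

End block_moments.

Section exp_bounds.
Context {R : realType}.
Implicit Types x : R.

Lemma expR_le_inv x : x < 1 -> expR x <= (1 - x)^-1.
Proof.
move=> x1; rewrite -[expR x]invrK lef_pV2 ?posrE ?invr_gt0 ?expR_gt0 ?subr_gt0//.
by rewrite -expRN; have := expR_ge1Dx (- x).
Qed.

Lemma expR_le_quad x : x <= 1 / 2 -> expR x <= 1 + x + 2 * x ^+ 2.
Proof.
move=> x2; apply: (le_trans (expR_le_inv _)); first by lra.
rewrite -[X in X <= _]mul1r ler_pdivrMr; last by lra.
have : 0 <= x ^+ 2 * (1 - 2 * x) by rewrite mulr_ge0 ?sqr_ge0//; lra.
nra.
Qed.

Lemma expR1_le4 : expR 1 <= 4 :> R.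
Proof.
have -> : (1 : R) = 1 / 2 + 1 / 2 by lra.
have h : expR (1 / 2) <= 2 :> R.
  by apply: (le_trans (expR_le_inv _)); [lra|rewrite (_ : 1 - 1 / 2 = 2^-1) ?invrK//; field].
rewrite expRD; have := expR_ge0 (1 / 2 : R); nra.
Qed.

Lemma expRN1_le : expR (- 1) <= 1 / 2 :> R.
Proof.
rewrite expRN div1r lef_pV2 ?posrE ?expR_gt0//.
by have := expR_ge1Dx (1 : R); lra.
Qed.

End exp_bounds.

Section exp_moments.
Context {R : realType} {d0} {T : measurableType d0} (P : probability T R).

Let mEb (b : T -> bool) (c : R) : measurable [set t | b t] ->
  measurable_fun [set: T] (fun t => (c * (b t)%:R)%:E).
Proof.
move=> mb; apply/measurable_EFinP; apply: measurable_funM => //.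
exact: measurable_fun_setb.
Qed.

Let intEb (b : T -> bool) (c : R) : 0 <= c -> measurable [set t | b t] ->
  (\int[P]_t (c * (b t)%:R)%:E = c%:E * P [set t | b t])%E.
Proof.
move=> c0 mb; under eq_integral do rewrite EFinM.
rewrite ge0_integralZl//; first by rewrite integral_setb.
by apply/measurable_EFinP; exact: measurable_fun_setb.
Qed.

(** Both events have the same probability [q], so the linear term of the exponential integrates to
    zero, and the quadratic term lives where the events disagree. The exponent is thus proportional
    to the disagreement probability [p], which drives the chaining. *)
Lemma exp_moment_diff (a b : T -> bool) (s p q : R) :
  measurable [set t | a t] -> measurable [set t | b t] ->
  P [set t | a t] = q%:E -> P [set t | b t] = q%:E ->
  (P [set t | b t != a t] <= p%:E)%E -> 0 <= s <= 1 / 2 ->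
  (\int[P]_t (expR (s * ((b t)%:R - (a t)%:R)))%:E <= (expR (2 * s ^+ 2 * p))%:E)%E.
Proof.
move=> ma mb Pa Pb Pab /andP[s0 s2].
have mab : measurable [set t | b t != a t].
  rewrite (_ : [set t | _] = [set t | b t] `\` [set t | a t] `|` ([set t | a t] `\` [set t | b t])).
    by apply: measurableU; exact: measurableD.
  apply/seteqP; split=> t /=; case: (b t); case: (a t) => //=; try by [left|right].
  - by case=> -[].
  - by case=> -[].
set I := (\int[P]_t _)%E.
have s20 : 0 <= 2 * s ^+ 2 by rewrite mulr_ge0// sqr_ge0.
have mexp : measurable_fun [set: T] (fun t => (expR (s * ((b t)%:R - (a t)%:R)))%:E).
  apply/measurable_EFinP; apply: measurableT_comp => //; apply: measurable_funM => //.
  by apply: measurable_funB; exact: measurable_fun_setb.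
have I0 : (0 <= I)%E by apply: integral_ge0 => t _; rewrite lee_fin expR_ge0.
(* The term [s * q] is kept on both sides so that only nonnegative functions are integrated; it
   cancels once [I] is known to be finite. *)
have h : (I + s%:E * q%:E <= 1 + (s%:E * q%:E + (2 * s ^+ 2)%:E * P [set t | b t != a t]))%E.
  rewrite -[X in (I + s%:E * X)%E]Pa -[X in (1 + (s%:E * X + _))%E]Pb.
  rewrite -!intEb// -[X in (_ <= X + _)%E](integral_probc P 1%E).
  rewrite -!ge0_integralD//; last 9 first.
  all: try by [move=> t _; rewrite lee_fin ?mulr_ge0|exact: mEb|exact: mexp|move=> t _; rewrite lee_fin expR_ge0].
  all: try by [move=> t _; rewrite adde_ge0// lee_fin mulr_ge0|apply: emeasurable_funD; exact: mEb].
  apply: ge0_le_integral => //.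
  - by move=> t _; rewrite adde_ge0// lee_fin ?expR_ge0// mulr_ge0.
  - by apply: emeasurable_funD => //; exact: mEb.
  - by apply: emeasurable_funD => //; apply: emeasurable_funD; exact: mEb.
  move=> t _; rewrite -!EFinD lee_fin; case: (b t); case: (a t) => /=.
  - by rewrite subrr mulr0 expR0; lra.
  - by have := @expR_le_quad R s s2; rewrite subr0 mulr1; lra.
  - have : - s <= 1 / 2 by lra.
    by move=> /(@expR_le_quad R); rewrite sub0r mulrN1 sqrrN; lra.
  - by rewrite subrr mulr0 expR0; lra.
have hb : (1 + (s%:E * q%:E + (2 * s ^+ 2)%:E * P [set t | b t != a t]) <=
           (1 + (s * q + (2 * s ^+ 2) * p))%:E)%E.
  rewrite (EFinD 1 (s * q + (2 * s ^+ 2) * p)) (EFinD (s * q)) (EFinM s) (EFinM (2 * s ^+ 2)).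
  by apply: leeD2l; apply: leeD2l; apply: lee_wpmul2l.
have Ifin : I \is a fin_num.
  rewrite ge0_fin_numE//; apply: le_lt_trans (ltry (1 + (s * q + (2 * s ^+ 2) * p))).
  apply: le_trans (leeDl _ _) (le_trans h _).
  - by rewrite -Pa; apply: mule_ge0; rewrite ?lee_fin.
  - exact: hb.
apply: (@le_trans _ _ (1 + 2 * s ^+ 2 * p)%:E); last by rewrite lee_fin expR_ge1Dx.
have : (I + (s * q)%:E <= (1 + (s * q + (2 * s ^+ 2) * p))%:E)%E.
  by rewrite (EFinM s q); apply: (le_trans h).
rewrite -(fineK Ifin) -EFinD !lee_fin; lra.
Qed.

Lemma exp_moment_ub (b : T -> bool) (p : R) : measurable [set t | b t] ->
  (P [set t | b t] <= p%:E)%E -> (\int[P]_t (expR (b t)%:R)%:E <= (expR (3 * p))%:E)%E.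
Proof.
move=> mb Pb.
apply: (@le_trans _ _ (\int[P]_t (1 + (3 * (b t)%:R)%:E))%E).
  apply: ge0_le_integral => //.
  - by apply/measurable_EFinP; apply: measurableT_comp => //; exact: measurable_fun_setb.
  - by apply: emeasurable_funD => //; exact: mEb.
  - move=> t _; rewrite -EFinD lee_fin; case: (b t) => /=; last by rewrite expR0; lra.
    by have := @expR1_le4 R; lra.
rewrite ge0_integralD//; last exact: mEb.
rewrite integral_probc intEb//.
apply: (@le_trans _ _ (1 + 3 * p)%:E); last by rewrite lee_fin expR_ge1Dx.
by rewrite (EFinD 1 (3 * p)) (EFinM 3 p); apply: leeD2l; apply: lee_wpmul2l.
Qed.

(** Pointwise [expR (- b) <= 1 - b / 2] for a 0-1 value [b], because [expR (- 1) <= 1 / 2]. The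
    halved exponent is the loss accepted for a lower-tail bound. *)
Lemma exp_moment_lb (b : T -> bool) (p : R) : measurable [set t | b t] ->
  (p%:E <= P [set t | b t])%E ->
  (\int[P]_t (expR (- (b t)%:R))%:E <= (expR (- (p / 2)))%:E)%E.
Proof.
move=> mb Pb; set I := (\int[P]_t _)%E.
have I0 : (0 <= I)%E by apply: integral_ge0 => t _; rewrite lee_fin expR_ge0.
have mexp : measurable_fun [set: T] (fun t => (expR (- (b t)%:R : R))%:E).
  apply/measurable_EFinP; apply: measurableT_comp => //; apply: measurableT_comp => //.
  exact: measurable_fun_setb.
have h : (I + (1 / 2)%:E * P [set t | b t] <= 1)%E.
  rewrite -intEb// -[X in (_ <= X)%E](integral_probc P 1%E) -ge0_integralD//; last first.
  all: try by [move=> t _; rewrite lee_fin ?mulr_ge0|exact: mEb|exact: mexp|move=> t _; rewrite lee_fin expR_ge0].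
  apply: ge0_le_integral => //.
  - by move=> t _; rewrite adde_ge0// lee_fin ?expR_ge0// mulr_ge0.
  - by apply: emeasurable_funD => //; exact: mEb.
  - move=> t _; rewrite -!EFinD lee_fin; case: (b t) => /=; last by rewrite oppr0 expR0; lra.
    by have := @expRN1_le R; lra.
have Ifin : I \is a fin_num.
  rewrite ge0_fin_numE//; apply: le_lt_trans (ltry 1).
  by apply: le_trans (leeDl _ _) h; apply: mule_ge0; rewrite ?lee_fin.
apply: (@le_trans _ _ (1 + - (p / 2))%:E); last by rewrite lee_fin expR_ge1Dx.
have : (I + (1 / 2 * p)%:E <= 1)%E.
  by apply: le_trans h; rewrite EFinM; apply: leeD2l; apply: lee_wpmul2l.
rewrite -(fineK Ifin) -EFinD !lee_fin; lra.
Qed.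

End exp_moments.

Section exp_moment_dot.
Context {R : realType} (d : nat).
Local Notation RR := (measurableTypeR R).
Local Notation U := (d.-tuple RR * RR)%type.

(** Since [expR (B x) <= 1 + B * expR x] and the noise is independent of the covariates, the bound
    is proportional to [p]. With [B] the event of small noise, this keeps the net error below of
    order [rho]. *)
Lemma exp_moment_dot (v : 'I_d -> R) (B : RR -> bool) (p : R) :
  measurable [set y | B y] -> (gN [set y | B y] <= p%:E)%E -> nrm2 v <= 4 ->
  (\int[gB d]_z (expR ((B z.2)%:R * `|dotT v z.1|))%:E <= (expR (expR 5 * p))%:E)%E.
Proof.
move=> mB PB v4.
have mabs : measurable_fun [set: d.-tuple RR] (fun g => expR `|dotT v g|).
  apply: measurableT_comp => //; apply: measurableT_comp => //; exact: measurable_dotT.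
have mBf := @measurable_fun_setb R _ _ _ mB.
have m1 : measurable_fun [set: U] (fun z : U => ((B z.2)%:R * expR `|dotT v z.1|)%:E).
  apply/measurable_EFinP; apply: measurable_funM.
    exact: (measurableT_comp mBf measurable_snd).
  exact: (measurableT_comp mabs measurable_fst).
have m2 : measurable_fun [set: U] (fun z : U => (expR ((B z.2)%:R * `|dotT v z.1|))%:E).
  apply/measurable_EFinP; apply: measurableT_comp => //; apply: measurable_funM.
    exact: (measurableT_comp mBf measurable_snd).
  by apply: measurableT_comp => //; exact: measurable_dotU.
apply: (@le_trans _ _ (\int[gB d]_z (1 + ((B z.2)%:R * expR `|dotT v z.1|)%:E))%E).
  apply: ge0_le_integral => //.
  - by apply: emeasurable_funD.
  - move=> z _; rewrite -EFinD lee_fin; case: (B z.2); rewrite ?mul1r ?mul0r ?expR0; last by lra.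
    by lra.
rewrite ge0_integralD//.
rewrite integral_probc integral_gB//.
have -> : (\int[gV d]_g \int[gN]_y ((B y)%:R * expR `|dotT v g|)%:E =
          gN [set y | B y] * \int[gV d]_g (expR `|dotT v g|)%:E)%E.
  rewrite -ge0_integralZl//; last exact/measurable_EFinP.
  apply: eq_integral => g _; under eq_integral do rewrite EFinM.
  rewrite ge0_integralZr//; last exact/measurable_EFinP.
  by congr (_ * _)%E; exact: integral_setb.
apply: (@le_trans _ _ (1 + expR 5 * p)%:E); last by rewrite lee_fin expR_ge1Dx.
rewrite (EFinD 1 (expR 5 * p)) mulrC (EFinM p); apply: leeD2l; apply: lee_pmul => //.
  by apply: integral_ge0 => g _; rewrite lee_fin expR_ge0.
apply: (le_trans (gV_exp v)); rewrite lee_fin.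
have -> : (5 : R) = 4 + 1 by lra.
rewrite expRD; apply: ler_pM; rewrite ?expR_ge0 ?ler_expR//.
by have := expR_ge1Dx (1 : R); lra.
Qed.
End exp_moment_dot.

(** * Nets and the uniform good event *)

Section nets.
Context {R : realType} (d : nat).

Definition nrm1 (v : 'I_d -> R) : R := \sum_(j < d) `|v j|.

(** Cauchy-Schwarz, obtained from the Lagrange identity for the double sum of
    [(|v i| - |v j|)^2]. *)
Lemma nrm1_le (v : 'I_d -> R) : nrm1 v <= Num.sqrt d%:R * Num.sqrt (nrm2 v).
Proof.
have n1 : 0 <= nrm1 v by apply: sumr_ge0.
rewrite -sqrtrM// -[X in X <= _]ger0_norm// -sqrtr_sqr ler_sqrt; last first.
  by rewrite mulr_ge0// nrm2_ge0.
have h : 0 <= \sum_(i < d) \sum_(j < d) (`|v i| - `|v j|) ^+ 2.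
  by apply: sumr_ge0 => i _; apply: sumr_ge0 => j _; exact: sqr_ge0.
have e : \sum_(i < d) \sum_(j < d) (`|v i| - `|v j|) ^+ 2 =
    2 * (d%:R * nrm2 v) - 2 * nrm1 v ^+ 2.
  transitivity (\sum_(i < d) (d%:R * v i ^+ 2 + nrm2 v - 2 * (`|v i| * nrm1 v))).
    apply: eq_bigr => i _; rewrite /nrm1 /nrm2.
    rewrite -[d in d%:R]card_ord -sum1_card natr_sum mulr_suml mulr_sumr mulr_sumr.
    rewrite -sumrN -!big_split/=; apply: eq_bigr => j _.
    rewrite sqrrB !real_normK ?num_real//; ring.
  rewrite sumrB big_split/= -!mulr_sumr -mulr_suml sumr_const card_ord -mulr_natl.
  rewrite -/(nrm1 v) -/(nrm2 v); ring.
by move: h; rewrite e; lra.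
Qed.

(* An index [f] encodes the integer vector [f (j, true) - f (j, false)] of l^1 norm at most
   [M * d], so [net M] is a net of the unit ball of resolution [1 / M] and of size
   exponential in [d]. *)
Definition netI (M : nat) := {ffun 'I_d * bool -> 'I_(M * d).+1}.
Definition net (M : nat) : {set netI M} := [set f : netI M | (\sum_p f p <= M * d)%N].
Definition zvec (M : nat) (f : netI M) (j : 'I_d) : R :=
  ((f (j, true))%:R - (f (j, false))%:R) / (M%:R * Num.sqrt d%:R).

Lemma card_net (M : nat) (a : R) : (0 < M)%N -> M.+1%:R <= expR a ->
  #|net M|%:R <= expR (d%:R * (1 + 2 * a)).
Proof.
move=> M0 Ma; set m := (M * d)%N.
have M0' : 0 < M%:R :> R by rewrite ltr0n.
(* Weighting each index by [th ^ (l^1 norm)] bounds the count by a product of geometric sums. *)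
pose th : R := M%:R / M.+1%:R.
have th0 : 0 < th by rewrite divr_gt0// ltr0n.
have th1 : 1 - th = M.+1%:R^-1.
  by rewrite /th -natr1; field; rewrite natr1 pnatr_eq0.
have geo : \sum_(i < m.+1) th ^+ i <= M.+1%:R.
  have : (1 - th) * \sum_(i < m.+1) th ^+ i <= 1.
    have := subrXX 1 th m.+1; rewrite expr1n.
    under eq_bigr => i _ do rewrite expr1n mul1r.
    by move=> <-; rewrite lerBlDr lerDl exprn_ge0// ltW.
  by rewrite th1 mulrC ler_pdivrMr ?ltr0n// mul1r.
have tot : \sum_(f : netI M) \prod_p th ^+ (f p) <= expR a ^+ (2 * d).
  rewrite -(bigA_distr_bigA (fun _ (i : 'I_m.+1) => th ^+ i)) prodr_const.
  rewrite card_prod card_ord card_bool mulnC.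
  apply: lerXn2r; rewrite ?nnegrE ?expR_ge0//; last exact: le_trans Ma.
  by apply: sumr_ge0 => i _; rewrite exprn_ge0// ltW.
have low : #|net M|%:R * th ^+ m <= \sum_(f : netI M) \prod_p th ^+ (f p).
  rewrite -sum1_card natr_sum mulr_suml big_mkcond/=; apply: ler_sum => f _.
  rewrite inE; case: ifPn => h; last first.
    by apply: prodr_ge0 => p _; rewrite exprn_ge0// ltW.
  rewrite mul1r prodrXr; apply: ler_wiXn2l => //; first exact: ltW.
  by rewrite /th ler_pdivrMr ?ltr0n// mul1r ler_nat.
(* Since [1 / th = 1 + 1 / M <= expR (1 / M)] and [m = M * d], the weight of the longest index costs
   only [expR d]. *)
have thm : expR (- d%:R) <= th ^+ m.
  have : expR (- M%:R^-1) <= th.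
    rewrite expRN -[th]invrK lef_pV2 ?posrE ?expR_gt0 ?invr_gt0//.
    have -> : th^-1 = 1 + M%:R^-1 by rewrite /th invf_div -natr1 mulrDl divff ?gt_eqF// mul1r.
    exact: expR_ge1Dx.
  move=> /(@lerXn2r _ m); rewrite !nnegrE => /(_ (expR_ge0 _) (ltW th0)).
  by rewrite -expRM_natr /m natrM mulNr mulrA mulVf ?gt_eqF// mul1r.
rewrite mulrDr mulr1 expRD.
have -> : expR (d%:R * (2 * a)) = expR a ^+ (2 * d).
  by rewrite -expRM_natr natrM; congr expR; ring.
have -> : #|net M|%:R = expR d%:R * (expR (- d%:R) * #|net M|%:R) :> R.
  by rewrite mulrA expRxMexpNx_1 mul1r.
rewrite ler_pM2l ?expR_gt0//.
apply: le_trans tot; apply: le_trans low; rewrite mulrC.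
by apply: ler_wpM2l.
Qed.

(** Each coordinate is rounded towards zero on the lattice of mesh [1 / c], with [c = M * sqrt d].
    The squared error is at most [d / c^2 = M^-2], rounding towards zero cannot increase the norm,
    and [nrm1_le] keeps the integer vector within l^1 norm [M * d]. *)
Lemma net_approx (M : nat) (u : 'I_d -> R) : (0 < M)%N -> (0 < d)%N -> nrm2 u <= 1 ->
  exists2 f, f \in net M &
    nrm2 (fun j => u j - zvec f j) <= M%:R ^- 2 /\ nrm2 (zvec f) <= nrm2 u.
Proof.
move=> M0 d0 u1.
pose c : R := M%:R * Num.sqrt d%:R.
have sd : 0 < Num.sqrt d%:R :> R by rewrite sqrtr_gt0 ltr0n.
have c0 : 0 < c by rewrite mulr_gt0// ltr0n.
pose x j := Num.truncn (`|u j| * c).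
have xP j : (x j)%:R <= `|u j| * c < (x j).+1%:R.
  by apply: truncn_itv; rewrite mulr_ge0// ltW.
have sumx : (\sum_j x j <= M * d)%N.
  rewrite -(ler_nat R) natr_sum; apply: (@le_trans _ _ (\sum_j `|u j| * c)).
    by apply: ler_sum => j _; case/andP : (xP j).
  rewrite -mulr_suml -/(nrm1 u); apply: (@le_trans _ _ (Num.sqrt d%:R * c)).
    rewrite ler_pM2r//; apply: (le_trans (nrm1_le u)).
    rewrite ler_piMr ?sqrtr_ge0//.
    by rewrite -sqrtr1 ler_sqrt.
  by rewrite /c mulrCA -expr2 sqr_sqrtr// natrM.
have xm j : (x j < (M * d).+1)%N.
  by rewrite ltnS; apply: leq_trans sumx; rewrite (bigD1 j)//= leq_addr.
pose f : netI M := [ffun p => if p.2 == (0 <= u p.1) then Ordinal (xm p.1) else ord0].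
have zE j : zvec f j = (if 0 <= u j then (x j)%:R else - (x j)%:R) / c.
  by rewrite /zvec !ffunE /=; case: (0 <= u j) => /=; rewrite ?subr0 ?sub0r.
have zu j : zvec f j ^+ 2 <= u j ^+ 2 /\ (u j - zvec f j) ^+ 2 <= c ^- 2.
  rewrite zE; have /andP[h1 h2] := xP j.
  have {}h1 : (x j)%:R / c <= `|u j| by rewrite ler_pdivrMr//; case/andP : (xP j).
  have {}h2 : `|u j| < (x j)%:R / c + c^-1.
    by rewrite -[X in _ + X]mul1r -mulrDl ltr_pdivlMr// natr1.
  have xc0 : 0 <= (x j)%:R / c by rewrite divr_ge0// ltW.
  rewrite -exprVn; case: ifPn => u0.
    rewrite ger0_norm// in h1 h2.
    by split; rewrite ler_sqr ?nnegrE ?invr_ge0 ?(ltW c0)//; lra.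
  rewrite -ltNge in u0; rewrite ltr0_norm// in h1 h2.
  rewrite mulNr sqrrN -[u j ^+ 2]sqrrN opprK -[(u j + _) ^+ 2]sqrrN.
  by split; rewrite ler_sqr ?nnegrE ?invr_ge0 ?(ltW c0)//; lra.
exists f; last first.
  split; last by apply: ler_sum => j _; case: (zu j).
  apply: (@le_trans _ _ (\sum_(j < d) c ^- 2)).
    by apply: ler_sum => j _; case: (zu j).
  rewrite sumr_const card_ord -(mulr_natl (c ^- 2) d) (_ : d%:R * c ^- 2 = M%:R ^- 2)//.
  rewrite /c exprMn sqr_sqrtr//; field.
  by rewrite !pnatr_eq0 -!lt0n M0 d0.
rewrite inE; apply: leq_trans sumx.
rewrite (eq_bigr (fun p => nat_of_ord (f (p.1, p.2)))); last by case.
rewrite -(pair_bigA _ (fun j b => nat_of_ord (f (j, b))))/=; apply: leq_sum => j _.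
by rewrite big_bool /= !ffunE /=; case: (0 <= u j); rewrite ?addn0 ?add0n.
Qed.

End nets.

Section small.
Context {R : realType} {d0} {T : measurableType d0} (P : probability T R).

Definition small (e : R) (S : set T) : Prop := measurable S /\ (P S <= e%:E)%E.

Lemma small_le e e' S : e <= e' -> small e S -> small e' S.
Proof.
by move=> ee [mS PS]; split=> //; apply: (le_trans PS); rewrite lee_fin.
Qed.

Lemma small0 : small 0 set0.
Proof. by split=> //; rewrite measure0. Qed.

Lemma small_setU e1 e2 A B : small e1 A -> small e2 B -> small (e1 + e2) (A `|` B).
Proof.
move=> [mA PA] [mB PB]; split; first exact: measurableU.
by apply: (le_trans (measureU2 _ mA mB)); rewrite EFinD; exact: leeD.
Qed.

Lemma small_seq (J : eqType) (s : seq J) (S : J -> set T) (e : J -> R) :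
  (forall j, j \in s -> small (e j) (S j)) ->
  small (\sum_(j <- s) e j) [set t | exists2 j, j \in s & S j t].
Proof.
elim: s => [|j s IH] h.
  rewrite big_nil (_ : [set t | _] = set0); first exact: small0.
  by apply/seteqP; split=> t // [].
rewrite big_cons (_ : [set t | _] = S j `|` [set t | exists2 j, j \in s & S j t]).
  apply: small_setU; first by apply: h; rewrite mem_head.
  by apply: IH => k ks; apply: h; rewrite inE ks orbT.
apply/seteqP; split=> t /=.
  by move=> [k]; rewrite inE => /orP[/eqP ->|ks Sk]; [left|right; exists k].
case=> [Sj|[k ks Sk]]; first by exists j => //; rewrite mem_head.
by exists k => //; rewrite inE ks orbT.
Qed.

Lemma small_fin (J : finType) (A : {set J}) (S : J -> set T) (e : R) :
  (forall j, j \in A -> small e (S j)) ->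
  small (#|A|%:R * e) [set t | exists2 j, j \in A & S j t].
Proof.
move=> h; have := @small_seq J (enum A) S (fun=> e).
rewrite big_const_seq count_predT -cardE iter_addr addr0 mulr_natl.
rewrite (_ : [set t | exists2 j, j \in enum A & S j t] = [set t | exists2 j, j \in A & S j t]).
  by apply => j; rewrite mem_enum; exact: h.
by apply/seteqP; split=> t /= [j]; rewrite ?mem_enum => jA Sj; exists j; rewrite ?mem_enum.
Qed.

End small.

Section chernoff_small.
Context {R : realType} {d0} {T : measurableType d0} (P : probability T R).
Context (n : nat) (I : {set 'I_n}).

Definition isum (h : T -> R) (t : n.-tuple T) : R := \sum_(i in I) h (tnth t i).

Lemma measurable_isum h : measurable_fun [set: T] h -> measurable_fun [set: n.-tuple T] (isum h).
Proof.
move=> mh; rewrite (_ : isum h = fun t => \sum_(i < n) (if i \in I then h (tnth t i) else 0)); last first.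
  by apply/funext => t; rewrite /isum big_mkcond.
apply: (@measurable_sum _ _ _ _ _ _ (fun i t => if i \in I then h (tnth t i) else 0)) => i.
case: (i \in I) => //; exact: (measurableT_comp mh (measurable_tnth i)).
Qed.

Lemma small_chernoff (h : T -> R) (k x : R) :
  measurable_fun [set: T] h -> (\int[P]_t (expR (h t))%:E <= (expR k)%:E)%E ->
  small (iid P n) (expR (k * #|I|%:R - x)) [set t | x <= isum h t].
Proof.
move=> mh hk; split.
  by apply: measurable_set_le => //; exact: measurable_isum.
by rewrite mulr_natr; exact: chernoff_iid.
Qed.

Lemma isumD h1 h2 t : isum (fun x => h1 x + h2 x) t = isum h1 t + isum h2 t.
Proof. by rewrite /isum big_split. Qed.

Lemma isumB h1 h2 t : isum (fun x => h1 x - h2 x) t = isum h1 t - isum h2 t.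
Proof. by rewrite /isum sumrB. Qed.

Lemma isumN h t : isum (fun x => - h x) t = - isum h t.
Proof. exact: sumrN. Qed.

Lemma isumZ c h t : isum (fun x => c * h x) t = c * isum h t.
Proof. by rewrite /isum -mulr_sumr. Qed.

Lemma isum_cst c t : isum (fun=> c) t = c * #|I|%:R.
Proof. by rewrite /isum sumr_const mulr_natr. Qed.

End chernoff_small.

(** * Deviation bounds for a single direction *)

Section events.
Context {R : realType} (d n : nat) (I : {set 'I_n}).
Local Notation RR := (measurableTypeR R).
Local Notation U := (d.-tuple RR * RR)%type.
Local Notation P := (iid (gB d) n).
Local Notation N := (#|I|%:R : R).
Local Notation isum := (@isum R _ U n I).
Local Notation zv := (@zvec R d _).

Lemma small_diff (v v' : 'I_d -> R) (s p x : R) : 0 < nrm2 v -> 0 < nrm2 v' ->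
  (gB d [set z | sgnb v' z != sgnb v z] <= p%:E)%E -> 0 <= s <= 1 / 2 ->
  small P (expR (2 * s ^+ 2 * p * N - s * x))
    [set t | s * x <= s * isum (fun z => (sgnb v' z)%:R - (sgnb v z)%:R) t].
Proof.
move=> v0 v0' Pd s2.
have mv := measurable_sgnb v; have mv' := measurable_sgnb v'.
have := @small_chernoff R _ U (gB d) n I
  (fun z => s * ((sgnb v' z)%:R - (sgnb v z)%:R)) (2 * s ^+ 2 * p) (s * x).
rewrite (_ : [set t | s * x <= s * _] = [set t | s * x <= isum (fun z => s * ((sgnb v' z)%:R - (sgnb v z)%:R)) t]); last first.
  by apply/seteqP; split=> t /=; rewrite isumZ.
apply.
  apply: measurable_funM => //; apply: measurable_funB; exact: measurable_fun_setb.
exact: (@exp_moment_diff _ _ _ (gB d) (sgnb v) (sgnb v') s p (1 / 2) mv mv' (gB_half v0) (gB_half v0') Pd s2).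
Qed.

(** Twice the count minus [N] is the sum of the sign indicators minus their complements. Both have
    probability 1/2, so [exp_moment_diff] applies with the trivial disagreement bound 1. *)
Lemma small_half (v : 'I_d -> R) (s x : R) : 0 < nrm2 v -> 0 <= s <= 1 / 2 ->
  small P (expR (2 * s ^+ 2 * N - s * x))
    [set t | s * x <= s * (2 * isum (fun z => (sgnb v z)%:R) t - N)] /\
  small P (expR (2 * s ^+ 2 * N - s * x))
    [set t | s * x <= s * (N - 2 * isum (fun z => (sgnb v z)%:R) t)].
Proof.
move=> v0 s2; have mv := measurable_sgnb v.
have mC : measurable [set z : U | ~~ sgnb v z].
  rewrite (_ : [set z | _] = ~` [set z | sgnb v z]); first exact: measurableC.
  by apply/seteqP; split=> z /= /negP.
have PC : gB d [set z : U | ~~ sgnb v z] = (1 / 2)%:E.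
  rewrite (_ : [set z | _] = ~` [set z | sgnb v z]); last first.
    by apply/seteqP; split=> z /= /negP.
  rewrite probability_setC// -[1%E]/(1%:E); apply: (etrans (congr1 (fun x => 1%:E - x)%E (gB_half v0))).
  by rewrite -EFinB; congr EFin; lra.
have le1 (S : set U) : measurable S -> (gB d S <= 1%:E)%E.
  by move=> mS; exact: (probability_le1 (gB d) mS).
have m1 : measurable [set z : U | sgnb v z != ~~ sgnb v z].
  by rewrite (_ : [set z | _] = setT)//; apply/seteqP; split=> z //= _; case: (sgnb v z).
have m2 : measurable [set z : U | ~~ sgnb v z != sgnb v z].
  by rewrite (_ : [set z | _] = setT)//; apply/seteqP; split=> z //= _; case: (sgnb v z).
have mf1 := @measurable_fun_setb R _ _ _ mv.
have mf2 := @measurable_fun_setb R _ _ _ mC.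
split.
- have := @small_chernoff R _ U (gB d) n I
    (fun z => s * ((sgnb v z)%:R - (~~ sgnb v z)%:R)) (2 * s ^+ 2 * 1) (s * x).
  rewrite mulr1 (_ : [set t | s * x <= s * _] = [set t | s * x <= isum (fun z => s * ((sgnb v z)%:R - (~~ sgnb v z)%:R)) t]); last first.
    apply/seteqP; split=> t /=; rewrite isumZ; congr (is_true (_ <= _ * _)).
      rewrite -[N]mul1r -(isum_cst I 1 t) -isumZ -isumB; apply: eq_bigr => i _.
      by case: (sgnb v _) => /=; ring.
    rewrite -[N]mul1r -(isum_cst I 1 t) -isumZ -isumB; apply: eq_bigr => i _.
    by case: (sgnb v _) => /=; ring.
  apply; first by apply: measurable_funM => //; exact: measurable_funB.
  have := @exp_moment_diff _ _ _ (gB d) (fun z => ~~ sgnb v z) (sgnb v) s 1 (1 / 2) mC mv PC (gB_half v0) (le1 _ m1) s2.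
  by rewrite mulr1.
- have := @small_chernoff R _ U (gB d) n I
    (fun z => s * ((~~ sgnb v z)%:R - (sgnb v z)%:R)) (2 * s ^+ 2 * 1) (s * x).
  rewrite mulr1 (_ : [set t | s * x <= s * _] = [set t | s * x <= isum (fun z => s * ((~~ sgnb v z)%:R - (sgnb v z)%:R)) t]); last first.
    apply/seteqP; split=> t /=; rewrite isumZ; congr (is_true (_ <= _ * _)).
      rewrite -[N]mul1r -(isum_cst I 1 t) -isumZ -isumB; apply: eq_bigr => i _.
      by case: (sgnb v _) => /=; ring.
    rewrite -[N]mul1r -(isum_cst I 1 t) -isumZ -isumB; apply: eq_bigr => i _.
    by case: (sgnb v _) => /=; ring.
  apply; first by apply: measurable_funM => //; exact: measurable_funB.
  have := @exp_moment_diff _ _ _ (gB d) (sgnb v) (fun z => ~~ sgnb v z) s 1 (1 / 2) mv mC (gB_half v0) PC (le1 _ m2) s2.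
  by rewrite mulr1.
Qed.

Lemma small_near (v : 'I_d -> R) (q x : R) : 0 <= q -> 1 / 4 <= nrm2 v ->
  small P (expR (6 * q * N - x))
    [set t | x <= isum (fun z => (`|dotT v z.1| <= q)%R%:R) t].
Proof.
move=> q0 v4.
have mg : measurable [set g : d.-tuple RR | `|dotT v g| <= q] := measurable_dot_le v q.
have m : measurable [set z : U | `|dotT v z.1| <= q].
  by apply: measurable_set_le => //; apply: measurableT_comp => //; exact: measurable_dotU.
have mf := @measurable_fun_setb R _ _ (fun z : U => `|dotT v z.1| <= q)%R m.
apply: small_chernoff => //.
have := @exp_moment_ub R _ _ (gB d) (fun z : U => `|dotT v z.1| <= q)%R (2 * q) m.
rewrite (_ : 3 * (2 * q) = 6 * q); last by ring.
apply; apply: le_trans (gV_small q0 v4).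
by rewrite le_eqVlt; apply/orP; left; apply/eqP; exact: (gB_fst mg).
Qed.

Lemma small_dot (v : 'I_d -> R) (B : RR -> bool) (p x : R) :
  measurable [set y | B y] -> (gN [set y | B y] <= p%:E)%E -> nrm2 v <= 4 ->
  small P (expR (expR 5 * p * N - x))
    [set t | x <= isum (fun z => (B z.2)%:R * `|dotT v z.1|) t].
Proof.
move=> mB PB v4; apply: small_chernoff; last exact: exp_moment_dot.
have mBf := @measurable_fun_setb R _ _ _ mB.
apply: measurable_funM; first exact: (measurableT_comp mBf measurable_snd).
by apply: measurableT_comp => //; exact: measurable_dotU.
Qed.

(** A version of [devb] with room to spare: a net point is asked for a projection of at least 2, so
    that a direction nearby still has a projection above 1. *)
Definition farb (v : 'I_d -> R) (rho : R) (z : U) : bool :=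
  (0 <= z.2 <= rho) && (2 <= dotT v z.1).

(** The probability of [farb] is at least [c6 * rho]: a factor [expR (- 25 / 2) / 3] for a standard
    normal in [[4, 5]], times [rho / 6] for the noise. *)
Definition c6 : R := expR (- (25 / 2)) / 18.

Lemma small_far (v : 'I_d -> R) (rho x : R) : 0 <= rho <= 1 -> 1 / 4 <= nrm2 v ->
  small P (expR (x - c6 * rho / 2 * N))
    [set t | isum (fun z => (farb v rho z)%:R) t <= x].
Proof.
move=> /andP[r0 r1] v4.
have mg : measurable [set g : d.-tuple RR | 2 <= dotT v g].
  by apply: measurable_set_le => //; exact: measurable_dotT.
have mfar : [set z : U | farb v rho z] = [set g | 2 <= dotT v g] `*` `[0, rho]%classic.
  apply/seteqP; split=> z /=; rewrite /farb in_itv/=; first by move=> /andP[].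
  by move=> [h1 h2]; apply/andP.
have m : measurable [set z : U | farb v rho z].
  by rewrite mfar; apply: measurableX => //; exact: measurable_itv.
have mf := @measurable_fun_setb R _ _ _ m.
have Pg : ((expR (- (25 / 2)) / 3)%:E <= gV d [set g | (2 <= dotT v g)%R])%E.
  have m2 : measurable [set x : RR | (2 <= x)%R].
    have := measurable_itv `[2 : R, +oo[; congr measurable.
    by apply/seteqP; split=> y /=; rewrite in_itv/= andbT.
  rewrite (gV_dot_set v m2).
  (* The projection has standard deviation at least 1/2, so a standard normal value of at least 4
     makes it at least 2. *)
  apply: (@le_trans _ _ (gN `[4, 5]%classic)).
    have h := @gN_itv_ge R 4 5 5.
    apply: le_trans (h _ _); last 2 first.
    - by lra.
    - by move=> y /andP[h1 h2]; rewrite ger0_norm//; lra.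
    by rewrite lee_fin mulrC ler_pM ?expR_ge0// ?ler_expR; lra.
  apply: le_measure; rewrite ?inE; [exact: measurable_itv| |].
    apply: measurable_set_le => //; exact: measurable_funM.
  move=> y /=; rewrite in_itv/= => /andP[y4 y5].
  have r2 : 1 / 2 <= Num.sqrt (nrm2 v).
    rewrite [X in X <= _](_ : 1 / 2 = Num.sqrt ((1 / 2) ^+ 2)); last first.
      by rewrite sqrtr_sqr ger0_norm.
    by rewrite ler_sqrt ?nrm2_ge0//; apply: le_trans v4; lra.
  nra.
have PN : ((rho / 6)%:E <= gN `[0%R, rho]%classic)%E.
  apply: le_trans (@gN_itv_ge R 0 rho 1 _ _) => //; last first.
    by move=> y /andP[y0 yr]; rewrite ger0_norm//; exact: le_trans yr r1.
  rewrite lee_fin subr0 expr1n; have := expR_ge1Dx (- 1 / 2 : R) => e.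
  have : rho / 3 * (1 / 2) <= rho / 3 * expR (- 1 / 2) by rewrite ler_wpM2l ?divr_ge0//; lra.
  lra.
have Pfar : ((c6 * rho)%:E <= gB d [set z | farb v rho z])%E.
  rewrite mfar; apply: (@le_trans _ _ (gV d [set g | (2 <= dotT v g)%R] * gN `[0%R, rho]%classic)%E).
    apply: le_trans (lee_pmul _ _ Pg PN); rewrite ?lee_fin ?divr_ge0 ?expR_ge0//.
    by rewrite /c6; lra.
  by rewrite le_eqVlt; apply/orP; left; apply/eqP/esym; exact: (product_measure1E (gV d) gN mg (measurable_itv _)).
have := @small_chernoff R _ U (gB d) n I (fun z => - (farb v rho z)%:R) (- (c6 * rho / 2)) (- x).
rewrite (_ : - _ * _ - - x = x - c6 * rho / 2 * N); last by ring.
rewrite (_ : [set t | - x <= _] = [set t | isum (fun z => (farb v rho z)%:R) t <= x]); last first.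
  by apply/seteqP; split=> t /=; rewrite isumN lerN2.
apply; first exact: measurableT_comp.
exact: exp_moment_lb.
Qed.

End events.

(** * Union bounds over the nets *)

Section good_event.
Context {R : realType} (d n : nat) (I : {set 'I_n}).
Local Notation RR := (measurableTypeR R).
Local Notation U := (d.-tuple RR * RR)%type.
Local Notation P := (iid (gB d) n).
Local Notation N := (#|I|%:R : R).
Local Notation isum := (@isum R _ U n I).
Local Notation cnt b := (isum (fun z : U => (b z)%:R)).
Context (A0 L q : R) (M0 : nat).
Context (M02 : (2 <= M0)%N) (A00 : 0 <= A0) (M0A0 : M0.+1%:R <= expR A0).
Context (L0 : 0 <= L) (d1 : (1 <= d)%N) (q0 : 0 < q) (q1 : q < 1)
  (q2N : q ^+ 2 * N = d%:R).

Let d1' : 1 <= d%:R :> R. Proof. by rewrite ler1n. Qed.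
Let N0 : 0 < N.
Proof.
have : 0 < q ^+ 2 * N by rewrite q2N; apply: lt_le_trans d1'.
by rewrite pmulr_rgt0// exprn_gt0.
Qed.

(** Net [k] has resolution [1 / (M0 * 16^k)]. Consecutive approximations are within [16^-k], which
    [gB_diff] turns into a sign disagreement of order [4^-k], while the log-size of the net grows
    only linearly in [k]. *)
Definition scl (k : nat) : nat := (M0 * 16 ^ k)%N.

Lemma scl_gt0 k : (0 < scl k)%N.
Proof. by rewrite muln_gt0 expn_gt0/= (leq_trans _ M02). Qed.

Lemma card_net_scl k : #|net d (scl k)|%:R <= expR (d%:R * (1 + 2 * (A0 + 4 * k%:R))) :> R.
Proof.
apply: card_net; first exact: scl_gt0.
rewrite expRD; apply: (@le_trans _ _ (M0.+1%:R * 16 ^+ k)).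
  rewrite -natrX -natrM ler_nat /scl mulSn -add1n leq_add2r expn_gt0//.
apply: ler_pM => //.
rewrite expRM_natr; apply: lerXn2r; rewrite ?nnegrE ?expR_ge0//.
have e1 : (2 : R) <= expR 1 by have := expR_ge1Dx (1 : R); lra.
have -> : (4 : R) = 1 * 4%:R by rewrite mul1r.
rewrite expRM_natr (_ : 16 = 2 ^+ 4); last by rewrite -natrX.
by apply: lerXn2r; rewrite ?nnegrE ?expR_ge0//.
Qed.

Lemma expR_dle (c : R) : 0 <= c -> expR (- (d%:R * c)) <= expR (- c).
Proof. by move=> c0; rewrite ler_expR lerN2 ler_peMl. Qed.

(* [yb], [yk], [C3] and [C4] are the deviations, in units of [q * N], that survive the union
   bound over the nets; [q = sqrt (d / N)] is the statistical rate. *)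
Definition yb : R := 2 * (3 / 2 + 2 * A0 + L).

Lemma event_base : exists Bad, small P (2 * expR (- L)) Bad /\
  forall t, ~ Bad t -> forall f : netI d (scl 0), f \in net d (scl 0) -> 1 / 4 <= nrm2 (zvec f : _ -> R) ->
   `|2 * cnt (sgnb (zvec f)) t - N| <= q * N * yb.
Proof.
have [A00' L0' q0' q1' N0'] : [/\ 0 <= A0, 0 <= L, 0 < q, q < 1 & 0 < N] by [].
pose F : {set netI d (scl 0)} := [set f in net d (scl 0) | 1 / 4 <= nrm2 (zvec f : _ -> R)].
(* With this [s] every term is a multiple of [q^2 * N = d]: entropy [1 + 2 A0], variance [1 / 2],
   gain [yb / 2]. The constant [yb] makes the total exactly [- d * L]. *)
pose s := q / 2; pose x := q * N * yb.
have s12 : 0 <= s <= 1 / 2 by rewrite /s; apply/andP; split; lra.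
have s0 : 0 < s by rewrite /s; lra.
have bnd : #|F|%:R * expR (2 * s ^+ 2 * N - s * x) <= expR (- L).
  apply: (@le_trans _ _ (expR (d%:R * (1 + 2 * (A0 + 4 * 0%:R))) * expR (2 * s ^+ 2 * N - s * x))).
    rewrite ler_wpM2r ?expR_ge0//; apply: le_trans (card_net_scl 0).
    by rewrite ler_nat subset_leq_card//; apply/fintype.subsetP => f; rewrite inE => /andP[].
  rewrite -expRD; apply: le_trans (expR_dle L0); rewrite ler_expR -q2N /s /x /yb.
  by rewrite le_eqVlt; apply/orP; left; apply/eqP; field.
have pos f : f \in F -> 0 < nrm2 (zvec f : _ -> R).
  by rewrite inE => /andP[_]; apply: lt_le_trans; lra.
exists ([set t | exists2 f, f \in F & [set t | s * x <= s * (2 * cnt (sgnb (zvec f)) t - N)] t] `|`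
        [set t | exists2 f, f \in F & [set t | s * x <= s * (N - 2 * cnt (sgnb (zvec f)) t)] t]); split.
  have -> : 2 * expR (- L) = expR (- L) + expR (- L) by lra.
  apply: small_setU; apply: (small_le bnd); apply: small_fin => f fF.
    by have [] := @small_half R d n I _ s x (pos f fF) s12.
  by have [] := @small_half R d n I _ s x (pos f fF) s12.
move=> t nB f fnet f4; have fF : f \in F by rewrite inE fnet f4.
rewrite ler_norml; apply/andP; split; rewrite leNgt; apply/negP => h; apply: nB.
  by right; exists f => //=; rewrite ler_pM2l// /x; lra.
by left; exists f => //=; rewrite ler_pM2l// /x; lra.
Qed.

Definition B1 : R := 2 * (14 + 4 * A0 + L).
Definition yk (k : nat) : R := (B1 + 34 * k%:R) / 2 ^+ k.
(** The radius given to [gB_diff] at level [k]; its fourth power is the squared distance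
    [16^(-2k)]. *)
Definition rk (k : nat) : R := (4 ^+ k)^-1.

Lemma event_chain_step k : q * 2 ^+ k <= 1 -> exists Bad, small P (2 * expR (- (L + k%:R))) Bad /\
  forall t, ~ Bad t -> forall (f : netI d (scl k)) (f' : netI d (scl k.+1)),
    f \in net d (scl k) -> f' \in net d (scl k.+1) ->
    1 / 4 <= nrm2 (zvec f : _ -> R) -> 1 / 4 <= nrm2 (zvec f' : _ -> R) ->
    nrm2 (fun j => zvec f' j - zvec f j : R) <= rk k ^+ 4 ->
   `|cnt (sgnb (zvec f')) t - cnt (sgnb (zvec f)) t| <= q * N * yk k.
Proof.
have [A00' L0' q0' q1' N0'] : [/\ 0 <= A0, 0 <= L, 0 < q, q < 1 & 0 < N] by [].
move=> qk.
pose C (p : netI d (scl k) * netI d (scl k.+1)) : bool :=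
  [&& 1 / 4 <= nrm2 (zvec p.1 : _ -> R), 1 / 4 <= nrm2 (zvec p.2 : _ -> R) &
   nrm2 (fun j => zvec p.2 j - zvec p.1 j : R) <= rk k ^+ 4].
pose F : {set netI d (scl k) * netI d (scl k.+1)} :=
  [set p in finset.setX (net d (scl k)) (net d (scl k.+1)) | C p].
(* In units of [d], the two nets cost [10 + 4 A0 + 16 k], the variance term is [4] since [4^k]
   cancels [rk k], and the gain is [14 + 4 A0 + L + 17 k]. What remains is [- (L + k)], summable
   over the levels. The hypothesis [q * 2^k <= 1] is what [s <= 1 / 2] requires. *)
pose s := q * 2 ^+ k / 2; pose x := q * N * yk k.
have p2 : 0 < 2 ^+ k :> R by exact: exprn_gt0.
have p4 : 0 < 4 ^+ k :> R by exact: exprn_gt0.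
have s12 : 0 <= s <= 1 / 2.
  by rewrite /s; apply/andP; split; [rewrite divr_ge0// mulr_ge0 ?ltW|lra].
have s0 : 0 < s by rewrite /s divr_gt0// mulr_gt0.
have r0 : 0 < rk k by rewrite invr_gt0.
have r1 : rk k <= 1 by rewrite invf_le1// exprn_ege1// ler1n.
have Lk0 : 0 <= L + k%:R by rewrite addr_ge0.
have bnd : #|F|%:R * expR (2 * s ^+ 2 * (8 * rk k) * N - s * x) <= expR (- (L + k%:R)).
  apply: (@le_trans _ _ ((expR (d%:R * (1 + 2 * (A0 + 4 * k%:R))) * expR (d%:R * (1 + 2 * (A0 + 4 * k.+1%:R)))) * expR (2 * s ^+ 2 * (8 * rk k) * N - s * x))).
    rewrite ler_wpM2r ?expR_ge0//.
    apply: (@le_trans _ _ (#|net d (scl k)|%:R * #|net d (scl k.+1)|%:R)); last first.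
      by apply: ler_pM => //; exact: card_net_scl.
    rewrite -natrM ler_nat -finset.cardsX subset_leq_card//.
    by apply/fintype.subsetP => f; rewrite inE => /andP[].
  rewrite -!expRD; apply: le_trans (expR_dle Lk0); rewrite ler_expR -q2N /s /x /yk /rk /B1.
  have -> : (4 : R) ^+ k = 2 ^+ k * 2 ^+ k by rewrite -exprMn -natrM.
  by rewrite le_eqVlt; apply/orP; left; apply/eqP; rewrite -natr1; field; rewrite gt_eqF.
have dpos v : 1 / 4 <= nrm2 v -> 0 < nrm2 (v : 'I_d -> R) by apply: lt_le_trans; lra.
have nsym (v v' : 'I_d -> R) : nrm2 (fun j => v j - v' j) = nrm2 (fun j => v' j - v j).
  by apply: eq_bigr => j _; rewrite -sqrrN opprB.
exists ([set t | exists2 p, p \in F & [set t | s * x <= s * isum (fun z => (sgnb (zvec p.2) z)%:R - (sgnb (zvec p.1) z)%:R) t] t] `|`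
        [set t | exists2 p, p \in F & [set t | s * x <= s * isum (fun z => (sgnb (zvec p.1) z)%:R - (sgnb (zvec p.2) z)%:R) t] t]); split.
  have -> : 2 * expR (- (L + k%:R)) = expR (- (L + k%:R)) + expR (- (L + k%:R)) by lra.
  apply: small_setU; apply: (small_le bnd); apply: small_fin => p;
    rewrite inE => /andP[_ /and3P[h1 h2 h3]].
    apply: small_diff => //; [exact: dpos|exact: dpos|exact: gB_diff].
  apply: small_diff => //; [exact: dpos|exact: dpos|].
  by apply: gB_diff => //; rewrite nsym.
move=> t nB f f' fn fn' f4 f4' ff.
have pF : (f, f') \in F by rewrite inE finset.in_setX /= fn fn' /C /= f4 f4' ff.
rewrite ler_norml; apply/andP; split; rewrite leNgt; apply/negP => h; apply: nB.
  by right; exists (f, f') => //=; rewrite ler_pM2l// isumB /x; lra.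
by left; exists (f, f') => //=; rewrite ler_pM2l// isumB /x; lra.
Qed.

(** The linear entropy of level [k] is beaten by the geometric factor, so the total deviation does
    not depend on the number of levels and no logarithm appears. *)
Lemma sum_yk K : \sum_(k < K) yk k <= 2 * B1 + 68.
Proof.
have [A00' L0' q0' q1' N0'] : [/\ 0 <= A0, 0 <= L, 0 < q, q < 1 & 0 < N] by [].
have B10 : 0 <= B1 by rewrite /B1; lra.
suff -> : \sum_(k < K) yk k = 2 * B1 + 68 - (2 * B1 + 68 + 68 * K%:R) / 2 ^+ K.
  have K0 : 0 <= 68 * K%:R :> R by rewrite mulr_ge0.
  by rewrite lerBlDr lerDl; apply: divr_ge0; [lra|exact: exprn_ge0].
elim: K => [|K IH]; first by rewrite big_ord0 expr0; field.
rewrite big_ord_recr/= IH /yk -natr1 exprS; field.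
by rewrite gt_eqF// exprn_gt0.
Qed.

Lemma sum_expN K : \sum_(k < K) 2 * expR (- (L + k%:R)) <= 4 * expR (- L).
Proof.
have [A00' L0' q0' q1' N0'] : [/\ 0 <= A0, 0 <= L, 0 < q, q < 1 & 0 < N] by [].
suff h : \sum_(k < K) 2 * expR (- (L + k%:R)) <= 4 * expR (- L) * (1 - (2 ^+ K)^-1).
  have e0 : 0 <= 4 * expR (- L) by rewrite mulr_ge0// expR_ge0.
  apply: (le_trans h); apply: ler_piMr => //.
elim: K => [|K IH]; first by rewrite big_ord0 expr0 invr1 subrr mulr0.
rewrite big_ord_recr/=; apply: (le_trans (lerD IH (lexx _))).
have e1 : expR (- (L + K%:R)) <= expR (- L) * (2 ^+ K)^-1.
  rewrite opprD expRD ler_wpM2l ?expR_ge0// expRN lef_pV2 ?posrE ?expR_gt0 ?exprn_gt0//.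
  rewrite -[K%:R]mul1r expRM_natr; apply: lerXn2r; rewrite ?nnegrE ?expR_ge0//.
  by have := expR_ge1Dx (1 : R); lra.
rewrite exprS invfM; set a := expR (- L) in e1 *; set b := (2 ^+ K)^-1 in e1 *.
have -> : 4 * a * (1 - 2^-1 * b) = 4 * a * (1 - b) + 2 * (a * b) by field.
by rewrite lerD2l ler_pM2l.
Qed.

Lemma event_chain K : (forall k, (k < K)%N -> q * 2 ^+ k <= 1) ->
  exists Bad, small P (4 * expR (- L)) Bad /\
  forall t, ~ Bad t -> forall k, (k < K)%N -> forall (f : netI d (scl k)) (f' : netI d (scl k.+1)),
    f \in net d (scl k) -> f' \in net d (scl k.+1) ->
    1 / 4 <= nrm2 (zvec f : _ -> R) -> 1 / 4 <= nrm2 (zvec f' : _ -> R) ->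
    nrm2 (fun j => zvec f' j - zvec f j : R) <= rk k ^+ 4 ->
   `|cnt (sgnb (zvec f')) t - cnt (sgnb (zvec f)) t| <= q * N * yk k.
Proof.
have [A00' L0' q0' q1' N0'] : [/\ 0 <= A0, 0 <= L, 0 < q, q < 1 & 0 < N] by [].
move=> hK.
have /choice[Bad hB] : forall k : 'I_K, exists Bad, small P (2 * expR (- (L + k%:R))) Bad /\
  forall t, ~ Bad t -> forall (f : netI d (scl k)) (f' : netI d (scl k.+1)),
    f \in net d (scl k) -> f' \in net d (scl k.+1) ->
    1 / 4 <= nrm2 (zvec f : _ -> R) -> 1 / 4 <= nrm2 (zvec f' : _ -> R) ->
    nrm2 (fun j => zvec f' j - zvec f j : R) <= rk k ^+ 4 ->
   `|cnt (sgnb (zvec f')) t - cnt (sgnb (zvec f)) t| <= q * N * yk k.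
  by move=> k; apply: event_chain_step; exact: hK.
exists [set t | exists2 k, k \in enum 'I_K & Bad k t]; split.
  apply: small_le (@sum_expN K) _.
  rewrite -big_enum/=; apply: small_seq => k _; by case: (hB k).
move=> t nB k kK; have [_ h] := hB (Ordinal kK); apply: h => Bt; apply: nB.
by exists (Ordinal kK) => //; rewrite mem_enum.
Qed.

Definition C3 : R := 23 + 2 * A0 + L.

(** At the finest level the entropy is [d (1 + 2 A0 + 8 K)], which is [O(q N)] because [d = q^2 N]
    and [K q] is bounded. The event has probability at most [2 q], so its mean count is of the same
    order. *)
Lemma event_near K : K%:R * q <= 1 + q ->
  exists Bad, small P (expR (- L)) Bad /\
  forall t, ~ Bad t -> forall f : netI d (scl K), f \in net d (scl K) ->
    1 / 4 <= nrm2 (zvec f : _ -> R) ->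
    isum (fun z => (`|dotT (zvec f) z.1| <= q)%R%:R) t <= C3 * q * N.
Proof.
have [A00' L0' q0' q1' N0'] : [/\ 0 <= A0, 0 <= L, 0 < q, q < 1 & 0 < N] by [].
move=> Kq.
pose F : {set netI d (scl K)} := [set f in net d (scl K) | 1 / 4 <= nrm2 (zvec f : _ -> R)].
pose x := C3 * q * N.
have bnd : #|F|%:R * expR (6 * q * N - x) <= expR (- L).
  apply: (@le_trans _ _ (expR (d%:R * (1 + 2 * (A0 + 4 * K%:R))) * expR (6 * q * N - x))).
    rewrite ler_wpM2r ?expR_ge0//; apply: le_trans (card_net_scl K).
    by rewrite ler_nat subset_leq_card//; apply/fintype.subsetP => f; rewrite inE => /andP[].
  rewrite -expRD; apply: le_trans (expR_dle L0); rewrite ler_expR -q2N /x /C3.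
  have -> : q ^+ 2 * N * (1 + 2 * (A0 + 4 * K%:R)) + (6 * q * N - (23 + 2 * A0 + L) * q * N)
    = q * N * (q * (1 + 2 * A0) + 8 * (K%:R * q) - 17 - 2 * A0 - L) by ring.
  have -> : - (q ^+ 2 * N * L) = q * N * (- (q * L)) by ring.
  rewrite ler_pM2l ?mulr_gt0//.
  have : q * (1 + 2 * A0) <= 1 * (1 + 2 * A0) by rewrite ler_wpM2r; lra.
  have : q * L <= 1 * L by rewrite ler_wpM2r; lra.
  lra.
exists [set t | exists2 f, f \in F & [set t | x <= isum (fun z => (`|dotT (zvec f) z.1| <= q)%R%:R) t] t]; split.
  apply: (small_le bnd); apply: small_fin => f; rewrite inE => /andP[_ f4].
  by apply: small_near => //; exact: ltW.
move=> t nB f fn f4; rewrite leNgt; apply/negP => h; apply: nB; exists f; last exact: ltW.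
by rewrite inE fn f4.
Qed.

Definition C4 : R := expR 5 + 1 + 2 * A0 + L.

(** It is used twice: with the sure event and [p = 1], to move from the finest net to any direction,
    and with [|xi| <= rho] and [p = rho], to compare [farb] with [devb]. *)
Lemma event_dot (B : RR -> bool) (p : R) : measurable [set y | B y] ->
  (gN [set y | B y] <= p%:E)%E -> d%:R <= p * N ->
  exists Bad, small P (expR (- L)) Bad /\
  forall t, ~ Bad t -> forall f : netI d (scl 0), f \in net d (scl 0) ->
    nrm2 (zvec f : _ -> R) <= 4 ->
    isum (fun z => (B z.2)%:R * `|dotT (zvec f) z.1|) t <= C4 * p * N.
Proof.
have [A00' L0' q0' q1' N0'] : [/\ 0 <= A0, 0 <= L, 0 < q, q < 1 & 0 < N] by [].
move=> mB PB dp.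
pose F : {set netI d (scl 0)} := [set f in net d (scl 0) | nrm2 (zvec f : _ -> R) <= 4].
pose x := C4 * p * N.
have bnd : #|F|%:R * expR (expR 5 * p * N - x) <= expR (- L).
  apply: (@le_trans _ _ (expR (d%:R * (1 + 2 * (A0 + 4 * 0%:R))) * expR (expR 5 * p * N - x))).
    rewrite ler_wpM2r ?expR_ge0//; apply: le_trans (card_net_scl 0).
    by rewrite ler_nat subset_leq_card//; apply/fintype.subsetP => f; rewrite inE => /andP[].
  rewrite -expRD; apply: le_trans (expR_dle L0); rewrite ler_expR /x /C4.
  have : d%:R * (1 + 2 * A0 + L) <= p * N * (1 + 2 * A0 + L) by rewrite ler_wpM2r//; lra.
  by rewrite mulr0n; lra.
exists [set t | exists2 f, f \in F & [set t | x <= isum (fun z => (B z.2)%:R * `|dotT (zvec f) z.1|) t] t]; split.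
  apply: (small_le bnd); apply: small_fin => f; rewrite inE => /andP[_ f4].
  exact: small_dot.
move=> t nB f fn f4; rewrite leNgt; apply/negP => h; apply: nB; exists f; last exact: ltW.
by rewrite inE fn f4.
Qed.

(** The mean count is at least [c6 * rho * N]; a quarter of it is kept. The lower bound imposed on
    [rho / q] makes another quarter outweigh the entropy of the coarsest net and the margin [L]. *)
Lemma event_far (rho : R) : 0 <= rho <= 1 -> 4 * (1 + 2 * A0 + L) / c6 * q <= rho ->
  exists Bad, small P (expR (- L)) Bad /\
  forall t, ~ Bad t -> forall f : netI d (scl 0), f \in net d (scl 0) ->
    1 / 4 <= nrm2 (zvec f : _ -> R) -> c6 * rho / 4 * N <= cnt (farb (zvec f) rho) t.
Proof.
have [A00' L0' q0' q1' N0'] : [/\ 0 <= A0, 0 <= L, 0 < q, q < 1 & 0 < N] by [].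
move=> r01 rq.
have c60 : 0 < c6 :> R by rewrite /c6 divr_gt0// expR_gt0.
pose F : {set netI d (scl 0)} := [set f in net d (scl 0) | 1 / 4 <= nrm2 (zvec f : _ -> R)].
pose x := c6 * rho / 4 * N.
have bnd : #|F|%:R * expR (x - c6 * rho / 2 * N) <= expR (- L).
  apply: (@le_trans _ _ (expR (d%:R * (1 + 2 * (A0 + 4 * 0%:R))) * expR (x - c6 * rho / 2 * N))).
    rewrite ler_wpM2r ?expR_ge0//; apply: le_trans (card_net_scl 0).
    by rewrite ler_nat subset_leq_card//; apply/fintype.subsetP => f; rewrite inE => /andP[].
  rewrite -expRD; apply: le_trans (expR_dle L0); rewrite ler_expR /x.
  have h : 4 * (1 + 2 * A0 + L) * q <= c6 * rho.
    by move: rq; rewrite mulrAC ler_pdivrMr// mulrC (mulrC rho).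
  have h2 : d%:R * (1 + 2 * A0 + L) <= c6 * rho / 4 * N.
    rewrite -q2N; have : (1 + 2 * A0 + L) * q * N <= c6 * rho / 4 * N.
      by rewrite ler_pM2r//; lra.
    apply: le_trans; rewrite (_ : _ * N * _ = (1 + 2 * A0 + L) * q * N * q); last by ring.
    have h3 : 0 <= (1 + 2 * A0 + L) * q * N.
      by apply: mulr_ge0; [apply: mulr_ge0; lra|exact: ltW].
    by apply: ler_piMr => //; exact: ltW.
  by rewrite mulr0n; lra.
exists [set t | exists2 f, f \in F & [set t | cnt (farb (zvec f) rho) t <= x] t]; split.
  apply: (small_le bnd); apply: small_fin => f; rewrite inE => /andP[_ f4].
  exact: small_far.
move=> t nB f fn f4; rewrite leNgt; apply/negP => h; apply: nB; exists f; last exact: ltW.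
by rewrite inE fn f4.
Qed.

End good_event.

Section seminorm.
Context {R : realType} (d n : nat) (I : {set 'I_n}).
Local Notation RR := (measurableTypeR R).
Local Notation U := (d.-tuple RR * RR)%type.
Local Notation isum := (@isum R _ U n I).

Lemma dotTZ (a : R) (v : 'I_d -> R) g : dotT (fun j => a * v j) g = a * dotT v g.
Proof. by rewrite /dotT mulr_sumr; apply: eq_bigr => j _; rewrite mulrA. Qed.

Lemma dotTB (u v : 'I_d -> R) g : dotT (fun j => u j - v j) g = dotT u g - dotT v g.
Proof. by rewrite /dotT -sumrB; apply: eq_bigr => j _; rewrite mulrBl. Qed.

Lemma nrm2Z (a : R) (v : 'I_d -> R) : nrm2 (fun j => a * v j) = a ^+ 2 * nrm2 v.
Proof. by rewrite /nrm2 mulr_sumr; apply: eq_bigr => j _; rewrite exprMn. Qed.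

Lemma nrm2_triangle (u v w : 'I_d -> R) :
  nrm2 (fun j => u j - w j) <= 2 * (nrm2 (fun j => u j - v j) + nrm2 (fun j => v j - w j)).
Proof.
rewrite /nrm2 -big_split/= mulr_sumr; apply: ler_sum => j _.
have -> : u j - w j = (u j - v j) + (v j - w j) by ring.
set x := u j - v j; set y := v j - w j.
have := sqr_ge0 (x - y); nra.
Qed.

Lemma nrm2_sub (u v : 'I_d -> R) : nrm2 u <= 2 * (nrm2 v + nrm2 (fun j => u j - v j)).
Proof.
rewrite /nrm2 -big_split/= mulr_sumr; apply: ler_sum => j _.
set x := u j; set y := v j.
have := sqr_ge0 (x - 2 * y); nra.
Qed.

Lemma coord_le (u : 'I_d -> R) j : nrm2 u <= 1 -> `|u j| <= 1.
Proof.
move=> u1; rewrite -(@ler_pXn2r _ 2)// ?nnegrE// expr1n real_normK ?num_real//.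
apply: le_trans u1; rewrite /nrm2 (bigD1 j)//= lerDl; apply: sumr_ge0 => i _; exact: sqr_ge0.
Qed.

(** The weighted sum [W] is a seminorm in [u], finite on the unit ball. Approximating by a net point
    leaves a remainder of norm at most [1 / M], so its supremum [s] satisfies [s <= C + s / M], and
    [M >= 2] gives [s <= 2 C]. *)
Lemma net_sup (M : nat) (w : U -> R) (C : R) t : (2 <= M)%N -> (1 <= d)%N ->
  (forall z, 0 <= w z) ->
  (forall f : netI d M, f \in net d M -> nrm2 (zvec f : _ -> R) <= 4 ->
     isum (fun z => w z * `|dotT (zvec f) z.1|) t <= C) ->
  forall (u : 'I_d -> R) (e : R), 0 < e -> nrm2 u <= e ^+ 2 ->
   isum (fun z => w z * `|dotT u z.1|) t <= 2 * C * e.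
Proof.
move=> M2 d1 w0 hC.
have M0 : 0 < M%:R :> R by rewrite ltr0n (leq_trans _ M2).
pose W (u : 'I_d -> R) : R := isum (fun z => w z * `|dotT u z.1|) t.
have WZ a u : 0 <= a -> W (fun j => a * u j) = a * W u.
  move=> a0; rewrite /W -isumZ; apply: eq_bigr => i _.
  by rewrite dotTZ normrM ger0_norm// mulrCA.
pose E : set R := [set W u | u in [set u | nrm2 u <= 1]].
have WE u : nrm2 u <= 1 -> E (W u) by move=> u1; exists u.
pose Wm : R := isum (fun z => w z * \sum_(j < d) `|tnth z.1 j|) t.
have ubE : ubound E Wm.
  move=> _ [u u1 <-]; apply: ler_sum => i _; rewrite ler_wpM2l//.
  apply: (le_trans (ler_norm_sum _ _ _)); apply: ler_sum => j _.
  by rewrite normrM ler_piMl// coord_le.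
have E0 : E !=set0.
  exists (W (fun=> 0)); apply: WE; rewrite /nrm2 big1// => j _; by rewrite expr0n.
have supE : has_sup E by split=> //; exists Wm.
have Sub u : nrm2 u <= 1 -> W u <= sup E.
  by move=> u1; apply: (sup_upper_bound supE); exact: WE.
have Wball u e : 0 < e -> nrm2 u <= e ^+ 2 -> W u <= e * sup E.
  move=> e0 ue; have -> : W u = e * W (fun j => e^-1 * u j).
    rewrite -WZ ?ltW//; congr W; apply/funext => j; rewrite mulrA divff ?mul1r//.
    exact: lt0r_neq0.
  rewrite ler_pM2l//; apply: Sub; rewrite nrm2Z exprVn mulrC ler_pdivrMr ?mul1r//.
  exact: exprn_gt0.
have SC : sup E <= 2 * C.
  suff : sup E <= C + M%:R^-1 * sup E.
    move=> h; have S0 : 0 <= sup E.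
      apply: le_trans (Sub (fun=> 0) _); last by rewrite /nrm2 big1// => j _; rewrite expr0n.
      by apply: sumr_ge0 => i _; rewrite mulr_ge0.
    have : M%:R^-1 * sup E <= 1 / 2 * sup E.
      apply: ler_wpM2r => //; rewrite div1r lef_pV2 ?posrE//.
      by rewrite ler_nat.
    lra.
  apply: ge_sup => // _ [u u1 <-].
  have [f fn [f1 f2]] := @net_approx R d M u (leq_trans (isT : (0 < 2)%N) M2) d1 u1.
  have WD : W u <= W (zvec f) + W (fun j => u j - zvec f j).
    rewrite /W -isumD; apply: ler_sum => i _; rewrite -mulrDr ler_wpM2l// dotTB.
    set a := dotT u _; set b := dotT (zvec f) _.
    by have := ler_normD b (a - b); rewrite addrC subrK.
  apply: (le_trans WD); apply: lerD.
    by apply: hC => //; apply: (le_trans f2); apply: (le_trans u1); lra.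
  by apply: Wball; rewrite ?invr_gt0// exprVn.
move=> u e e0 ue; apply: (le_trans (Wball u e e0 ue)).
by rewrite mulrC ler_pM2r.
Qed.

End seminorm.

Section uniform_good_event.
Context {R : realType} (d n : nat) (I : {set 'I_n}).
Local Notation RR := (measurableTypeR R).
Local Notation U := (d.-tuple RR * RR)%type.
Local Notation P := (iid (gB d) n).
Local Notation N := (#|I|%:R : R).
Local Notation isum := (@isum R _ U n I).
Local Notation cnt b := (isum (fun z : U => (b z)%:R)).

(** The clean samples whose contribution to the depth is lost when the regression vector moves by
    [rho * sigma] along [u], in whitened coordinates. *)
Definition devb (u : 'I_d -> R) (rho : R) (z : U) : bool :=
  (0 <= z.2 * dotT u z.1) && (z.2 * dotT u z.1 < rho * dotT u z.1 ^+ 2).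

(** [K] is the least integer with [q * 4^K >= 1], about [log (1 / q)]. Minimality gives both upper
    bounds; the last one also uses [k <= 4^k]. *)
Lemma exists_level (q : R) : 0 < q -> exists K : nat,
  [/\ 1 <= q * 4 ^+ K, (forall k, (k < K)%N -> q * 2 ^+ k <= 1) & K%:R * q <= 1 + q].
Proof.
move=> q0.
have le4 (k : nat) : k%:R <= 4 ^+ k :> R.
  by rewrite -natrX ler_nat ltnW// ltn_expl.
have ex : exists K, 1 <= q * 4 ^+ K.
  exists (Num.bound q^-1); rewrite mulrC -ler_pdivrMr//.
  apply: le_trans (le4 _); rewrite div1r ltW//.
  by apply: le_lt_trans (archi_boundP _); rewrite ?ler_norm// invr_ge0 ltW.
case: (ex_minnP ex) => K K1 Kmin; exists K; split=> // [k kK|].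
  have h : q * 4 ^+ k < 1.
    by rewrite ltNge; apply/negP => /Kmin; rewrite leqNgt kK.
  apply: le_trans (ltW h); rewrite ler_pM2l//; apply: lerXn2r; rewrite ?nnegrE//.
  by rewrite ler_nat.
case: K K1 Kmin => [|K] _ Kmin; first by rewrite mul0r addr_ge0// ltW.
have h : q * 4 ^+ K < 1.
  by rewrite ltNge; apply/negP => /Kmin; rewrite ltnn.
rewrite -natr1 mulrDl mul1r lerD2r; apply: le_trans (ltW h).
by rewrite mulrC ler_pM2l.
Qed.

(** A sign change forces a projection of size at most [q], or a difference of projections of size at
    least [q]. Replacing the second indicator by the difference divided by [q] leaves a seminorm,
    for which [net_sup] reaches all directions. *)
Lemma sgnb_neq (u v : 'I_d -> R) (z : U) (q : R) : 0 < q ->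
  `|(sgnb u z)%:R - (sgnb v z)%:R| <=
  (`|dotT v z.1| <= q)%R%:R + q^-1 * ((true)%:R * `|dotT (fun j => u j - v j) z.1|) :> R.
Proof.
move=> q0; rewrite mul1r dotTB /sgnb; set a := dotT u z.1; set b := dotT v z.1.
have t0 : 0 <= q^-1 * `|a - b| by rewrite mulr_ge0// invr_ge0 ltW.
have [bq|bq] := leP `|b| q.
  case: (0 <= _) => /=; case: (0 <= _) => /=;
    rewrite ?subrr ?subr0 ?sub0r ?normrN ?normr1 ?normr0; lra.
have [h|h] := leP q `|a - b|.
  have t1 : 1 <= q^-1 * `|a - b| by rewrite mulrC ler_pdivlMr// mul1r.
  case: (0 <= _) => /=; case: (0 <= _) => /=;
    rewrite ?subrr ?subr0 ?sub0r ?normrN ?normr1 ?normr0; lra.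
suff -> : (0 <= z.2 * a) = (0 <= z.2 * b) by rewrite subrr normr0 add0r.
have [b0|b0] := ltP 0 b.
  have a0 : 0 < a by move: bq h; rewrite gtr0_norm// ltr_norml => h1 /andP[h2 h3]; lra.
  by rewrite !pmulr_lge0.
have b0' : b < 0.
  rewrite lt_neqAle b0 andbT; apply/eqP => b00; rewrite b00 normr0 in bq; lra.
have a0 : a < 0 by move: bq h; rewrite ltr0_norm// ltr_norml => h1 /andP[h2 h3]; lra.
by rewrite !nmulr_lge0.
Qed.

(** The factor 10 adds up the six exceptional events: 2 for the coarsest net, 4 for the chain, and 1
    for each of the other four. *)
Lemma good_event (A0 L q rho : R) (M0 : nat) :
  (2 <= M0)%N -> 0 <= A0 -> M0.+1%:R <= expR A0 -> 0 <= L -> (1 <= d)%N ->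
  0 < q -> q < 1 -> q ^+ 2 * N = d%:R -> 0 < rho -> rho <= 1 -> q <= rho ->
  4 * (1 + 2 * A0 + L) / c6 * q <= rho -> 16 * C4 A0 L <= c6 * M0%:R ->
  exists Bad, small P (10 * expR (- L)) Bad /\
   forall t, ~ Bad t -> forall u, nrm2 u = 1 ->
    `|cnt (sgnb u) t - N / 2| <= (yb A0 L / 2 + (2 * B1 A0 L + 68) + C3 A0 L + 2 * C4 A0 L) * (q * N) /\
    c6 * rho / 8 * N <= cnt (devb u rho) t.
Proof.
have aux1 (a b c : R) : b <= 1 / 4 * c -> 1 <= 2 * (a + b) -> c <= 1 -> 1 / 4 <= a.
  by move=> *; lra.
have aux2 (x y a b c : R) : x <= 2 * (a + b) -> c <= y -> b <= 1 / 4 * y ->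
    a <= 1 / 4 * c -> x <= y.
  by move=> *; lra.
have aux3 (c M y z : R) : - (z * y) <= 2 * c - M -> 2 * c - M <= z * y ->
    - (z * (y / 2)) <= c - M / 2 /\ c - M / 2 <= z * (y / 2).
  by move=> *; split; lra.
have aux6 (a b : R) : `|a - b| < 1 -> 2 <= b -> 1 < a /\ 0 < a.
  by rewrite ltr_norml => /andP[*]; split; lra.
have aux4 (x y : R) : 0 <= x -> x <= y -> 1 / 4 * x <= y by move=> *; lra.
have aux5 (x y z a : R) : 2 * a = x -> y <= a -> x <= z + y -> a <= z by move=> *; lra.
move=> M02 A00 MA L0 d1 q0 q1 q2N rho0 rho1 qrho rhoq M0C.
have N0 : 0 < N.
  have : 0 < q ^+ 2 * N by rewrite q2N ltr0n.
  by rewrite pmulr_rgt0// exprn_gt0.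
have [K [K1 K2 K3]] := exists_level q0.
have dN : d%:R <= 1 * N.
  rewrite -q2N; apply: ler_wpM2r; first exact: ltW.
  by apply: exprn_ile1; exact: ltW.
have drN : d%:R <= rho * N.
  rewrite -q2N; apply: ler_wpM2r; first exact: ltW.
  by apply: le_trans qrho; rewrite expr2 ler_piMr ?ltW.
have mT : measurable [set y : RR | true] by rewrite (_ : [set y | _] = setT)//; apply/seteqP; split.
have gT : (gN [set y : RR | true] <= 1%:E)%E by exact: (probability_le1 gN mT).
have mB : measurable [set y : RR | (`|y| <= rho)%R].
  by apply: measurable_set_le => //; exact: measurableT_comp.
have r01 : 0 <= rho <= 1 by rewrite ltW.
have [Bad1 [s1 h1]] := event_base M02 A00 MA L0 d1 q0 q1 q2N.
have [Bad2 [s2 h2]] := event_chain M02 A00 MA L0 d1 q0 q1 q2N K2.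
have [Bad3 [s3 h3]] := event_near M02 A00 MA L0 d1 q0 q1 q2N K3.
have [Bad4 [s4 h4]] := event_dot M02 A00 MA L0 d1 q0 q1 q2N mT gT dN.
have [Bad5 [s5 h5]] := event_dot M02 A00 MA L0 d1 q0 q1 q2N mB (gN_small (ltW rho0)) drN.
have [Bad6 [s6 h6]] := event_far M02 A00 MA L0 d1 q0 q1 q2N r01 rhoq.
exists (Bad1 `|` (Bad2 `|` (Bad3 `|` (Bad4 `|` (Bad5 `|` Bad6))))); split.
  apply: small_le (small_setU s1 (small_setU s2 (small_setU s3 (small_setU s4 (small_setU s5 s6))))).
  by rewrite le_eqVlt; apply/orP; left; apply/eqP; ring.
move=> t nB u u1.
have {}h1 := h1 t (fun b => nB (or_introl b)).
have {}h2 := h2 t (fun b => nB (or_intror (or_introl b))).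
have {}h3 := h3 t (fun b => nB (or_intror (or_intror (or_introl b)))).
have {}h4 := h4 t (fun b => nB (or_intror (or_intror (or_intror (or_introl b))))).
have {}h5 := h5 t (fun b => nB (or_intror (or_intror (or_intror (or_intror (or_introl b)))))).
have {}h6 := h6 t (fun b => nB (or_intror (or_intror (or_intror (or_intror (or_intror b)))))).
have u1' : nrm2 u <= 1 by rewrite u1.
have M00 : (0 < M0)%N by exact: leq_trans M02.
have ex k : exists f : netI d (scl M0 k), f \in net d (scl M0 k) /\
    (nrm2 (fun j => u j - zvec f j) <= (scl M0 k)%:R ^- 2 /\ nrm2 (zvec f) <= nrm2 u).
  have [f fn ff] := @net_approx R d (scl M0 k) u (scl_gt0 M02 k) d1 u1'.
  by exists f.
have [f hf] : exists f : (forall k, netI d (scl M0 k)), forall k, f k \in net d (scl M0 k) /\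
    (nrm2 (fun j => u j - zvec (f k) j) <= (scl M0 k)%:R ^- 2 /\ nrm2 (zvec (f k)) <= nrm2 u).
  by exists (fun k => sval (cid (ex k))) => k; exact: (svalP (cid (ex k))).
have fnet k : f k \in net d (scl M0 k) by case: (hf k).
have fle k : nrm2 (zvec (f k) : _ -> R) <= 1 by have [_ [_ h]] := hf k; rewrite -u1.
have sclk k : 2 * 16 ^+ k <= (scl M0 k)%:R :> R.
  by rewrite /scl natrM natrX ler_wpM2r ?exprn_ge0// ler_nat.
have fapp k : nrm2 (fun j => u j - zvec (f k) j) <= (2 * 16 ^+ k) ^- 2.
  have [_ [h _]] := hf k; apply: (le_trans h).
  rewrite lef_pV2 ?posrE ?exprn_gt0 ?mulr_gt0 ?exprn_gt0//; last first.
    by apply: lt_le_trans (sclk k); rewrite mulr_gt0// exprn_gt0.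
  by apply: lerXn2r; rewrite ?nnegrE ?mulr_ge0 ?exprn_ge0.
have f16 k : (2 * 16 ^+ k) ^- 2 = 1 / 4 * rk k ^+ 4 :> R.
  rewrite /rk (_ : 16 = 4 ^+ 2); last by rewrite -natrX.
  rewrite -exprM mulnC exprM; set a := 4 ^+ k.
  have a0 : a != 0 by rewrite gt_eqF// exprn_gt0.
  by field.
have rk1 k : rk k <= 1 :> R by rewrite /rk invf_le1 ?exprn_gt0// exprn_ege1// ler1n.
have rk0 k : 0 <= rk k :> R by rewrite /rk invr_ge0 exprn_ge0.
have rk4 k : rk k ^+ 4 <= 1 :> R by rewrite exprn_ile1.
have f4 k : 1 / 4 <= nrm2 (zvec (f k) : _ -> R).
  have h1' := nrm2_sub u (zvec (f k)); have h2' := fapp k; rewrite f16 in h2'; rewrite u1 in h1'.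
  exact: aux1 h2' h1' (rk4 k).
have fstep k : nrm2 (fun j => zvec (f k.+1) j - zvec (f k) j : R) <= rk k ^+ 4.
  have := nrm2_triangle (zvec (f k.+1)) u (zvec (f k)).
  have -> : nrm2 (fun j => zvec (f k.+1) j - u j) = nrm2 (fun j => u j - zvec (f k.+1) j).
    by apply: eq_bigr => j _; rewrite -sqrrN opprB.
  move=> g1; have g2 := fapp k; have g3 := fapp k.+1; rewrite f16 in g2; rewrite f16 in g3.
  apply: aux2 g1 _ g2 g3.
  apply: lerXn2r; rewrite ?nnegrE ?rk0// /rk lef_pV2 ?posrE ?exprn_gt0//.
  by rewrite exprS ler_peMl ?exprn_ge0// ler1n.
have qN0 : 0 < q * N by rewrite mulr_gt0.
split.
  have chain : forall k, (k <= K)%N ->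
     `|cnt (sgnb (zvec (f k))) t - N / 2| <= q * N * (yb A0 L / 2 + \sum_(i < k) yk A0 L i).
    elim=> [_|k IH kK].
      rewrite big_ord0 addr0.
      have := h1 (f 0) (fnet 0) (f4 0); set c := isum _ t; rewrite !ler_norml => /andP[g1 g2].
      by have [g3 g4] := aux3 _ _ _ _ g1 g2; apply/andP.
    have e1 := IH (ltnW kK).
    have e2 := h2 k kK (f k) (f k.+1) (fnet k) (fnet k.+1) (f4 k) (f4 k.+1) (fstep k).
    rewrite big_ord_recr/= addrA mulrDr.
    set c := isum _ t in e1 e2 *; set c' := isum _ t in e2 *.
    have -> : c' - N / 2 = (c' - c) + (c - N / 2) by ring.
    apply: (le_trans (ler_normD _ _)); rewrite [X in _ <= X]addrC; exact: lerD.
  have {}chain : `|cnt (sgnb (zvec (f K))) t - N / 2| <= q * N * (yb A0 L / 2 + (2 * B1 A0 L + 68)).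
    apply: (le_trans (chain K (leqnn K))); rewrite ler_pM2l// lerD2l.
    exact: (sum_yk A00 L0 d1 q0 q1 q2N).
  have n3 := h3 (f K) (fnet K) (f4 K).
  (* At level [K] the distance to [u] is at most [q^2], since [4^-K <= q]; the later division by [q]
     then leaves the target order [q * N]. *)
  have n4 : isum (fun z => true%:R * `|dotT (fun j => u j - zvec (f K) j) z.1|) t <= 2 * (C4 A0 L * 1 * N) * q ^+ 2.
    apply: (@net_sup R d n I (scl M0 0) (fun=> true%:R)) => //.
    - by rewrite /scl expn0 muln1.
    - exact: exprn_gt0.
    apply: (le_trans (fapp K)).
    have q4 : (4 ^+ K)^-1 <= q by rewrite -[_^-1]mul1r ler_pdivrMr// exprn_gt0.
    rewrite f16 -exprM; apply: aux4; first by rewrite exprn_ge0.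
    by apply: lerXn2r; rewrite ?nnegrE ?(ltW q0).
  have last : `|cnt (sgnb u) t - cnt (sgnb (zvec (f K))) t| <= (C3 A0 L + 2 * C4 A0 L) * (q * N).
    rewrite -isumB; apply: (le_trans (ler_norm_sum _ _ _)).
    apply: (@le_trans _ _ (isum (fun z => (`|dotT (zvec (f K)) z.1| <= q)%R%:R + q^-1 * ((true)%:R * `|dotT (fun j => u j - zvec (f K) j) z.1|)) t)).
      by apply: ler_sum => i _; exact: sgnb_neq.
    rewrite isumD isumZ mulrDl; apply: lerD; first by rewrite mulrA.
    rewrite mulrC ler_pdivrMr//; apply: (le_trans n4).
    by rewrite le_eqVlt; apply/orP; left; apply/eqP; ring.
  set c := isum _ t in chain last *; set c' := isum _ t in last *.
  have -> : c' - N / 2 = (c' - c) + (c - N / 2) by ring.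
  apply: (le_trans (ler_normD _ _)); apply: (le_trans (lerD last chain)).
  by rewrite le_eqVlt; apply/orP; left; apply/eqP; ring.
have n5 : isum (fun z => (`|z.2| <= rho)%R%:R * `|dotT (fun j => u j - zvec (f 0) j) z.1|) t <= 2 * (C4 A0 L * rho * N) * (M0%:R)^-1.
  apply: (@net_sup R d n I (scl M0 0) (fun z : U => (`|z.2| <= rho)%R%:R)) => //.
  - by rewrite /scl expn0 muln1.
  - by rewrite invr_gt0 ltr0n.
  by have [_ [h _]] := hf 0; apply: (le_trans h); rewrite /scl expn0 muln1 exprVn.
have n6 := h6 (f 0) (fnet 0) (f4 0).
(* If the projections on [u] and the net point differ by at least 1, the seminorm term pays for the
   sample. Otherwise the projection [a] on [u] exceeds 1, and [xi * a <= rho * a < rho * a^2]. *)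
have pt : cnt (farb (zvec (f 0)) rho) t <= cnt (devb u rho) t +
   isum (fun z => (`|z.2| <= rho)%R%:R * `|dotT (fun j => u j - zvec (f 0) j) z.1|) t.
  rewrite -isumD; apply: ler_sum => i _; set z := tnth t i.
  rewrite dotTB /farb /devb; set a := dotT u z.1; set b := dotT (zvec _) z.1.
  have [/andP[/andP[y0 yr] b2]|_] := boolP (_ && _); last first.
    by rewrite addr_ge0// mulr_ge0.
  have -> : (`|z.2| <= rho)%R by rewrite ger0_norm.
  have [h|h] := leP 1 `|a - b|; first by rewrite mul1r -[X in X <= _]add0r lerD.
  have [a1 a0] := aux6 _ _ h b2.
  have -> : 0 <= z.2 * a by rewrite mulr_ge0// ltW.
  have -> : z.2 * a < rho * a ^+ 2.
    rewrite expr2 mulrA ltr_pM2r//; apply: (le_lt_trans yr); by rewrite ltr_pMr.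
  by rewrite lerDl mulr_ge0.
have M0R : 0 < M0%:R :> R by rewrite ltr0n.
(* The choice of a large [M0] makes the transfer error at most half of the count guaranteed by
   [event_far]. *)
have n7 : 2 * (C4 A0 L * rho * N) * (M0%:R)^-1 <= c6 * rho / 8 * N.
  rewrite ler_pdivrMr//.
  have h7 : 16 * C4 A0 L * (rho * N) <= c6 * M0%:R * (rho * N).
    by apply: ler_wpM2r => //; apply: mulr_ge0; exact: ltW.
  have -> : 2 * (C4 A0 L * rho * N) = 1 / 8 * (16 * C4 A0 L * (rho * N)) by field.
  have -> : c6 * rho / 8 * N * M0%:R = 1 / 8 * (c6 * M0%:R * (rho * N)) by field.
  by apply: ler_wpM2l.
by apply: aux5 (le_trans n5 n7) (le_trans n6 pt); field.
Qed.

End uniform_good_event.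

(** * Regression depth and the upper bound *)

Section constants.
Context {R : realType}.

Lemma expR7_small : 10 * expR (- 7) <= 1 / 10 :> R.
Proof.
have h : expR (- 7) <= (1 / 2) ^+ 7 :> R.
  rewrite -[7]mul1r -mulNr expRM_natr; apply: lerXn2r; rewrite ?nnegrE ?expR_ge0//.
  exact: expRN1_le.
apply: (@le_trans _ _ (10 * (1 / 2) ^+ 7)); first by rewrite ler_wpM2l.
by rewrite !exprS expr0; lra.
Qed.

(** The requirement looks circular, as [C4] depends on [A0], which must dominate the logarithm of
    [M0 + 1]. But [C4] is affine in [A0] while [M0] may be nearly [expR A0], so a large [A0]
    works. *)
Lemma upper_constants : exists (A0 : R) (M0 : nat),
  [/\ (2 <= M0)%N, 0 <= A0, M0.+1%:R <= expR A0 & 16 * C4 A0 7 <= c6 * M0%:R].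
Proof.
pose k0 : R := 16 / c6; pose k1 : R := expR 5 + 8.
have c60 : 0 < c6 :> R by rewrite /c6 divr_gt0// expR_gt0.
have k00 : 0 < k0 by rewrite divr_gt0.
have k10 : 8 <= k1 by rewrite /k1; have := expR_ge0 (5 : R); lra.
(* Chosen so that [A0^2 / 2], a lower bound for [expR A0 - 1], exceeds the affine function
   [k0 * (k1 + 2 * A0)] with room for rounding down. *)
pose A0 : R := 4 * k0 + k0 * k1 * 2 + 10.
have k01 : 0 < k0 * k1 by apply: mulr_gt0 => //; lra.
have A00 : 10 <= A0 by rewrite /A0; lra.
have e : 1 + A0 ^+ 2 / 2 <= expR A0 by have := @expR_ge1Dxn R A0 1; rewrite factE/=; apply; lra.
have tr := truncn_itv (expR_ge0 A0).
have T2 : (3 < Num.truncn (expR A0))%N.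
  have A2 : 100 <= A0 ^+ 2 by rewrite (_ : 100 = 10 ^+ 2); [apply: lerXn2r; rewrite ?nnegrE//; lra|rewrite -natrX].
  by rewrite -(ltr_nat R); case/andP : tr => _; rewrite -natr1; lra.
move: (Num.truncn _) T2 tr => -[//|T] T2 /andP[tr1 tr2].
exists A0, T; split; [exact: ltnW|by lra|exact: tr1|].
have -> : 16 * C4 A0 7 = c6 * (k0 * (k1 + 2 * A0)).
  rewrite /C4 /k0 /k1; field; exact: lt0r_neq0.
rewrite ler_pM2l//.
have h : expR A0 - 2 <= T%:R by move: tr2; rewrite -natr1 -natr1; lra.
apply: le_trans h; apply: (@le_trans _ _ (A0 ^+ 2 / 2 - 1)); last by lra.
have : A0 ^+ 2 / 2 = A0 * (2 * k0) + A0 * (k0 * k1) + A0 * 5 by rewrite expr2 {2}/A0; field.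
move=> ->; have : 1 * (k0 * k1) <= A0 * (k0 * k1) by rewrite ler_pM2r//; lra.
lra.
Qed.

End constants.

Section depth.
Context {R : realType} (n d : nat).
Local Notation RR := (measurableTypeR R).
Local Notation U := (d.-tuple RR * RR)%type.

(** The samples kept by the threshold weights; individually they may still be contaminated. *)
Definition clean_set (lam : 'I_n -> R) (t : R) : {set 'I_n} := finset (fun i => lam i <= t).

Lemma NcountE (lam : 'I_n -> R) t : Ncount lam t = #|clean_set lam t|.
Proof. by apply: eq_card => i; rewrite !inE; apply/idP/idP; rewrite ?inE. Qed.

Definition rowf (v : 'rV[R]_d) : 'I_d -> R := fun j => v 0 j.
Definition tuprow (g : d.-tuple RR) : 'rV[R]_d := \row_j tnth g j.

Lemma dotv_dotT (v : 'rV[R]_d) (S : 'M[R]_d) (g : d.-tuple RR) :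
  dotv v (tuprow g *m S^T) = dotT (rowf (v *m S)) g.
Proof.
rewrite /dotv trmx_mul trmxK mulmxA mxE /dotT; apply: eq_bigr => j _.
by rewrite /rowf !mxE.
Qed.

Lemma dotvC (v w : 'rV[R]_d) : dotv v w = dotv w v.
Proof. by rewrite /dotv !mxE; apply: eq_bigr => j _; rewrite !mxE mulrC. Qed.

Lemma dotvv (v : 'rV[R]_d) : dotv v v = nrm2 (rowf v).
Proof. by rewrite /dotv mxE; apply: eq_bigr => j _; rewrite !mxE expr2. Qed.

Lemma sqnormS_nrm2 (Sigma S : 'M[R]_d) (x : 'rV[R]_d) : S *m S^T = Sigma ->
  sqnormS Sigma x = nrm2 (rowf (x *m S)).
Proof.
move=> <-; rewrite -dotvv /sqnormS /dotv.
by rewrite trmx_mul !mulmxA.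
Qed.

Lemma nrm2_eq0 (v : 'rV[R]_d) : nrm2 (rowf v) = 0 -> v = 0.
Proof.
move=> h; apply/rowP => j; rewrite mxE.
have /allP/(_ j) : all (fun i => rowf v i ^+ 2 == 0) (index_enum 'I_d).
  by move: h => /eqP; rewrite /nrm2 psumr_eq0// => i _; exact: sqr_ge0.
by rewrite mem_index_enum => /(_ isT); rewrite sqrf_eq0 => /eqP.
Qed.

Lemma nrm2_mulS_gt0 (Sigma S : 'M[R]_d) (x : 'rV[R]_d) : S *m S^T = Sigma -> posdef Sigma ->
  x != 0 -> 0 < nrm2 (rowf (x *m S)).
Proof. by move=> SS [_ pd] x0; rewrite -(sqnormS_nrm2 x SS); exact: pd. Qed.

Definition dval (lam : 'I_n -> R) t (eta v : 'rV[R]_d) (z : sample n d) : R :=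
  (\sum_(i in clean_set lam t) (0 <= ((z i).2 - dotv eta (z i).1) * dotv v (z i).1)%R%:R)
   / #|clean_set lam t|%:R.

Lemma depthwE (lam : 'I_n -> R) t (eta : 'rV[R]_d) (z : sample n d) :
  depthw (wthr lam t) eta z =
  inf [set dval lam t eta v z | v in [set v : 'rV[R]_d | dotv v v = 1]].
Proof.
congr inf; congr image; apply/funext => v; rewrite /dval mulr_suml [in RHS]big_mkcond/=.
apply: eq_bigr => i _; rewrite /wthr NcountE inE.
by case: (lam i <= t); case: (0 <= _); rewrite ?mulr1 ?mulr0 ?mul0r.
Qed.

Lemma dval_ge0 lam t eta v z : 0 <= dval lam t eta v z.
Proof. by rewrite /dval divr_ge0// sumr_ge0. Qed.

Lemma depthw_le lam t (eta v : 'rV[R]_d) (z : sample n d) : dotv v v = 1 ->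
  depthw (wthr lam t) eta z <= dval lam t eta v z.
Proof.
move=> v1; rewrite depthwE; apply: ge_inf; last by exists v.
by exists 0 => _ [u _ <-]; exact: dval_ge0.
Qed.

Lemma exists_unit : (1 <= d)%N -> exists v : 'rV[R]_d, dotv v v = 1.
Proof.
move=> d1; pose j0 := Ordinal d1; exists (delta_mx 0 j0).
rewrite dotvv /nrm2 (bigD1 j0)//= /rowf mxE !eqxx expr1n big1 ?addr0// => j jj.
by rewrite mxE (negbTE jj) expr0n.
Qed.

Lemma depthw_ge lam t (eta : 'rV[R]_d) (z : sample n d) x : (1 <= d)%N ->
  (forall v, dotv v v = 1 -> x <= dval lam t eta v z) ->
  x <= depthw (wthr lam t) eta z.
Proof.
move=> d1 h; rewrite depthwE; apply: lb_le_inf.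
  by have [v v1] := exists_unit d1; exists (dval lam t eta v z); exists v.
by move=> _ [v v1 <-]; exact: h.
Qed.

Lemma sgnbZ (a : R) (v : 'I_d -> R) (z : U) : 0 < a -> sgnb (fun j => a * v j) z = sgnb v z.
Proof. by move=> a0; rewrite /sgnb dotTZ mulrCA pmulr_rge0. Qed.

Local Notation cnt I b := (@isum R _ U n I (fun z : U => (b z)%:R)).

(** The argument is deterministic. In every direction the true vector keeps at least a fraction
    [1 / 2 - a - b]. Along its own error, a far candidate counts a clean sample only if
    [xi <u, g> >= rho <u, g>^2], hence one in [sgnb] and not in [devb]; its fraction is at most
    [1 / 2 + a - c + b]. *)
Lemma depth_separation (Sigma S : 'M[R]_d) (sigma t rho a b c : R) (lam : 'I_n -> R)
    (beta eta : 'rV[R]_d) (z : sample n d) (g : n.-tuple U) (B : 'I_n -> bool) :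
  (1 <= d)%N -> S *m S^T = Sigma -> posdef Sigma -> 0 < sigma ->
  (0 < #|clean_set lam t|)%N ->
  (forall i, ~~ B i -> z i = (tuprow (tnth g i).1 *m S^T,
      dotv (tuprow (tnth g i).1 *m S^T) beta + sigma * (tnth g i).2)) ->
  (forall u : 'I_d -> R, nrm2 u = 1 ->
     `|cnt (clean_set lam t) (sgnb u) g - #|clean_set lam t|%:R / 2| <= a * #|clean_set lam t|%:R /\
     c * #|clean_set lam t|%:R <= cnt (clean_set lam t) (devb u rho) g) ->
  \sum_(i in clean_set lam t) (B i)%:R <= b * #|clean_set lam t|%:R ->
  2 * a + 2 * b < c -> 0 < rho -> (rho * sigma) ^+ 2 <= sqnormS Sigma (eta - beta) ->
  depthw (wthr lam t) eta z < depthw (wthr lam t) beta z.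
Proof.
move=> d1 SS pd s0; set I := clean_set lam t => I0 zE good Bb abc rho0 far.
have N0 : 0 < #|I|%:R :> R by rewrite ltr0n.
apply: (@lt_le_trans _ _ (1 / 2 - a - b)); last first.
  apply: depthw_ge => // v v1.
  have v0 : v != 0.
    by apply/eqP => v0; move: v1; rewrite v0 /dotv mul0mx mxE => /esym/eqP; rewrite oner_eq0.
  have nv := nrm2_mulS_gt0 SS pd v0; set u := rowf (v *m S) in nv.
  have sv : 0 < (Num.sqrt (nrm2 u))^-1 by rewrite invr_gt0 sqrtr_gt0.
  pose u' j := (Num.sqrt (nrm2 u))^-1 * u j.
  have u'1 : nrm2 u' = 1.
    by rewrite nrm2Z exprVn sqr_sqrtr ?nrm2_ge0// mulVf// gt_eqF.
  have [/ler_normlP[h _] _] := good u' u'1.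
  rewrite /dval ler_pdivlMr// -/I.
  apply: (@le_trans _ _ (cnt I (sgnb u') g - \sum_(i in I) (B i)%:R)).
    by move: h; set x := isum _ _ _ => h; lra.
  rewrite /isum -sumrB; apply: ler_sum => i _.
  have [Bi|Bi] := boolP (B i).
    apply: (@le_trans _ _ 0) => //; rewrite subr_le0; by case: (sgnb _ _).
  rewrite subr0 (sgnbZ _ _ sv) (zE i Bi)/=.
  rewrite (dotvC beta) addrAC subrr add0r dotv_dotT -/u /sgnb -mulrA.
  by rewrite (pmulr_rge0 _ s0).
have eb0 : eta - beta != 0.
  apply/eqP => e0; move: far; rewrite e0 /sqnormS !mul0mx mxE.
  by rewrite leNgt exprn_gt0// mulr_gt0.
set r2 := sqnormS Sigma (eta - beta) in far.
have r2E : r2 = nrm2 (rowf ((eta - beta) *m S)) by exact: sqnormS_nrm2.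
have r20 : 0 < r2 by rewrite r2E; exact: (nrm2_mulS_gt0 SS pd eb0).
pose r := Num.sqrt r2.
have r0 : 0 < r by rewrite sqrtr_gt0.
have rE : r ^+ 2 = r2 by rewrite sqr_sqrtr// ltW.
have rrho : rho * sigma <= r.
  rewrite -(@ler_pXn2r _ 2) ?nnegrE ?rE//; last exact: ltW.
  by rewrite mulr_ge0// ltW.
(* The error is normalised twice: [u] is a unit vector after whitening by [S], as the good event
   needs, while [v] below is a Euclidean unit vector, as the depth needs. *)
pose u j := r^-1 * rowf ((eta - beta) *m S) j.
have u1 : nrm2 u = 1 by rewrite nrm2Z -r2E exprVn rE mulVf// gt_eqF.
have [/ler_normlP[_ h1] h2] := good u u1.
have ne0 : 0 < dotv (eta - beta) (eta - beta).
  rewrite dotvv lt_neqAle nrm2_ge0 andbT eq_sym; apply/eqP => /nrm2_eq0 /eqP.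
  by rewrite (negbTE eb0).
pose k := (Num.sqrt (dotv (eta - beta) (eta - beta)))^-1.
have k0 : 0 < k by rewrite invr_gt0 sqrtr_gt0.
pose v := k *: (eta - beta).
have v1 : dotv v v = 1.
  rewrite /v /dotv linearZ/= -scalemxAl -scalemxAr scalerA mxE -/(dotv _ _).
  by rewrite -expr2 exprVn sqr_sqrtr ?ltW// mulVf// gt_eqF.
apply: (le_lt_trans (depthw_le _ _ _ _ v1)).
rewrite /dval ltr_pdivrMr// -/I.
apply: (@le_lt_trans _ _ (cnt I (sgnb u) g - cnt I (devb u rho) g + \sum_(i in I) (B i)%:R)); last first.
  move: h1 h2; set x := isum _ _ _; set y := isum _ _ _ => h1 h2.
  have : (2 * a + 2 * b) * #|I|%:R < c * #|I|%:R by rewrite ltr_pM2r.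
  lra.
rewrite -isumB /isum -big_split/=; apply: ler_sum => i _.
have ds : (devb u rho (tnth g i))%:R <= (sgnb u (tnth g i))%:R :> R.
  by rewrite /devb /sgnb; case: (0 <= _) => //=; case: (_ < _).
have [Bi|Bi] := boolP (B i).
  apply: (@le_trans _ _ 1); first by case: (0 <= _).
  by rewrite lerDr subr_ge0.
rewrite addr0 (zE i Bi)/=; set W := tuprow _ *m S^T.
have [cond|_] := boolP (0 <= _); last by rewrite subr_ge0.
have vW : dotv v W = k * r * dotT u (tnth g i).1.
  rewrite /v /dotv -scalemxAl mxE -/(dotv _ _) dotv_dotT /u dotTZ mulrA.
  by rewrite -[k * r * _]mulrA divff ?mulr1// gt_eqF.
have resW : dotv W beta + sigma * (tnth g i).2 - dotv eta W =
    sigma * (tnth g i).2 - r * dotT u (tnth g i).1.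
  have -> : r * dotT u (tnth g i).1 = dotv (eta - beta) W.
    by rewrite dotv_dotT /u dotTZ mulrA divff ?mul1r// gt_eqF.
  have -> : dotv (eta - beta) W = dotv eta W - dotv beta W by rewrite /dotv mulmxBl !mxE.
  by rewrite (dotvC W beta); ring.
rewrite resW vW in cond; set x := dotT u _ in cond *; set y := (tnth g i).2 in cond *.
have c2 : r * x ^+ 2 <= sigma * (y * x).
  rewrite mulrCA (pmulr_rge0 _ (mulr_gt0 k0 r0)) in cond.
  by move: cond; rewrite mulrBl subr_ge0 expr2 !mulrA.
have c3 : rho * x ^+ 2 <= y * x.
  rewrite -(ler_pM2l s0); apply: le_trans c2; rewrite mulrA; apply: ler_wpM2r; first exact: sqr_ge0.
  by rewrite mulrC.
have c4 : 0 <= y * x by apply: le_trans c3; rewrite mulr_ge0 ?sqr_ge0// ltW.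
by rewrite /sgnb /devb -/x -/y c4 /= ltNge c3 subr0.
Qed.

End depth.

(** * The depth estimator under contamination *)

Section upper.
Context {R : realType}.
Local Notation RR := (measurableTypeR R).

Lemma bernoulli_true (p : R) : 0 <= p <= 1 -> bernoulli_prob p [set true] = p%:E.
Proof.
move=> p01; rewrite bernoulli_probE// !diracE mem_set// memNset//= mule1 mule0 adde0//.
Qed.

(** Markov's inequality: the expected number of contaminated samples in [I] is at most
    [t * #|I|]. *)
Lemma contamination_count (n : nat) (d0 : measure_display) (T : measurableType d0)
    (mu : probability T R) (B : 'I_n -> T -> bool) (lam : 'I_n -> R) (I : {set 'I_n}) (t x : R) :
  (forall i, 0 <= lam i <= 1) -> (forall i, measurable_fun setT (B i)) ->
  (forall i A, measurable A -> mu (B i @^-1` A) = bernoulli_prob (lam i) A) ->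
  (forall i, i \in I -> lam i <= t) -> 0 < x ->
  small mu (t * #|I|%:R / x) [set w | x <= \sum_(i in I) (B i w)%:R].
Proof.
move=> l01 mB lB lt x0.
have mBi i : measurable [set w | B i w].
  rewrite (_ : [set w | _] = B i @^-1` [set true]).
    by rewrite -[X in measurable X]setTI; exact: mB.
  by apply/seteqP; split=> w /=.
have mf : measurable_fun [set: T] (fun w => \sum_(i in I) (B i w)%:R : R).
  rewrite (_ : (fun w => _) = fun w => \sum_(i < n) (if i \in I then (B i w)%:R else 0)); last first.
    by apply/funext => w; rewrite big_mkcond.
  apply: (@measurable_sum _ _ _ _ _ _ (fun i w => if i \in I then (B i w)%:R else 0)) => i.
  case: (i \in I) => //; exact: measurable_fun_setb.
split; first by apply: measurable_set_le.
apply: (le_trans (markov_ineq mu mf _ x0)); first by move=> w; apply: sumr_ge0.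
have -> : (\int[mu]_w (\sum_(i in I) (B i w)%:R)%:E = \sum_(i in I) (lam i)%:E)%E.
  under eq_integral do rewrite -sumEFin -big_filter.
  rewrite ge0_integral_sum//; last first.
    by move=> i; apply/measurable_EFinP; exact: measurable_fun_setb.
  rewrite big_filter; apply: eq_bigr => i _; rewrite (integral_setb mu (mBi i)) -bernoulli_true// -lB//.
rewrite sumEFin -EFinM lee_fin mulrC ler_pM2r ?invr_gt0//.
apply: (@le_trans _ _ (\sum_(i in I) t)); first by apply: ler_sum => i /lt.
by rewrite sumr_const mulr_natr.
Qed.

Lemma mobj_fin n d (lam : 'I_n -> R) t (c : R) : (mobj d lam t <= c%:E)%E ->
  (0 < Ncount lam t)%N /\ mobj d lam t = (t ^+ 2 + d%:R / (Ncount lam t)%:R)%:E.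
Proof.
rewrite /mobj; case: eqP => [_|/eqP N0 _]; first by rewrite addey// leye_eq.
by rewrite lt0n N0.
Qed.

Lemma TC_upper : exists c C2 : R, [/\ 0 < c, c < 1, 0 < C2 &
  forall (d n : nat) (Sigma : 'M[R]_d) (sigma : R) (lam : 'I_n -> R),
    (1 <= d)%N -> posdef Sigma -> 0 < sigma ->
    (forall i, 0 <= lam i <= 1) ->
    forall (tstar : R), 0 <= tstar <= 1 ->
    forall m : R, m <= c -> mobj d lam tstar = m%:E ->
    forall sel : sample n d -> 'rV[R]_d,
      (forall z, is_TC (wthr lam tstar) z (sel z)) ->
    forall (beta : 'rV[R]_d) (d0 : measure_display) (T : measurableType d0)
           (mu : probability T R) (Z : T -> sample n d),
      contam_model Sigma sigma lam beta mu Z ->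
      (outerP mu [set w | (C2 * sigma ^+ 2 * m <= sqnormS Sigma (sel (Z w) - beta))%R]
         <= (1 / 5 : R)%:E)%E].
Proof.
have [A0 [M0 [M02 A00 MA MC]]] := @upper_constants R.
have c60 : 0 < c6 :> R by rewrite /c6 divr_gt0// expR_gt0.
pose CA := yb A0 7 / 2 + (2 * B1 A0 7 + 68) + C3 A0 7 + 2 * C4 A0 7.
have CA0 : 0 < CA.
  by rewrite /CA /yb /B1 /C3 /C4; have := expR_ge0 (5 : R); lra.
pose cr := 4 * (1 + 2 * A0 + 7) / c6.
have cr0 : 0 < cr by rewrite /cr divr_gt0//; lra.
(* The first summand makes the loss [c6 * rho / 8] exceed [2 CA q + 40 (t + q)], with 41 in place of
   40 for strictness; the second is the condition of [event_far]; the last gives [q <= rho]. *)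
pose Cr := 8 * (2 * CA + 41) / c6 + cr + 1.
have Cr1 : 1 <= Cr.
  have : 0 < 8 * (2 * CA + 41) / c6 by rewrite divr_gt0//; lra.
  rewrite /Cr; lra.
have Cr0 : 0 < Cr by lra.
have Cr2 : 0 < Cr ^+ 2 by exact: exprn_gt0.
have Cr21 : 1 <= Cr ^+ 2 by rewrite exprn_ege1.
exists (1 / (2 * Cr ^+ 2)), (2 * Cr ^+ 2); split.
- by rewrite divr_gt0// mulr_gt0.
- by rewrite ltr_pdivrMr ?mul1r ?mulr_gt0//; lra.
- by rewrite mulr_gt0.
move=> d n Sigma sigma lam d1 pd s0 l01 t /andP[t0 t1] m mc mE sel selTC beta d0 T mu Z cm.
have [N0 mE'] : (0 < Ncount lam t)%N /\ mobj d lam t = (t ^+ 2 + d%:R / (Ncount lam t)%:R)%:E.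
  by apply: (@mobj_fin _ _ _ _ m); rewrite mE.
have {mE mE'} mE : m = t ^+ 2 + d%:R / (Ncount lam t)%:R by move: mE; rewrite mE' => -[].
pose I := clean_set lam t.
rewrite NcountE -/I in N0 mE.
have N0' : 0 < #|I|%:R :> R by rewrite ltr0n.
have d0' : 0 < d%:R :> R by rewrite ltr0n.
pose q := Num.sqrt (d%:R / #|I|%:R : R).
have q0 : 0 < q by rewrite sqrtr_gt0 divr_gt0.
have q2 : q ^+ 2 = d%:R / #|I|%:R by rewrite sqr_sqrtr// divr_ge0.
have q2N : q ^+ 2 * #|I|%:R = d%:R by rewrite q2 divfK// gt_eqF.
rewrite -q2 in mE.
have tq2 : (t + q) ^+ 2 <= 2 * m.
  rewrite mE; have := sqr_ge0 (t - q); lra.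
pose rho := Cr * (t + q).
have tq0 : 0 < t + q by lra.
have rho0 : 0 < rho by rewrite mulr_gt0.
have rho2 : rho ^+ 2 <= 2 * Cr ^+ 2 * m.
  have -> : 2 * Cr ^+ 2 * m = Cr ^+ 2 * (2 * m) by ring.
  by rewrite /rho exprMn; apply: ler_wpM2l => //; exact: ltW.
have rho1 : rho <= 1.
  rewrite -(@ler_pXn2r _ 2)// ?nnegrE ?(ltW rho0)// expr1n; apply: (le_trans rho2).
  by move: mc; rewrite ler_pdivlMr ?mulr_gt0// mulrC.
have Crq : Cr * q <= rho by rewrite /rho ler_pM2l//; lra.
have qrho : q <= rho by apply: le_trans Crq; rewrite ler_peMl// ltW.
have q1 : q < 1.
  have : q ^+ 2 < 1.
    have : m < 1.
      apply: (le_lt_trans mc); rewrite ltr_pdivrMr ?mul1r ?mulr_gt0//; lra.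
    have := sqr_ge0 t; lra.
  by rewrite expr_lt1// ltW.
have rhocr : 4 * (1 + 2 * A0 + 7) / c6 * q <= rho.
  apply: le_trans Crq; rewrite ler_pM2r// -/cr /Cr.
  have : 0 < 8 * (2 * CA + 41) / c6 by rewrite divr_gt0//; lra.
  lra.
have L0 : 0 <= 7 :> R by [].
have [Bad [[mBad PBad] good]] := @good_event R d n I A0 7 q rho M0 M02 A00 MA L0 d1 q0 q1 q2N rho0 rho1 qrho rhocr MC.
have [G [xi [B [Wt [Yt [S [SS [mG [mxi [mB _]]] [lG [lxi lB]] ind ZE]]]]]]] := cm.
have law := @blocks_law R n d d0 T mu G xi mG mxi lG lxi.
have ind' (AG : 'I_n -> 'I_d -> set R) (Axi : 'I_n -> set R) :
     (forall i j, measurable (AG i j)) -> (forall i, measurable (Axi i)) ->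
     fine (mu [set w | (forall i j, AG i j (G i j w)) /\ (forall i, Axi i (xi i w))]) =
     (\prod_(i < n) \prod_(j < d) fine (mu (G i j @^-1` AG i j))) *
     (\prod_(i < n) fine (mu (xi i @^-1` Axi i))).
  move=> mAG mAxi; have := ind AG Axi (fun=> setT) mAG mAxi (fun=> measurableT).
  have -> : \prod_(i < n) fine (mu (B i @^-1` setT)) = 1.
    by rewrite big1// => i _; rewrite preimage_setT probability_setT.
  rewrite mulr1 => <-; congr (fine (mu _)); apply/seteqP; split=> w /=.
    by move=> [h1 h2]; split.
  by move=> [h1 [h2 _]]; split.
have {}law := law ind' Bad mBad.
(* Using [t + q] instead of [t] keeps the Markov threshold positive when [t = 0]; the failure
   probability is still at most [1 / 20]. *)
have x0 : 0 < 20 * (t + q) * #|I|%:R by rewrite !mulr_gt0.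
have Ilam i : i \in I -> lam i <= t by rewrite inE.
have [mC PC] := contamination_count l01 mB lB Ilam x0.
have mX := measurable_blocks mG mxi.
pose E1 := [set w | Bad (blocks G xi w)].
have mE1 : measurable E1.
  by rewrite -[X in measurable X]setTI; exact: (mX measurableT Bad mBad).
have s1 : small mu (1 / 10) E1.
  split=> //; rewrite /E1 law; apply: (le_trans PBad); rewrite lee_fin; exact: expR7_small.
have s2 : small mu (1 / 20) [set w | 20 * (t + q) * #|I|%:R <= \sum_(i in I) (B i w)%:R].
  split=> //; apply: (le_trans PC); rewrite lee_fin ler_pdivrMr// mulrA ler_pM2r//; lra.
have [mE2 PE2] := small_setU s1 s2.
apply: (@le_trans _ _ (mu (E1 `|` [set w | 20 * (t + q) * #|I|%:R <= \sum_(i in I) (B i w)%:R]))); last first.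
  by apply: (le_trans PE2); rewrite lee_fin; clear; lra.
apply: ereal_inf_lbound => /=; exists (E1 `|` [set w | 20 * (t + q) * #|I|%:R <= \sum_(i in I) (B i w)%:R]) => //; split=> // w /= far.
have [|nB1] := pselect (Bad (blocks G xi w)); first by left.
have [|nB2] := leP (20 * (t + q) * #|I|%:R) (\sum_(i in I) (B i w)%:R); first by right.
exfalso; have := selTC (Z w) beta; apply/negP; rewrite -ltNge.
apply: (@depth_separation R n d Sigma S sigma t rho (CA * q) (20 * (t + q)) (c6 * rho / 8) lam beta _ (Z w) (blocks G xi w) (fun i => B i w)) => //.
- move=> i nBi; rewrite ZE (negbTE nBi) /blocks tnth_mktuple/=.
  have -> : tuprow [tuple G i j w | j < d] = \row_j G i j w.
    by apply/rowP => j; rewrite !mxE tnth_mktuple.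
  by [].
- by move=> u u1; have [h1 h2] := good _ nB1 u u1; split; rewrite // -mulrA.
- exact: ltW.
- have e1 : c6 * (8 * (2 * CA + 41) / c6) = 8 * (2 * CA + 41) by field; exact: lt0r_neq0.
  have e2 : 8 * (2 * CA + 41) * (t + q) < c6 * rho.
    rewrite /rho mulrA ltr_pM2r// -e1 ltr_pM2l// /Cr; lra.
  have : 2 * CA * q <= 2 * CA * (t + q) by rewrite ler_pM2l ?mulr_gt0//; lra.
  lra.
- rewrite exprMn; apply: le_trans far.
  have -> : 2 * Cr ^+ 2 * sigma ^+ 2 * m = 2 * Cr ^+ 2 * m * sigma ^+ 2 by ring.
  by apply: ler_wpM2r => //; exact: sqr_ge0.
Qed.

End upper.

(** * The adversary for the lower bound *)

Section cholesky.
Context {R : realType}.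

(** Induction on the dimension through the Schur complement [D - b^T b / a] of the top left
    entry. *)
Lemma cholesky d (Sigma : 'M[R]_d) : posdef Sigma -> exists S : 'M[R]_d, S *m S^T = Sigma.
Proof.
elim: d Sigma => [|d IH] Sigma; first by exists 0; apply/matrixP => -[].
move=> [sym pd].
pose A : 'M[R]_(1 + d) := Sigma.
pose a : R := ulsubmx A 0 0.
pose b : 'rV[R]_d := ursubmx A.
pose D : 'M[R]_d := drsubmx A.
have aM : ulsubmx A = a%:M by apply/matrixP => i j; rewrite !ord1 !mxE eqxx mulr1n /a !mxE.
have cE : dlsubmx A = b^T.
  by rewrite /b trmx_ursub (_ : A^T = A).
have DT : D^T = D by rewrite /D trmx_drsub (_ : A^T = A).
have AE : A = block_mx a%:M b b^T D by rewrite -(submxK A) aM cE.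
have quad (x0 : R) (y : 'rV[R]_d) : sqnormS Sigma (row_mx x0%:M y) =
    x0 ^+ 2 * a + 2 * x0 * (b *m y^T) 0 0 + (y *m D *m y^T) 0 0.
  transitivity ((row_mx x0%:M y *m A *m (row_mx x0%:M y)^T) 0 0) => //.
  rewrite AE mul_row_block tr_row_mx mul_row_col.
  rewrite tr_scalar_mx !mulmxDl -!scalar_mxM.
  have yb : (y *m b^T) 0 0 = (b *m y^T) 0 0.
    by rewrite -[b *m y^T]trmxK trmx_mul trmxK [RHS]mxE.
  have e1 : (y *m b^T *m x0%:M) 0 0 = x0 * (b *m y^T) 0 0 by rewrite mul_mx_scalar mxE yb.
  have e2 : (x0%:M *m b *m y^T) 0 0 = x0 * (b *m y^T) 0 0.
    by rewrite mul_scalar_mx -scalemxAl mxE.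
  have e3 : ((x0 * a * x0)%:M : 'M[R]_1) 0 0 = x0 * a * x0 by rewrite mxE eqxx mulr1n.
  have eD (X Y : 'M[R]_1) : (X + Y) 0 0 = X 0 0 + Y 0 0 by rewrite mxE.
  by rewrite !eD e1 e2 e3; ring.
have a0 : 0 < a.
  have := pd (row_mx 1%:M 0 : 'rV[R]_(1 + d)).
  rewrite quad trmx0 mulmx0 !mul0mx !mxE expr1n mul1r mulr0 !addr0; apply.
  apply/eqP => e; have := congr1 (lsubmx : 'rV[R]_(1 + d) -> 'rV[R]_1) e.
  rewrite row_mxKl linear0 => /matrixP/(_ 0 0); rewrite !mxE eqxx => /eqP.
  by rewrite oner_eq0.
pose al := Num.sqrt a.
have al0 : al != 0 by rewrite gt_eqF// sqrtr_gt0.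
have al2 : al * al = a by rewrite -expr2 sqr_sqrtr// ltW.
pose C := D - a^-1 *: (b^T *m b).
have [S' S'E] : exists S' : 'M[R]_d, S' *m S'^T = C.
  apply: IH; split.
    by rewrite /C linearB/= linearZ/= trmx_mul trmxK DT.
  (* This [x0] minimises the quadratic form over its first coordinate; the minimum is the form of
     the Schur complement at [y], hence positive. *)
  move=> y y0; pose x0 : R := - (a^-1 * (b *m y^T) 0 0).
  have := pd (row_mx x0%:M y : 'rV[R]_(1 + d)); rewrite quad.
  have -> : sqnormS C y = x0 ^+ 2 * a + 2 * x0 * (b *m y^T) 0 0 + (y *m D *m y^T) 0 0.
    rewrite /sqnormS /C mulmxBr mulmxBl mxE -scalemxAr -scalemxAl.
    have -> : y *m (b^T *m b) *m y^T = ((b *m y^T) 0 0 * (b *m y^T) 0 0)%:M.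
      rewrite mulmxA -mulmxA -[y *m b^T]trmxK trmx_mul trmxK [b *m y^T]mx11_scalar.
      by rewrite tr_scalar_mx -scalar_mxM !mxE eqxx.
    have e4 (u v : R) : (- (u *: (v%:M : 'M[R]_1))) 0 0 = - (u * v) by rewrite !mxE eqxx mulr1n.
    rewrite e4 /x0.
    by field; exact: lt0r_neq0.
  apply; apply/eqP => e; move/eqP: y0; apply.
  have := congr1 (rsubmx : 'rV[R]_(1 + d) -> 'rV[R]_d) e.
  by rewrite row_mxKr linear0.
pose B : 'M[R]_(1 + d) := block_mx al%:M 0 (al^-1 *: b^T) S'.
suff e : B *m B^T = A by exists B.
rewrite AE /B tr_block_mx mulmx_block.
rewrite !trmx0 !mulmx0 !mul0mx !addr0 tr_scalar_mx -scalar_mxM al2 S'E.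
rewrite linearZ/= trmxK mul_scalar_mx mul_mx_scalar !scalerA divff// !scale1r.
by rewrite -scalemxAl -scalemxAr scalerA -invfM al2 addrC /C subrK.
Qed.

End cholesky.

(** * Realising the contamination model through densities *)

Section density_probability.
Context {R : realType} {d0} {T : measurableType d0} (P : probability T R).

Definition densp (r : T -> R) (mr : measurable_fun [set: T] r) (r0 : forall x, 0 <= r x)
    (r1 : (\int[P]_x (r x)%:E = 1)%E) : set T -> \bar R :=
  fun A => (\int[P]_(x in A) (r x)%:E)%E.

Context (r : T -> R) (mr : measurable_fun [set: T] r) (r0 : forall x, 0 <= r x)
  (r1 : (\int[P]_x (r x)%:E = 1)%E).
Local Notation Q := (densp mr r0 r1).

Let densp0 : Q set0 = 0%E.
Proof. by rewrite /densp integral_set0. Qed.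

Let densp_ge0 A : (0 <= Q A)%E.
Proof. by apply: integral_ge0 => x _; rewrite lee_fin. Qed.

Let densp_sigma_additive : semi_sigma_additive Q.
Proof.
move=> /= F mF tF mUF; rewrite /densp; apply: cvg_toP.
  apply: ereal_nondecreasing_is_cvgn => m n mn.
  apply: lee_sum_nneg_natr => // k _ _.
  by apply: integral_ge0 => /= x Fkx; rewrite lee_fin.
rewrite ge0_integral_bigcup//=.
- by apply: measurable_funTS; exact/measurable_EFinP.
- by move=> x _; rewrite lee_fin.
Qed.

HB.instance Definition _ := isMeasure.Build _ _ _ Q densp0 densp_ge0 densp_sigma_additive.

Let densp_setT : Q [set: _] = 1%E. Proof. exact: r1. Qed.

HB.instance Definition _ := @Measure_isProbability.Build _ _ R Q densp_setT.

Lemma densp_setb (b : T -> bool) : measurable [set t | b t] ->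
  Q [set t | b t] = (\int[P]_x ((b x)%:R * r x)%:E)%E.
Proof.
move=> mb; rewrite /densp integral_mkcond; apply: eq_integral => x _.
rewrite patchE; have [h|h] := boolP (b x).
  by rewrite mem_set// mul1r.
by rewrite memNset/= ?mul0r//; apply/negP.
Qed.

End density_probability.

Section shift_block.
Context {R : realType} (d : nat).
Local Notation RR := (measurableTypeR R).
Local Notation U := (d.-tuple RR * RR)%type.

(* The density with respect to [gB d] of [(g, <th, g> + xi)], i.e. of a clean sample with
   regression vector [th]; [tau th] recovers the noise from it. *)
Definition pth (th : 'I_d -> R) (z : U) : R :=
  expR (dotT th z.1 * z.2 - dotT th z.1 ^+ 2 / 2).

Definition tau (th : 'I_d -> R) (z : U) : U := (z.1, z.2 - dotT th z.1).

Lemma measurable_pth th : measurable_fun [set: U] (pth th).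
Proof.
apply: measurableT_comp => //; apply: measurable_funB.
  by apply: measurable_funM; [exact: measurable_dotU|exact: measurable_sndU].
by apply: measurable_funM => //; apply: measurable_funX; exact: measurable_dotU.
Qed.

Lemma measurable_tau th : measurable_fun [set: U] (tau th).
Proof.
apply: measurable_fun_pair; first exact: measurable_fst.
apply: measurable_funB; [exact: measurable_sndU|exact: measurable_dotU].
Qed.

(** Conditionally on the covariates this is [integral_gN_shift]: under the density [pth th],
    subtracting the regression part recovers a standard block. *)
Lemma integral_pth th (F : U -> \bar R) : measurable_fun [set: U] F ->
  (forall z, 0 <= F z)%E ->
  (\int[gB d]_z (F (tau th z) * (pth th z)%:E) = \int[gB d]_z F z)%E.
Proof.
move=> mF F0.
have mFt : measurable_fun [set: U] (fun z => F (tau th z)).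
  exact: (measurableT_comp mF (measurable_tau th)).
have mp : measurable_fun [set: U] (fun z => (pth th z)%:E).
  by apply/measurable_EFinP; exact: measurable_pth.
rewrite integral_gB; last 2 first.
- exact: emeasurable_funM.
- by move=> z; rewrite mule_ge0// lee_fin expR_ge0.
rewrite integral_gB//; apply: eq_integral => g _.
have mG : measurable_fun [set: RR] (fun y : RR => F (tau th (g, y))).
  exact: (measurableT_comp mFt (measurable_pair1 g)).
have := @integral_gN_shift R (fun y => F (tau th (g, y))) (dotT th g) mG (fun y => F0 _).
rewrite /tau/= => h; rewrite /pth /= -h.
by apply: eq_integral => y _; rewrite addrK.
Qed.

Lemma integral_pth1 th : (\int[gB d]_z (pth th z)%:E = 1)%E.
Proof.
have := @integral_pth th (fun=> 1%E); under eq_integral do rewrite mul1e.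
by rewrite integral_probc; apply.
Qed.

(** For fixed [g] the second moment is [expR (<th, g>^2)], and integrating gives [(1 - 2 c)^(-1/2)]
    with [c = nrm2 th]. The exponential bound follows from [(1 + 4 c) (1 - 2 c) >= 1] for small
    [c]. *)
Lemma integral_pth_sq th : nrm2 th <= 1 / 8 ->
  (\int[gB d]_z (pth th z ^+ 2)%:E <= (expR (2 * nrm2 th))%:E)%E.
Proof.
move=> th8; have n0 := nrm2_ge0 th.
have mp2 : measurable_fun [set: U] (fun z => (pth th z ^+ 2)%:E).
  by apply/measurable_EFinP; apply: measurable_funX; exact: measurable_pth.
rewrite integral_gB//; last by move=> z; rewrite lee_fin sqr_ge0.
have -> : (\int[gV d]_g \int[gN]_y (pth th (g, y) ^+ 2)%:E =
           \int[gV d]_g (expR (dotT th g ^+ 2))%:E)%E.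
  apply: eq_integral => g _.
  have m1 : measurable_fun [set: RR] (fun y : RR => (expR (dotT th g ^+ 2))%:E) by [].
  have := @integral_gN_shift R (fun=> (expR (dotT th g ^+ 2))%:E) (2 * dotT th g) m1.
  rewrite integral_probc => ->; last by move=> _; rewrite lee_fin expR_ge0.
  apply: eq_integral => y _; rewrite -EFinM -expRD /pth -expRM_natr; congr ((expR _)%:E).
  by rewrite /=; field.
have -> : (\int[gV d]_g (expR (dotT th g ^+ 2))%:E = \int[gN]_x (expR ((Num.sqrt (nrm2 th) * x) ^+ 2))%:E)%E.
  apply: (@integral_gV_dot R d th (fun x => (expR (x ^+ 2))%:E)).
    by apply/measurable_EFinP; apply: measurableT_comp => //; exact: measurable_funX.
  by move=> x; rewrite lee_fin expR_ge0.
have -> : (\int[gN]_x (expR ((Num.sqrt (nrm2 th) * x) ^+ 2))%:E = \int[gN]_x (expR (nrm2 th * x ^+ 2))%:E)%E.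
  by apply: eq_integral => x _; rewrite exprMn sqr_sqrtr.
rewrite integral_gN_expsq; last by lra.
rewrite lee_fin; set c := nrm2 th in n0 th8 *.
have e : expR (- (2 * c)) <= Num.sqrt (1 - 2 * c).
  have -> : expR (- (2 * c)) = Num.sqrt (expR (- (2 * c)) ^+ 2).
    by rewrite sqrtr_sqr ger0_norm ?expR_ge0.
  have c2 : 0 <= 1 - 2 * c by lra.
  have c4 : 0 < 1 + 4 * c by lra.
  rewrite (ler_sqrt _ c2) -expRM_natr mulNr expRN.
  have -> : 2 * c * 2 = 4 * c by ring.
  have h : (expR (4 * c))^-1 <= (1 + 4 * c)^-1.
    by rewrite lef_pV2 ?posrE ?expR_gt0//; exact: expR_ge1Dx.
  apply: (le_trans h); rewrite -[X in X <= _]mul1r ler_pdivrMr//.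
  by have : 0 <= c * (1 - 4 * c) by [apply: mulr_ge0 => //; lra]; lra.
rewrite -[expR (2 * c)]invrK -expRN lef_pV2 ?posrE ?expR_gt0//.
by rewrite (lt_le_trans _ e)// expR_gt0.
Qed.

End shift_block.

Section block_model.
Context {R : realType} (d : nat).
Local Notation RR := (measurableTypeR R).
Local Notation U := (d.-tuple RR * RR)%type.

Definition uni : probability RR R := uniform_prob (@ltr01 R).
(* A point [((z, u), x)]: the observed block, a uniform variable deciding whether it is
   contaminated, and a fresh clean block used when it is. *)
Definition Ub := ((U * RR) * U)%type.
Definition gBu : probability (U * RR)%type R := (gB d \x uni)%E.
Definition gU : probability Ub R := (gBu \x gB d)%E.

Lemma uni_lt (c : R) : 0 <= c <= 1 -> uni [set u | (u < c)%R] = c%:E.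
Proof.
move=> /andP[c0 c1]; apply: (etrans (@integral_uniform_pdf R 0 1 _)).
have -> : [set u | (u < c)%R] `&` `[0, 1]%classic = `[0, c[%classic :> set RR.
  apply/seteqP; split=> u /=; rewrite !in_itv/=.
    by move=> [h1 /andP[-> _]].
  by move=> /andP[h1 h2]; split=> //; rewrite h1/=; apply: le_trans c1; exact: ltW.
rewrite (eq_integral (fun=> 1%E)); last first.
  move=> u; rewrite inE/= in_itv/= => /andP[h1 h2]; rewrite /uniform_pdf h1/= subr0 invr1.
  by rewrite (le_trans (ltW h2) c1).
rewrite integral_cst//= mul1e lebesgue_measure_itv/= lte_fin.
case: ifPn => [_|]; first by rewrite oppr0 addr0.
by rewrite -leNgt => h; congr EFin; apply/eqP; rewrite eq_le c0 h.
Qed.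

Lemma integral_gU (F : U -> RR -> U -> R) : measurable_fun [set: Ub] (fun w : Ub => F w.1.1 w.1.2 w.2) ->
  (forall z u x, 0 <= F z u x) ->
  (\int[gU]_w (F w.1.1 w.1.2 w.2)%:E = \int[gB d]_z \int[uni]_u \int[gB d]_x (F z u x)%:E)%E.
Proof.
move=> mF F0.
have mF' : measurable_fun [set: Ub] (fun w : Ub => (F w.1.1 w.1.2 w.2)%:E) by exact/measurable_EFinP.
have Fw0 w : (0 <= (F w.1.1 w.1.2 w.2)%:E)%E by rewrite lee_fin.
apply: (etrans (fubini_tonelli1 (m1 := gBu) (m2 := gB d) _ mF' Fw0)).
apply: (fubini_tonelli1 (m1 := gB d) (m2 := uni) (fun w => \int[gB d]_x (F w.1 w.2 x)%:E)%E).
  exact: (measurable_fun_fubini_tonelli_F (m2 := gB d) _ mF').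
by move=> w; apply: integral_ge0 => x _; rewrite lee_fin.
Qed.

End block_model.

Lemma integral_indicT {R : realType} {d0} {T : measurableType d0}
    (mu : {measure set T -> \bar R}) (A : set T) :
  measurable A -> (\int[mu]_x (\1_A x)%:E = mu A)%E.
Proof. by move=> mA; rewrite integral_indic// setIT. Qed.

Section block_law.
Context {R : realType} (d : nat) (th : 'I_d -> R) (l : R) (r : d.-tuple (measurableTypeR R) * measurableTypeR R -> R).
Local Notation RR := (measurableTypeR R).
Local Notation U := (d.-tuple RR * RR)%type.
Local Notation Ub := (@Ub R d).
Context (l01 : 0 <= l <= 1) (mr : measurable_fun [set: U] r).
Context (rdom : forall z, (1 - l) * pth th z <= r z) (r1 : (\int[gB d]_z (r z)%:E = 1)%E).

(* Observing [z] with density [r], declare it clean with conditional probability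
   [(1 - l) * pth th z / r z]: then the bit is Bernoulli([l]), independent of the clean block,
   and an uncontaminated [z] is the clean block itself. *)
Definition badbit (w : Ub) : bool := (1 - l) * pth th w.1.1 <= w.1.2 * r w.1.1.
Definition cleanpt (w : Ub) : U := if badbit w then w.2 else tau th w.1.1.

Let k z := (1 - l) * pth th z.

Let mk : measurable_fun [set: U] k.
Proof. by apply: measurable_funM => //; exact: measurable_pth. Qed.

Let k0 z : 0 <= k z.
Proof. by apply: mulr_ge0; [case/andP: l01; lra|exact: expR_ge0]. Qed.

Lemma density_ge0 z : 0 <= r z.
Proof. exact: le_trans (k0 z) (rdom z). Qed.

Let mz : measurable_fun [set: Ub] (fun w : Ub => w.1.1).
Proof. exact: (measurableT_comp measurable_fst measurable_fst). Qed.

Let mu_ : measurable_fun [set: Ub] (fun w : Ub => w.1.2 : R).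
Proof. exact: (measurableT_comp measurable_snd measurable_fst). Qed.

Lemma measurable_badbit : measurable [set w | badbit w].
Proof.
apply: measurable_set_le; first exact: (measurableT_comp mk mz).
by apply: measurable_funM => //; exact: (measurableT_comp mr mz).
Qed.

Lemma measurable_fun_badbit : measurable_fun [set: Ub] badbit.
Proof.
apply: (measurable_fun_bool true); rewrite setTI.
by rewrite (_ : _ @^-1` _ = [set w | badbit w]) //; exact: measurable_badbit.
Qed.

Lemma measurable_cleanpt : measurable_fun [set: Ub] cleanpt.
Proof.
apply: measurable_fun_if => //; first exact: measurable_fun_badbit.
  by apply: measurable_funTS; exact: measurable_snd.
by apply: measurable_funTS; exact: (measurableT_comp (measurable_tau th) mz).
Qed.

Definition ind (A : set U) (c : bool) (w : Ub) : R := \1_A (cleanpt w) * (badbit w == c)%:R.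

Lemma measurable_ind A c : measurable A -> measurable_fun [set: Ub] (ind A c).
Proof.
move=> mA; apply: measurable_funM.
  exact: (measurableT_comp (measurable_indic mA) measurable_cleanpt).
apply: measurable_fun_setb; case: c.
  rewrite (_ : [set t | _] = [set w | badbit w]); first exact: measurable_badbit.
  by apply/seteqP; split=> w /=; rewrite eqb_id.
rewrite (_ : [set t | _] = ~` [set w | badbit w]); first by apply: measurableC; exact: measurable_badbit.
by apply/seteqP; split=> w /=; rewrite eqbF_neg => /negP.
Qed.

Let u_lt z : (\int[uni]_u ((u * r z < k z)%R%:R * r z)%:E = (k z)%:E)%E.
Proof.
have mlt : measurable [set u : RR | (u * r z < k z)%R].
  by apply: measurable_set_lt => //; apply: measurable_funM.
under eq_integral do rewrite EFinM.
rewrite ge0_integralZr//; last first.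
- by rewrite lee_fin density_ge0.
- by apply/measurable_EFinP; exact: measurable_fun_setb.
rewrite integral_setb//.
have := density_ge0 z; rewrite le_eqVlt => /predU1P[e|rz].
  have kz : k z = 0.
    by apply/eqP; rewrite eq_le k0 andbT e; exact: rdom.
  by rewrite -e mule0 kz.
have -> : [set u : RR | (u * r z < k z)%R] = [set u : RR | (u < k z / r z)%R].
  by apply/seteqP; split=> u /=; rewrite ltr_pdivlMr.
transitivity ((k z / r z)%:E * (r z)%:E)%E; last by rewrite -EFinM divfK// gt_eqF.
congr (_ * _)%E; apply: uni_lt; rewrite divr_ge0//=; last exact: ltW.
by rewrite ler_pdivrMr// mul1r; exact: rdom.
Qed.

Let u_ge z : (\int[uni]_u ((k z <= u * r z)%R%:R * r z)%:E = (r z - k z)%:E)%E.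
Proof.
have mlt : measurable [set u : RR | (u * r z < k z)%R].
  by apply: measurable_set_lt => //; apply: measurable_funM.
have mge : measurable [set u : RR | (k z <= u * r z)%R].
  by apply: measurable_set_le => //; apply: measurable_funM.
have m1 (B : RR -> bool) : measurable [set u | B u] ->
    measurable_fun [set: RR] (fun u => ((B u)%:R * r z)%:E).
  by move=> mB; apply/measurable_EFinP; apply: measurable_funM => //; exact: measurable_fun_setb.
have p1 (B : RR -> bool) u : (0 <= ((B u)%:R * r z)%:E)%E.
  by rewrite lee_fin mulr_ge0// density_ge0.
have h : (\int[uni]_u ((k z <= u * r z)%R%:R * r z)%:E + (k z)%:E = (r z)%:E)%E.
  rewrite -(u_lt z) -ge0_integralD//; last 2 first.
  - exact: m1.
  - exact: m1.
  rewrite -[RHS](integral_probc uni); apply: eq_integral => u _.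
  by rewrite -EFinD -mulrDl ltNge; case: (k z <= u * r z); rewrite /= ?addr0 ?add0r mul1r.
by rewrite EFinB -h addeK.
Qed.

Let ind_ge0 A c w : 0 <= ind A c w.
Proof. by rewrite mulr_ge0// indicE. Qed.

(** The bad part has mass [1 - (1 - l) = l] and carries an independent fresh block. The good part
    has density [(1 - l) * pth th], which [tau th] maps to [1 - l] times the law of a standard
    block. *)
Lemma block_law A c : measurable A ->
  (\int[gU d]_w (ind A c w * r w.1.1)%:E =
   gB d A * (if c then l else 1 - l)%:E)%E.
Proof.
move=> mA.
have gBA0 : (0 <= gB d A)%E by exact: measure_ge0.
have l1 : 0 <= 1 - l by case/andP: l01; lra.
rewrite (integral_gU (F := fun z u x => ind A c (z, u, x) * r z)); last 2 first.
- rewrite (_ : (fun w => _) = (fun w : Ub => ind A c w * r w.1.1)); last first.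
    by apply/funext => -[[]].
  by apply: measurable_funM; [exact: measurable_ind|exact: (measurableT_comp mr mz)].
- by move=> z u x; rewrite mulr_ge0 ?density_ge0.
case: c.
- have e z u : (\int[gB d]_x (ind A true (z, u, x) * r z)%:E =
                gB d A * ((k z <= u * r z)%R%:R * r z)%:E)%E.
    transitivity (\int[gB d]_x ((\1_A x)%:E * ((k z <= u * r z)%R%:R * r z)%:E))%E.
      apply: eq_integral => x _; rewrite -EFinM; congr EFin; rewrite /ind /cleanpt /badbit/= -/(k z).
      by case: (k z <= u * r z); rewrite /= ?mulr1 ?mul1r ?mulr0 ?mul0r ?mulr0.
    rewrite ge0_integralZr//.
    + by congr (_ * _)%E; exact: integral_indicT.
    + by apply/measurable_EFinP; exact: measurable_indic.
    + by rewrite lee_fin mulr_ge0// density_ge0.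
  under eq_integral => z _ do under eq_integral => u _ do rewrite e.
  have e2 z : (\int[uni]_u (gB d A * ((k z <= u * r z)%R%:R * r z)%:E) = gB d A * (r z - k z)%:E)%E.
    rewrite ge0_integralZl//; first by rewrite u_ge.
    + apply/measurable_EFinP; apply: measurable_funM => //; apply: measurable_fun_setb.
      by apply: measurable_set_le => //; apply: measurable_funM.
    + by move=> u _; rewrite lee_fin mulr_ge0// density_ge0.
  under eq_integral do rewrite e2.
  have rk z : 0 <= r z - k z by rewrite subr_ge0; exact: rdom.
  rewrite ge0_integralZl//; last 2 first.
  + by apply/measurable_EFinP; apply: measurable_funB.
  + by move=> z _; rewrite lee_fin.
  congr (_ * _)%E.
  have : (\int[gB d]_z (r z - k z)%:E + (1 - l)%:E = 1)%E.
    rewrite -r1.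
    have <- : (\int[gB d]_z (k z)%:E = (1 - l)%:E)%E.
      under eq_integral do rewrite EFinM.
      rewrite ge0_integralZl//; first by rewrite integral_pth1 mule1.
      - by apply/measurable_EFinP; exact: measurable_pth.
      - by move=> z _; rewrite lee_fin expR_ge0.
    rewrite -ge0_integralD//; last 4 first.
    - by move=> z _; rewrite lee_fin.
    - by apply/measurable_EFinP; apply: measurable_funB.
    - by move=> z _; rewrite lee_fin.
    - exact/measurable_EFinP.
    by apply: eq_integral => z _; rewrite -EFinD subrK.
  move=> h; have := congr1 (fun x => x - (1 - l)%:E)%E h.
  by rewrite addeK// => ->; rewrite -EFinB; congr EFin; ring.
have e z u : (\int[gB d]_x (ind A false (z, u, x) * r z)%:E =
                (\1_A (tau th z))%:E * ((u * r z < k z)%R%:R * r z)%:E)%E.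
  rewrite -[RHS](integral_probc (gB d)).
  apply: eq_integral => x _; rewrite -EFinM; congr EFin; rewrite /ind /cleanpt /badbit/= -/(k z) ltNge.
  by case: (k z <= u * r z); rewrite /= ?mulr1 ?mul1r ?mulr0 ?mul0r ?mulr0.
under eq_integral => z _ do under eq_integral => u _ do rewrite e.
have e2 z : (\int[uni]_u ((\1_A (tau th z))%:E * ((u * r z < k z)%R%:R * r z)%:E) =
    (\1_A (tau th z))%:E * (pth th z)%:E * (1 - l)%:E)%E.
  rewrite ge0_integralZl//; first by rewrite u_lt /k EFinM (muleC (1 - l)%:E) muleA.
  + apply/measurable_EFinP; apply: measurable_funM => //; apply: measurable_fun_setb.
    by apply: measurable_set_lt => //; apply: measurable_funM.
  + by move=> u _; rewrite lee_fin mulr_ge0// density_ge0.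
under eq_integral do rewrite e2.
have mi : measurable_fun [set: U] (fun z => (\1_A z : R)%:E).
  by apply/measurable_EFinP; exact: measurable_indic.
rewrite ge0_integralZr//.
- rewrite (@integral_pth R d th (fun z => (\1_A z)%:E))//.
  by congr (_ * _)%E; exact: integral_indicT.
- apply: emeasurable_funM; first exact: (measurableT_comp mi (measurable_tau th)).
  by apply/measurable_EFinP; exact: measurable_pth.
- by move=> z _; rewrite mule_ge0// lee_fin expR_ge0.
Qed.

End block_law.

Section flat_density.
Context {R : realType} (d : nat).
Local Notation RR := (measurableTypeR R).
Local Notation U := (d.-tuple RR * RR)%type.
Context (J : {set 'I_d}) (l s : R).

(** It dominates [expR (|g_j| |y| / 2)] by the arithmetic-geometric inequality, and the quarters
    keep it integrable: each square contributes a factor [sqrt 2]. *)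
Definition peak (j : 'I_d) (z : U) : R := expR (tnth z.1 j ^+ 2 / 4 + z.2 ^+ 2 / 4).

(* Each [peak] has mass [2] under [gB d], whence the constant term. *)
Definition flat (z : U) : R :=
  1 - 2 * ((1 - l) * s) + (1 - l) * s / #|J|%:R * \sum_(j in J) peak j z.

Context (J0 : (0 < #|J|)%N) (l0 : 0 <= l) (l1 : l <= 1) (s0 : 0 <= s) (s12 : s <= 1 / 2).

Let mpeak j : measurable_fun [set: U] (peak j).
Proof.
apply: measurableT_comp => //; apply: measurable_funD; apply: measurable_funM => //.
  apply: measurable_funX; exact: (measurableT_comp (measurable_tnth j) measurable_fst).
by apply: measurable_funX; exact: measurable_sndU.
Qed.

Lemma measurable_flat : measurable_fun [set: U] flat.
Proof.
apply: measurable_funD => //; apply: measurable_funM => //.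
under eq_fun do rewrite big_mkcond.
by apply: (@measurable_sum _ _ _ _ _ _ (fun j z => if j \in J then peak j z else 0)) => j; case: (j \in J).
Qed.

Let integral_expsq4 : (\int[gN]_x (expR (x ^+ 2 / 4))%:E = (Num.sqrt (2 : R))%:E)%E.
Proof.
under eq_integral do rewrite mulrC.
rewrite integral_gN_expsq; last by lra.
congr EFin; rewrite (_ : 1 - 2 * 4^-1 = 2^-1); last by field.
by rewrite sqrtrV// invrK.
Qed.

Lemma integral_peak j : (\int[gB d]_z (peak j z)%:E = 2%:E)%E.
Proof.
have mN : measurable_fun [set: RR] (fun x : RR => (expR (x ^+ 2 / 4) : R)%:E).
  apply/measurable_EFinP; apply: measurableT_comp => //.
  by apply: measurable_funM => //; exact: measurable_funX.
rewrite (integral_gB (f := fun z => (peak j z)%:E)); last 2 first.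
- exact/measurable_EFinP.
- by move=> z; rewrite lee_fin expR_ge0.
have e g : (\int[gN]_y (peak j (g, y))%:E = (expR (tnth g j ^+ 2 / 4))%:E * (Num.sqrt 2)%:E)%E.
  rewrite /peak; under eq_integral do rewrite /= expRD EFinM.
  rewrite ge0_integralZl// ?integral_expsq4// => [x _|]; rewrite lee_fin; exact: expR_ge0.
under eq_integral do rewrite e.
have mT : measurable_fun [set: d.-tuple RR] (fun g => (expR (tnth g j ^+ 2 / 4) : R)%:E).
  exact: (measurableT_comp mN (measurable_tnth j)).
rewrite ge0_integralZr//.
pose v (i : 'I_d) : R := (i == j)%:R.
have vg (g : d.-tuple RR) : dotT v g = tnth g j.
  rewrite /dotT (bigD1 j)//= /v eqxx mul1r big1 ?addr0// => i /negbTE ->.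
  by rewrite mul0r.
have v1 : nrm2 v = 1.
  rewrite /nrm2 (bigD1 j)//= /v eqxx expr1n big1 ?addr0// => i /negbTE ->.
  by rewrite expr0n.
have -> : (\int[gV d]_g (expR (tnth g j ^+ 2 / 4))%:E = (Num.sqrt (2 : R))%:E)%E.
  under eq_integral do rewrite -vg.
  rewrite (@integral_gV_dot R d v (fun x => (expR (x ^+ 2 / 4))%:E) mN).
    by under eq_integral do rewrite v1 sqrtr1 mul1r.
  by move=> x; rewrite lee_fin expR_ge0.
by rewrite -EFinM -expr2 sqr_sqrtr.
Qed.

Lemma integral_flat : (\int[gB d]_z (flat z)%:E = 1)%E.
Proof.
have k0 : 0 < #|J|%:R :> R by rewrite ltr0n.
have [l0' l1' s0' s12'] : [/\ 0 <= l, l <= 1, 0 <= s & s <= 1 / 2] by [].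
have a0 : 0 <= (1 - l) * s by rewrite mulr_ge0//; lra.
have b0 : 0 <= 1 - 2 * ((1 - l) * s).
  have : (1 - l) * s <= 1 * (1 / 2) by apply: ler_pM => //; lra.
  by lra.
have mS : measurable_fun [set: U] (fun z => (\sum_(j in J) peak j z)%:E).
  apply/measurable_EFinP; under eq_fun do rewrite big_mkcond.
  by apply: (@measurable_sum _ _ _ _ _ _ (fun j z => if j \in J then peak j z else 0)) => j; case: (j \in J).
have S0 z : (0 <= (\sum_(j in J) peak j z)%:E)%E.
  by rewrite lee_fin sumr_ge0// => j _; exact: expR_ge0.
have c0 : 0 <= (1 - l) * s / #|J|%:R by rewrite divr_ge0// ltW.
under eq_integral do rewrite EFinD EFinM.
rewrite ge0_integralD//; last 2 first.
- by move=> z _; rewrite mule_ge0.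
- exact: emeasurable_funM.
rewrite ge0_integralZl// integral_probc.
have -> : (\int[gB d]_z (\sum_(j in J) peak j z)%:E = (2 * #|J|%:R)%:E)%E.
  under eq_integral do rewrite -big_enum/= -sumEFin.
  rewrite ge0_integral_sum//; last 2 first.
  - by move=> j; exact/measurable_EFinP.
  - by move=> j z _; rewrite lee_fin expR_ge0.
  under eq_bigr do rewrite integral_peak.
  by rewrite big_enum/= sumEFin sumr_const mulr_natr.
by rewrite -EFinM -EFinD; congr EFin; field; rewrite gt_eqF.
Qed.

(** Jensen's inequality with mass [1 - s] at 0 and [s / #|J|] at each [a j], proved with the tangent
    to [expR] at the barycentre [x]. *)
Lemma expR_jensen (a : 'I_d -> R) : s <= 1 ->
  expR (s / #|J|%:R * \sum_(j in J) a j) <=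
  1 - s + s / #|J|%:R * \sum_(j in J) expR (a j).
Proof.
move=> s1; set x := _ * _.
have k0 : 0 < #|J|%:R :> R by rewrite ltr0n.
have tang y : expR x * (1 + (y - x)) <= expR y.
  rewrite -[in leRHS](subrKC x y) expRD ler_wpM2l ?expR_ge0//; exact: expR_ge1Dx.
have h1 : (1 - s) * (expR x * (1 - x)) <= 1 - s.
  rewrite -[leRHS]mulr1 ler_wpM2l ?subr_ge0//.
  by have := tang 0; rewrite add0r expR0.
have h2 : \sum_(j in J) (expR x * (1 - x) + expR x * a j) <= \sum_(j in J) expR (a j).
  apply: ler_sum => j _; rewrite -mulrDr; apply: le_trans (tang (a j)).
  by rewrite le_eqVlt; apply/orP; left; apply/eqP; congr (_ * _); ring.
rewrite big_split/= sumr_const -mulr_sumr in h2.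
apply: le_trans (lerD h1 (ler_wpM2l _ h2)); last by rewrite divr_ge0// ltW.
rewrite -mulr_natr le_eqVlt; apply/orP; left; apply/eqP.
set S := \sum_(j in J) a j; have xE : x = s / #|J|%:R * S by [].
transitivity ((1 - s) * (expR x * (1 - x)) + (s * (expR x * (1 - x)) + expR x * (s / #|J|%:R * S))).
  by rewrite -xE; ring.
by field; rewrite gt_eqF.
Qed.

(** After dropping the negative square, the exponent of [pth] is at most [e |y|] times the sum of
    the [|g_j|] over [J], which is [s / #|J|] times the sum of the [|g_j| |y| / 2]. Jensen then
    separates the coordinates. The weight [s = 2 #|J| e] is twice the l^1 norm of a sign vector. *)
Lemma flat_dom (e : R) (th : 'I_d -> R) : s <= l -> s = 2 * #|J|%:R * e ->
  (forall j, j \notin J -> th j = 0) -> (forall j, `|th j| <= e) ->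
  forall z, (1 - l) * pth th z <= flat z.
Proof.
move=> sl se th0 the [w y].
have [l0' l1' s0' s12'] : [/\ 0 <= l, l <= 1, 0 <= s & s <= 1 / 2] by [].
have k0 : 0 < #|J|%:R :> R by rewrite ltr0n.
have h1 : pth th (w, y) <= 1 - s + s / #|J|%:R * \sum_(j in J) peak j (w, y).
  apply: (@le_trans _ _ (1 - s + s / #|J|%:R * \sum_(j in J) expR (`|tnth w j| * `|y| / 2))); last first.
    rewrite lerD2l; apply: ler_wpM2l; first by rewrite divr_ge0// ltW.
    apply: ler_sum => j _; rewrite ler_expR/= -[X in _ <= X / _ + _]real_normK ?num_real//.
    rewrite -[X in _ <= _ + X / _]real_normK ?num_real//.
    by have := sqr_ge0 (`|tnth w j| - `|y|); rewrite sqrrB; lra.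
  apply: le_trans (expR_jensen _ _); last by lra.
  rewrite ler_expR/=; apply: (@le_trans _ _ (dotT th w * y)).
    by rewrite gerBl divr_ge0// sqr_ge0.
  apply: le_trans (ler_norm _) _; rewrite normrM /dotT.
  have -> : s / #|J|%:R * (\sum_(j in J) `|tnth w j| * `|y| / 2) = (\sum_(j in J) e * `|tnth w j|) * `|y|.
    rewrite !mulr_sumr mulr_suml; apply: eq_bigr => j _; rewrite se.
    by field; rewrite gt_eqF.
  rewrite ler_wpM2r//; apply: le_trans (ler_norm_sum _ _ _) _.
  rewrite [leRHS]big_mkcond; apply: ler_sum => j _; rewrite normrM; case: ifPn => jJ.
    by rewrite ler_wpM2r.
  by rewrite th0// normr0 mul0r.
have l2 : 0 <= 1 - l by lra.
apply: le_trans (ler_wpM2l l2 h1) _.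
(* Only the constant terms differ, by [l - s (1 - l)]; the contamination rate pays for it since
   [s <= l]. *)
rewrite /flat mulrDr !mulrA -subr_ge0.
rewrite [X in _ <= X](_ : _ = l - s * (1 - l)); last by ring.
nra.
Qed.

End flat_density.

(** * The testing argument *)

Section packing.
Context {R : realType} (d : nat) (J : {set 'I_d}).

Definition ham (b b' : {ffun 'I_d -> bool}) : nat := #|finset (fun j => (j \in J) && (b j != b' j))|.

Lemma packing_count (F : {ffun 'I_d -> bool} -> bool) :
  (forall b b', F b -> F b' -> (200 * ham b b' <= #|J|)%N) ->
  \sum_b (F b)%:R <= (53 / 100) ^+ #|J| * 2 ^+ d :> R.
Proof.
move=> sep; have [/existsP[b0 Fb0]|none] := boolP [exists b, F b]; last first.
  rewrite big1 ?mulr_ge0 ?exprn_ge0//.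
  by move=> b _; move: none; rewrite negb_exists => /forallP/(_ b)/negbTE ->.
(* Chernoff bound on the Hamming ball, with Laplace parameter [4]. *)
pose w (j : 'I_d) (c : bool) : R := if (j \in J) && (c != b0 j) then expR (- 4) else 1.
have wE (b : {ffun 'I_d -> bool}) : \prod_j w j (b j) = expR (- (4 * (ham b b0)%:R)).
  transitivity (\prod_(j in finset (fun j => (j \in J) && (b j != b0 j))) expR (- 4 : R)).
    by rewrite [RHS]big_mkcond/=; apply: eq_bigr => j _; rewrite inE.
  by rewrite prodr_const -expRM_natr mulNr.
(* All members lie within [#|J| / 200] of the fixed member [b0], and [4 / 200 = 1 / 50]. Each
   coordinate of [J] will then cost [expR (1 / 50) (1 + expR (- 4)) / 2 <= 53 / 100]. *)
have Fw b : (F b)%:R <= expR (1 / 50) ^+ #|J| * \prod_j w j (b j).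
  rewrite wE; case Fb: (F b); last by rewrite mulr_ge0 ?exprn_ge0 ?expR_ge0.
  rewrite -expRM_natr -expRD -[X in X <= _]expR0 ler_expR.
  by have := sep b b0 Fb Fb0; rewrite -(ler_nat R) natrM; lra.
apply: (le_trans (ler_sum _ (fun b _ => Fw b))).
rewrite -mulr_sumr -(bigA_distr_bigA w).
have e4 : expR (- 4) <= 1 / 35 :> R.
  rewrite expRN div1r lef_pV2 ?posrE ?expR_gt0//.
  rewrite (_ : expR 4 = expR (1 / 4 : R) ^+ 16); last by rewrite -expRM_natr; congr expR; field.
  have h : 5 / 4 <= expR (1 / 4) :> R by have := @expR_ge1Dx R (1 / 4); lra.
  apply: (@le_trans _ _ ((5 / 4) ^+ 16)); first by rewrite !exprS expr0; lra.
  by apply: lerXn2r => //; rewrite nnegrE ?expR_ge0//; lra.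
have e50 : expR (1 / 50) <= 50 / 49 :> R.
  have l1 : 1 / 50 < 1 :> R by lra.
  by apply: (le_trans (expR_le_inv l1)); rewrite (_ : 1 - 1 / 50 = 49 / 50) ?invf_div//; lra.
have sE j : \sum_c w j c = 2 * (if j \in J then (1 + expR (- 4)) / 2 else 1).
  rewrite big_bool /w; case: (j \in J) => /=; last by ring.
  by case: (b0 j) => /=; field.
under eq_bigr do rewrite sE.
rewrite big_split/= prodr_const card_ord mulrCA mulrC ler_wpM2r ?exprn_ge0//.
rewrite -big_mkcond/= prodr_const -exprMn.
have p1 := expR_ge0 (- 4 : R); have p2 := expR_ge0 (1 / 50 : R).
apply: lerXn2r; rewrite ?nnegrE; [by rewrite mulr_ge0//; lra|by lra|].
apply: (@le_trans _ _ (50 / 49 * ((1 + 1 / 35) / 2))); last by lra.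
by apply: ler_pM => //; lra.
Qed.

End packing.

Section testing.
Context {R : realType} {d0} {T : measurableType d0} (P : probability T R) (I : finType).

(* The elementary bound [f L <= (a L^2 + f^2 / a) / 2] replaces a change of measure. *)
Lemma testing_bound (L : I -> T -> R) (rho : T -> R) (F : I -> T -> bool) (a e c : R) :
  0 < a -> 0 <= c ->
  (forall i, measurable_fun [set: T] (L i)) -> (forall i x, 0 <= L i x) ->
  measurable_fun [set: T] rho ->
  (forall x, 0 <= rho x) -> (\int[P]_x (rho x)%:E = 1)%E ->
  (forall i, \int[P]_x (L i x ^+ 2 * rho x)%:E <= e%:E)%E ->
  (forall i, measurable [set x | F i x]) ->
  (forall x, \sum_i (F i x)%:R <= c) ->
  (\sum_i \int[P]_x ((F i x)%:R * (L i x * rho x))%:E <= (#|I|%:R * (a / 2 * e) + c / (2 * a))%:E)%E.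
Proof.
move=> a0 c0 mL L0 mrho rho0 rho1 Le mF Fc.
have mf i : measurable_fun [set: T] (fun x => (F i x)%:R : R) by exact: measurable_fun_setb.
have m1 i : measurable_fun [set: T] (fun x => (L i x ^+ 2 * rho x)%:E).
  by apply/measurable_EFinP; apply: measurable_funM => //; exact: measurable_funX.
have m2 i : measurable_fun [set: T] (fun x => ((F i x)%:R * rho x)%:E).
  by apply/measurable_EFinP; exact: measurable_funM.
have p1 i x : (0 <= (L i x ^+ 2 * rho x)%:E)%E by rewrite lee_fin mulr_ge0// sqr_ge0.
have p2 i x : (0 <= ((F i x)%:R * rho x)%:E)%E by rewrite lee_fin mulr_ge0.
have a20 : (0 <= (a / 2)%:E)%E by rewrite lee_fin; lra.
have a21 : (0 <= ((2 * a)^-1)%:E)%E by rewrite lee_fin invr_ge0; lra.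
have i1 i : (\int[P]_x ((F i x)%:R * (L i x * rho x))%:E <=
   (a / 2 * e)%:E + ((2 * a)^-1)%:E * \int[P]_x ((F i x)%:R * rho x)%:E)%E.
  apply: (@le_trans _ _ (\int[P]_x ((a / 2)%:E * (L i x ^+ 2 * rho x)%:E + ((2 * a)^-1)%:E * ((F i x)%:R * rho x)%:E))%E).
    apply: ge0_le_integral => //.
    - by move=> x _; rewrite lee_fin !mulr_ge0.
    - by apply/measurable_EFinP; do 2! apply: measurable_funM => //.
    - by apply: emeasurable_funD; exact: measurable_funeM.
    move=> x _; rewrite -!EFinM -EFinD lee_fin.
    rewrite [leLHS]mulrA [X in _ <= X + _]mulrA [X in _ <= _ + X]mulrA -mulrDl ler_wpM2r//.
    rewrite -subr_ge0 (_ : _ - _ = (a * L i x - (F i x)%:R) ^+ 2 / (2 * a)).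
      by rewrite divr_ge0 ?sqr_ge0//; lra.
    by case: (F i x) => /=; rewrite ?mulr1n ?mulr0n; field; rewrite gt_eqF.
  rewrite ge0_integralD//; last 4 first.
  - by move=> x _; rewrite mule_ge0.
  - exact: measurable_funeM.
  - by move=> x _; rewrite mule_ge0.
  - exact: measurable_funeM.
  rewrite !ge0_integralZl//; apply: leeD => //.
  by rewrite (EFinM (a / 2) e); apply: lee_wpmul2l.
apply: (le_trans (lee_sum _ (fun i _ => i1 i))).
rewrite big_split/= sumEFin sumr_const -[(a / 2 * e) *+ _]mulr_natl EFinD; apply: leeD => //.
rewrite -ge0_sume_distrr//; last first.
  by move=> i _; apply: integral_ge0.
rewrite (mulrC c) EFinM; apply: lee_wpmul2l => //.
rewrite -ge0_integral_sum//.
rewrite -[leRHS]mule1 -rho1 -ge0_integralZl//; last first.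
- by move=> x _; rewrite lee_fin.
- exact/measurable_EFinP.
apply: ge0_le_integral => //.
- by move=> x _; apply: sume_ge0.
- exact: emeasurable_sum.
- by apply: measurable_funeM; exact/measurable_EFinP.
move=> x _; rewrite sumEFin -mulr_suml -EFinM lee_fin; exact: ler_wpM2r.
Qed.

End testing.

Lemma densp_indic {R : realType} {d0} {T : measurableType d0} (P : probability T R)
    (r : T -> R) mr r0 r1 (A : set T) :
  @densp R d0 T P r mr r0 r1 A = (\int[P]_x (\1_A x * r x)%:E)%E.
Proof.
rewrite /densp integral_mkcond; apply: eq_integral => x _.
by rewrite patchE indicE; case: (x \in A); rewrite ?mul1r ?mul0r.
Qed.

Section global_model.
Context {R : realType} (d n : nat).
Local Notation RR := (measurableTypeR R).
Local Notation U := (d.-tuple RR * RR)%type.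
Local Notation Ub := (@Ub R d).
Local Notation gN := (@gN R).

Lemma integral_gU_fst (f : U -> R) : measurable_fun [set: U] f -> (forall z, 0 <= f z) ->
  (\int[gU d]_w (f w.1.1)%:E = \int[gB d]_z (f z)%:E)%E.
Proof.
move=> mf f0.
have mz : measurable_fun [set: Ub] (fun w : Ub => w.1.1).
  exact: (measurableT_comp measurable_fst measurable_fst).
rewrite (integral_gU (F := fun z _ _ => f z))//; last exact: (measurableT_comp mf mz).
by apply: eq_integral => z _; under eq_integral do rewrite integral_probc; rewrite integral_probc.
Qed.

Lemma gB_rect (A : 'I_d -> set RR) (B : set RR) :
  (forall j, measurable (A j)) -> measurable B ->
  gB d [set z : U | (forall j, A j (tnth z.1 j)) /\ B z.2] = ((\prod_(j < d) gN (A j)) * gN B)%E.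
Proof.
move=> mA mB.
rewrite (_ : [set z | _] = [set t | forall j, A j (tnth t j)] `*` B); last by apply/seteqP; split.
apply: (etrans (product_measure1E (gV d) gN (measurable_rect mA) mB)).
by congr (_ * _)%E; exact: (iid_rect gN mA).
Qed.

Lemma measurable_U_rect (A : 'I_d -> set RR) (B : set RR) :
  (forall j, measurable (A j)) -> measurable B ->
  measurable [set z : U | (forall j, A j (tnth z.1 j)) /\ B z.2].
Proof.
move=> mA mB.
rewrite (_ : [set z | _] = [set t | forall j, A j (tnth t j)] `*` B); last by apply/seteqP; split.
by apply: measurableX => //; exact: measurable_rect.
Qed.

Context (th : 'I_d -> R) (lam : 'I_n -> R) (r : 'I_n -> U -> R).
Context (l01 : forall i, 0 <= lam i <= 1) (mr : forall i, measurable_fun [set: U] (r i)).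
Context (rdom : forall i z, (1 - lam i) * pth th z <= r i z).
Context (r1 : forall i, (\int[gB d]_z (r i z)%:E = 1)%E).

Local Notation bad i := (badbit th (lam i) (r i)).
Local Notation clean i := (cleanpt th (lam i) (r i)).

Let r0 i z : 0 <= r i z := density_ge0 (l01 i) (rdom i) z.

Let mz : measurable_fun [set: Ub] (fun w : Ub => w.1.1).
Proof. exact: (measurableT_comp measurable_fst measurable_fst). Qed.

Lemma block_law_set i (A : set U) (B : set bool) : measurable A ->
  (\int[gU d]_w (\1_A (clean i w) * \1_B (bad i w) * r i w.1.1)%:E =
   gB d A * bernoulli_prob (lam i) B)%E.
Proof.
move=> mA.
pose f c (w : Ub) := \1_B c * (ind th (lam i) (r i) A c w * r i w.1.1).
have i0 c w : 0 <= ind th (lam i) (r i) A c w * r i w.1.1.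
  by rewrite mulr_ge0 ?r0//; rewrite /ind mulr_ge0// indicE.
have B0 (c : bool) : 0 <= \1_B c :> R by rewrite indicE.
have mi c : measurable_fun [set: Ub] (fun w => (ind th (lam i) (r i) A c w * r i w.1.1)%:E).
  apply/measurable_EFinP; apply: measurable_funM; first exact: measurable_ind.
  exact: (measurableT_comp (mr i) mz).
transitivity (\int[gU d]_w ((\1_B true)%:E * (ind th (lam i) (r i) A true w * r i w.1.1)%:E +
                            (\1_B false)%:E * (ind th (lam i) (r i) A false w * r i w.1.1)%:E))%E.
  apply: eq_integral => w _; rewrite -!EFinM -EFinD; congr EFin; rewrite /ind.
  by case: (bad i w) => /=; ring.
rewrite ge0_integralD//; last 4 first.
- by move=> w _; rewrite mule_ge0// lee_fin.
- exact: measurable_funeM.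
- by move=> w _; rewrite mule_ge0// lee_fin.
- exact: measurable_funeM.
rewrite !ge0_integralZl// ?lee_fin//; do ?by move=> w _; rewrite lee_fin.
rewrite !block_law// bernoulli_probE// !diracE !indicE.
have [g gE] : exists g : R, gB d A = g%:E.
  by exists (fine (gB d A)); rewrite fineK// fin_num_measure.
rewrite gE.
have aux (b1 b2 l : R) : (b1%:E * (g%:E * l%:E) + b2%:E * (g%:E * (1 - l)%:E) =
    g%:E * (l%:E * b1%:E + (1 - l)%:E * b2%:E))%E.
  by rewrite -!EFinM -!EFinD; congr EFin; ring.
exact: aux.
Qed.

Definition rho (t : n.-tuple Ub) : R := \prod_(i < n) r i (tnth t i).1.1.

Let mri i : measurable_fun [set: Ub] (fun w : Ub => r i w.1.1).
Proof. exact: (measurableT_comp (mr i) mz). Qed.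

Lemma measurable_rho : measurable_fun [set: n.-tuple Ub] rho.
Proof. exact: (measurable_prod_tnth (f := fun i (w : Ub) => r i w.1.1)). Qed.

Lemma rho_ge0 t : 0 <= rho t.
Proof. by apply: prodr_ge0 => i _; exact: r0. Qed.

Lemma integral_rho : (\int[iid (gU d) n]_t (rho t)%:E = 1)%E.
Proof.
rewrite (integral_iid_prod (gU d) (f := fun i (w : Ub) => r i w.1.1))//.
by rewrite big1// => i _; rewrite integral_gU_fst.
Qed.

Definition advP : probability (n.-tuple Ub) R :=
  densp (P := iid (gU d) n) measurable_rho rho_ge0 integral_rho.

(** The density is a product over samples, so [block_law_set] applies to each factor; this one
    formula yields all the marginal laws and the mutual independence required by the model. *)
Lemma advP_rect (A : 'I_n -> set U) (B : 'I_n -> set bool) : (forall i, measurable (A i)) ->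
  advP [set t | forall i, A i (clean i (tnth t i)) /\ B i (bad i (tnth t i))] =
  (\prod_(i < n) (gB d (A i) * bernoulli_prob (lam i) (B i)))%E.
Proof.
move=> mA; apply: (etrans (densp_indic _ _ _ _)).
under eq_bigr do rewrite -block_law_set//.
rewrite -(integral_iid_prod (gU d)
   (f := fun i (w : Ub) => \1_(A i) (clean i w) * \1_(B i) (bad i w) * r i w.1.1)); last 2 first.
- move=> i; apply: measurable_funM => //; apply: measurable_funM.
    exact: (measurableT_comp (measurable_indic (mA i)) (measurable_cleanpt th (lam i) (mr i))).
  have mB : measurable (B i : set bool) by [].
  exact: (measurableT_comp (measurable_indic mB) (measurable_fun_badbit th (lam i) (mr i))).
- by move=> i w; rewrite mulr_ge0 ?r0// mulr_ge0// indicE.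
apply: eq_integral => t _; congr EFin; rewrite big_split/= -/(rho t); congr (_ * _).
rewrite indicE; have [h|/existsNP[i h]] := pselect (forall i, A i (clean i (tnth t i)) /\ B i (bad i (tnth t i))).
  rewrite mem_set// big1// => i _; have [h1 h2] := h i.
  by rewrite !indicE !mem_set// mulr1.
rewrite memNset//.
rewrite (bigD1 i)//= !indicE.
have [h1|h1] := pselect (A i (clean i (tnth t i))); last by rewrite (memNset h1) !mul0r.
have h2 : ~ B i (bad i (tnth t i)) by move=> h2; apply: h.
by rewrite (memNset h2) mulr0 mul0r.
Qed.

Lemma advP_one (i : 'I_n) (A : set U) (B : set bool) : measurable A ->
  advP [set t | A (clean i (tnth t i)) /\ B (bad i (tnth t i))] =
  (gB d A * bernoulli_prob (lam i) B)%E.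
Proof.
move=> mA; pose A' j := if j == i then A else setT; pose B' j := if j == i then B else setT.
have := @advP_rect A' B'.
rewrite (_ : [set t | forall j, _] = [set t | A (clean i (tnth t i)) /\ B (bad i (tnth t i))]); last first.
  apply/seteqP; split=> t /=; first by move=> /(_ i); rewrite /A' /B' eqxx.
  by move=> h j; rewrite /A' /B'; case: eqP => // ->.
move=> ->; last by move=> j; rewrite /A'; case: eqP.
rewrite (bigD1 i)//= /A' /B' eqxx big1 ?mule1// => j /negbTE ->.
rewrite (_ : gB d setT = 1%E); last exact: (@probability_setT _ _ _ (gB d)).
by rewrite mul1e; exact: (@probability_setT _ _ _ (bernoulli_prob (lam j))).
Qed.

End global_model.

Section adversary_model.
Context {R : realType} (d n : nat).
Local Notation RR := (measurableTypeR R).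
Local Notation U := (d.-tuple RR * RR)%type.
Local Notation Ub := (@Ub R d).
Context (th : 'I_d -> R) (lam : 'I_n -> R) (r : 'I_n -> U -> R).
Context (l01 : forall i, 0 <= lam i <= 1) (mr : forall i, measurable_fun [set: U] (r i)).
Context (rdom : forall i z, (1 - lam i) * pth th z <= r i z).
Context (r1 : forall i, (\int[gB d]_z (r i z)%:E = 1)%E).

Local Notation bad i := (badbit th (lam i) (r i)).
Local Notation clean i := (cleanpt th (lam i) (r i)).
Local Notation mu := (advP l01 mr rdom r1).

(** It does not involve [th]: the sample is one fixed function on one space, and only the measure
    varies with the regression vector. A single estimate is thus tested against all hypotheses at
    once. *)
Definition observed (S : 'M[R]_d) (sigma : R) (t : n.-tuple Ub) : sample n d :=
  fun i => (tuprow (tnth t i).1.1.1 *m S^T, sigma * (tnth t i).1.1.2).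

(** The clean variables are reconstructed from the observation by [cleanpt], and the outliers are
    declared to be the observed block itself, which is legitimate as they may depend on
    everything. *)
Lemma advP_contam (Sigma S : 'M[R]_d) (sigma : R) (beta : 'rV[R]_d) :
  S *m S^T = Sigma -> (forall j, rowf (beta *m S) j = sigma * th j) ->
  contam_model Sigma sigma lam beta mu (observed S sigma).
Proof.
move=> SS bS.
have mcl i : measurable_fun [set: n.-tuple Ub] (fun t => clean i (tnth t i)).
  exact: (measurableT_comp (measurable_cleanpt th (lam i) (mr i)) (measurable_tnth i)).
have mz i : measurable_fun [set: n.-tuple Ub] (fun t => (tnth t i).1.1).
  have m11 : measurable_fun [set: Ub] (fun w : Ub => w.1.1).
    exact: (measurableT_comp measurable_fst measurable_fst).
  exact: (measurableT_comp m11 (measurable_tnth i)).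
have mcoord j (A : set R) : measurable A -> measurable [set z : U | A (tnth z.1 j)].
  move=> mA; have := measurableT_comp (measurable_tnth j) (@measurable_fst _ _ (d.-tuple RR) RR).
  by move=> /(_ measurableT A mA); rewrite setTI.
have msnd (A : set R) : measurable A -> measurable [set z : U | A z.2].
  by move=> mA; have := @measurable_snd _ _ (d.-tuple RR) RR measurableT A mA; rewrite setTI.
have lG i j A : measurable A -> mu [set t | A (tnth (clean i (tnth t i)).1 j)] = normal_prob 0 1 A.
  move=> mA; have := advP_one l01 mr rdom r1 i setT (mcoord j A mA).
  rewrite (_ : bernoulli_prob _ _ = 1%E); last exact: (@probability_setT _ _ _ (bernoulli_prob (lam i))).
  rewrite mule1 (_ : [set t | _ /\ _] = [set t | A (tnth (clean i (tnth t i)).1 j)]); last first.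
    by apply/seteqP; split=> t //= -[].
  move=> ->; pose A' k : set RR := if k == j then A else setT.
  have := @gB_rect R d A' setT _ measurableT.
  rewrite (_ : [set z | _] = [set z : U | A (tnth z.1 j)]); last first.
    apply/seteqP; split=> z /=; first by move=> [/(_ j)]; rewrite /A' eqxx.
    by move=> h; split=> // k; rewrite /A'; case: eqP => // ->.
  move=> ->; last by move=> k; rewrite /A'; case: eqP.
  rewrite (_ : gN _ = 1%E) ?mule1; last exact: (@probability_setT _ _ _ gN).
  rewrite (bigD1 j)//= /A' eqxx big1 ?mule1// => k /negbTE ->.
  exact: (@probability_setT _ _ _ gN).
have lx i A : measurable A -> mu [set t | A (clean i (tnth t i)).2] = normal_prob 0 1 A.
  move=> mA; have := advP_one l01 mr rdom r1 i setT (msnd A mA).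
  rewrite (_ : bernoulli_prob _ _ = 1%E); last exact: (@probability_setT _ _ _ (bernoulli_prob (lam i))).
  rewrite mule1 (_ : [set t | _ /\ _] = [set t | A (clean i (tnth t i)).2]); last first.
    by apply/seteqP; split=> t //= -[].
  by move=> ->; exact: gB_snd.
have lB i A : measurable A -> mu [set t | A (bad i (tnth t i))] = bernoulli_prob (lam i) A.
  move=> mA; have := advP_one l01 mr rdom r1 i A measurableT.
  rewrite (_ : [set t | _ /\ _] = [set t | A (bad i (tnth t i))]); last first.
    by apply/seteqP; split=> t //= -[].
  move=> ->; rewrite (_ : gB d setT = 1%E) ?mul1e//.
  exact: (@probability_setT _ _ _ (gB d)).
exists (fun i j t => tnth (clean i (tnth t i)).1 j), (fun i t => (clean i (tnth t i)).2),
  (fun i t => bad i (tnth t i)),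
  (fun i j t => (tuprow (tnth t i).1.1.1 *m S^T) 0 j), (fun i t => sigma * (tnth t i).1.1.2), S.
have SE (g : d.-tuple RR) j : (tuprow g *m S^T) 0 j = dotT (fun k => S j k) g.
  by rewrite mxE; apply: eq_bigr => k _; rewrite !mxE mulrC.
split=> //.
- split; [|split; [|split; [|split]]].
  + move=> i j.
    exact: (measurableT_comp (measurableT_comp (measurable_tnth j) measurable_fst) (mcl i)).
  + by move=> i; exact: (measurableT_comp measurable_snd (mcl i)).
  + move=> i; exact: (measurableT_comp (measurable_fun_badbit th (lam i) (mr i)) (measurable_tnth i)).
  + move=> i j; under eq_fun do rewrite SE.
    exact: (measurableT_comp (measurable_dotU _) (mz i)).
  + move=> i; apply: measurable_funM => //.
    exact: (measurableT_comp (@measurable_sndU R d) (mz i)).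
- move=> AG Axi AB mAG mAxi mAB.
  pose A i : set U := [set z | (forall j, AG i j (tnth z.1 j)) /\ Axi i z.2].
  have mA i : measurable (A i) by exact: (measurable_U_rect (A := AG i) (mAG i) (mAxi i)).
  rewrite [X in fine (mu X) = _](_ : _ = [set t | forall i, A i (clean i (tnth t i)) /\ AB i (bad i (tnth t i))]); last first.
    apply/seteqP; split=> t /=.
      by move=> [h1 [h2 h3]] i; split=> //; split=> //; exact: h1.
    move=> h; split; first by move=> i j; have [[]] := h i.
    by split=> i; have [[]] := h i.
  rewrite advP_rect//.
  transitivity ((\prod_(i < n) \prod_(j < d) fine (gN (AG i j))) *
      (\prod_(i < n) fine (gN (Axi i))) * \prod_(i < n) fine (bernoulli_prob (lam i) (AB i))); last first.
    congr (_ * _ * _); apply: eq_bigr => i _; last by congr fine; exact/esym/lB.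
      by apply: eq_bigr => j _; congr fine; apply/esym/lG; exact: mAG.
    by congr fine; apply/esym/lx; exact: mAxi.
  have fN (B : set RR) : measurable B -> (fine (gN B))%:E = gN B.
    by move=> mB; rewrite fineK// fin_num_measure.
  have gBE i : fine (gB d (A i)) = (\prod_(j < d) fine (gN (AG i j))) * fine (gN (Axi i)).
    apply: EFin_inj; rewrite fineK ?fin_num_measure// EFinM -prodEFin.
    rewrite (gB_rect (A := AG i) (mAG i) (mAxi i)) (fN _ (mAxi i)); congr (_ * _)%E.
    by apply: eq_bigr => j _; rewrite (fN _ (mAG i j)).
  rewrite (eq_bigr (fun i => (fine (gB d (A i)) * fine (bernoulli_prob (lam i) (AB i)))%:E)); last first.
    by move=> i _; rewrite EFinM !fineK ?fin_num_measure.
  rewrite prodEFin /= -!big_split/=; apply: eq_bigr => i _.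
  by rewrite gBE.
move=> t i; rewrite /observed; case bt: (bad i (tnth t i)).
  by congr pair; apply/rowP => j; rewrite mxE.
rewrite /= /cleanpt bt /tau/=; congr pair.
rewrite dotvC dotv_dotT (_ : dotT _ _ = sigma * dotT th (tnth t i).1.1.1); first by ring.
by rewrite /dotT mulr_sumr; apply: eq_bigr => j _; rewrite bS mulrA.
Qed.

End adversary_model.

(** * The family of sign vectors *)

Section sign_family.
Context {R : realType} (d n : nat).
Local Notation RR := (measurableTypeR R).
Local Notation U := (d.-tuple RR * RR)%type.
Local Notation Ub := (@Ub R d).
Local Notation cube := {ffun 'I_d -> bool}.
Context (J : {set 'I_d}) (e t : R) (lam : 'I_n -> R).
Local Notation k := (#|J|%:R : R).
Local Notation s := (2 * k * e).

Definition signs (b : cube) (j : 'I_d) : R :=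
  if j \in J then (if b j then e else - e) else 0.

Definition block_density (b : cube) (i : 'I_n) (z : U) : R :=
  if lam i <= t then pth (signs b) z else flat J (lam i) s z.

Lemma nrm2_signs b : nrm2 (signs b) = k * e ^+ 2.
Proof.
rewrite /nrm2 (eq_bigr (fun j => if j \in J then e ^+ 2 else 0)).
  by rewrite -big_mkcond sumr_const mulr_natl.
move=> j _; rewrite /signs; case: (j \in J); last by rewrite expr0n.
by case: (b j); rewrite ?sqrrN.
Qed.

Lemma nrm2_signsB b b' : nrm2 (fun j => signs b j - signs b' j) = (ham J b b')%:R * (4 * e ^+ 2).
Proof.
rewrite /ham -sum1_card natr_sum mulr_suml big_mkcond [RHS]big_mkcond/=.
apply: eq_bigr => j _; rewrite inE /signs; case: (j \in J) => /=; last by rewrite subr0 expr0n.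
by case: (b j); case: (b' j) => /=; rewrite ?subrr ?expr0n//; ring.
Qed.

Context (J0 : (0 < #|J|)%N) (e0 : 0 < e) (st : s <= t) (s12 : s <= 1 / 2)
  (l01 : forall i, 0 <= lam i <= 1).

Let s0 : 0 <= s. Proof. by rewrite !mulr_ge0// ltW. Qed.
Let l0 i : 0 <= lam i. Proof. by case/andP: (l01 i). Qed.
Let l1 i : lam i <= 1. Proof. by case/andP: (l01 i). Qed.

Lemma measurable_block_density b i : measurable_fun [set: U] (block_density b i).
Proof.
rewrite /block_density; case: (lam i <= t); first exact: measurable_pth.
exact: measurable_flat.
Qed.

Lemma block_density_dom b i z : (1 - lam i) * pth (signs b) z <= block_density b i z.
Proof.
rewrite /block_density; case: ifPn => [_|].
  by rewrite -[leRHS]mul1r ler_wpM2r ?expR_ge0// gerBl.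
rewrite -ltNge => tl; apply: (flat_dom J0 (l0 i) (l1 i) s0 s12 (e := e)) => //.
- by apply: (le_trans st); exact: ltW.
- by move=> j /negbTE jJ; rewrite /signs jJ.
- move=> j; rewrite /signs; case: (j \in J); last by rewrite normr0 ltW.
  by case: (b j); rewrite ?normrN gtr0_norm.
Qed.

Lemma integral_block_density b i : (\int[gB d]_z (block_density b i z)%:E = 1)%E.
Proof.
rewrite /block_density; case: (lam i <= t); first exact: integral_pth1.
exact: (integral_flat J0 (l0 i) (l1 i) s0 s12).
Qed.

Definition signP b : probability (n.-tuple Ub) R :=
  advP l01 (measurable_block_density b) (block_density_dom b) (integral_block_density b).

(** [block_density] is the product of [lik_block] and [base_block]: the factor [base] is common to
    all sign vectors, and [lik] involves only the samples with rate at most [t]. *)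
Let lik_block b (i : 'I_n) (z : U) : R := if lam i <= t then pth (signs b) z else 1.
Let base_block (i : 'I_n) (z : U) : R := if lam i <= t then 1 else flat J (lam i) s z.
Let lik b (x : n.-tuple Ub) : R := \prod_(i < n) lik_block b i (tnth x i).1.1.
Let base (x : n.-tuple Ub) : R := \prod_(i < n) base_block i (tnth x i).1.1.

Let mz : measurable_fun [set: Ub] (fun w : Ub => w.1.1).
Proof. exact: (measurableT_comp measurable_fst measurable_fst). Qed.

Let mlikb b i : measurable_fun [set: U] (lik_block b i).
Proof. by rewrite /lik_block; case: (lam i <= t) => //; exact: measurable_pth. Qed.

Let mbaseb i : measurable_fun [set: U] (base_block i).
Proof. by rewrite /base_block; case: (lam i <= t) => //; exact: measurable_flat. Qed.

Let likb0 b i z : 0 <= lik_block b i z.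
Proof. by rewrite /lik_block; case: (lam i <= t) => //; exact: expR_ge0. Qed.

Let baseb0 i z : 0 <= base_block i z.
Proof.
have := density_ge0 (l01 i) (block_density_dom [ffun=> true] i) z.
by rewrite /base_block /block_density; case: (lam i <= t).
Qed.

Let mlik b : measurable_fun [set: n.-tuple Ub] (lik b).
Proof.
apply: (measurable_prod_tnth (f := fun i (w : Ub) => lik_block b i w.1.1)) => i.
exact: (measurableT_comp (mlikb b i) mz).
Qed.

Let mbase : measurable_fun [set: n.-tuple Ub] base.
Proof.
apply: (measurable_prod_tnth (f := fun i (w : Ub) => base_block i w.1.1)) => i.
exact: (measurableT_comp (mbaseb i) mz).
Qed.

Let lik0 b x : 0 <= lik b x. Proof. by apply: prodr_ge0 => i _; exact: likb0. Qed.
Let base0 x : 0 <= base x. Proof. by apply: prodr_ge0 => i _; exact: baseb0. Qed.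

Let base1 : (\int[iid (gU d) n]_x (base x)%:E = 1)%E.
Proof.
rewrite (integral_iid_prod (gU d) (f := fun i (w : Ub) => base_block i w.1.1)); last 2 first.
- by move=> i; exact: (measurableT_comp (mbaseb i) mz).
- by move=> i w; exact: baseb0.
rewrite big1// => i _; rewrite integral_gU_fst//.
rewrite /base_block; case: (lam i <= t); first exact: integral_probc.
exact: (integral_flat J0 (l0 i) (l1 i) s0 s12).
Qed.

Let lik_sq b : k * e ^+ 2 <= 1 / 8 ->
  (\int[iid (gU d) n]_x (lik b x ^+ 2 * base x)%:E <=
   (expR (2 * (k * e ^+ 2) * (Ncount lam t)%:R))%:E)%E.
Proof.
move=> ke.
have likE x : lik b x ^+ 2 * base x = \prod_(i < n) (lik_block b i (tnth x i).1.1 ^+ 2 * base_block i (tnth x i).1.1).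
  by rewrite big_split/= prodrXl.
under eq_integral do rewrite likE.
have m2 i : measurable_fun [set: U] (fun z => lik_block b i z ^+ 2 * base_block i z).
  by apply: measurable_funM => //; exact: measurable_funX.
have p2 i z : 0 <= lik_block b i z ^+ 2 * base_block i z.
  by rewrite mulr_ge0// sqr_ge0.
rewrite (integral_iid_prod (gU d) (f := fun i (w : Ub) => lik_block b i w.1.1 ^+ 2 * base_block i w.1.1)); last 2 first.
- by move=> i; exact: (measurableT_comp (m2 i) mz).
- by move=> i w; exact: p2.
apply: (@le_trans _ _ (\prod_(i < n) (if lam i <= t then expR (2 * (k * e ^+ 2)) else 1)%:E)%E).
  pose K (x y : \bar R) := (0 <= x)%E /\ (x <= y)%E.
  suff [] : K (\prod_(i < n) \int[gU d]_x (lik_block b i x.1.1 ^+ 2 * base_block i x.1.1)%:E)%E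
    (\prod_(i < n) (if lam i <= t then expR (2 * (k * e ^+ 2)) else 1)%:E)%E by [].
  elim/big_ind2: _ => [|x1 x2 y1 y2 [? ?] [? ?]|i _]; first by split.
    by split; [exact: mule_ge0|exact: lee_pmul].
  split; first by apply: integral_ge0 => w _; rewrite lee_fin.
  rewrite (integral_gU_fst (f := fun z => lik_block b i z ^+ 2 * base_block i z))//.
  rewrite /lik_block /base_block; case: (lam i <= t).
    under eq_integral do rewrite mulr1.
    by rewrite -(nrm2_signs b); apply: integral_pth_sq; rewrite nrm2_signs.
  under eq_integral do rewrite expr1n mul1r.
  by rewrite (integral_flat J0 (l0 i) (l1 i) s0 s12).
rewrite prodEFin lee_fin NcountE.
rewrite -big_mkcond/= (eq_bigl (fun i => i \in clean_set lam t)); last by move=> i; rewrite inE.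
by rewrite prodr_const expRM_natr.
Qed.

(** Summing the success probabilities over the cube gives at least [3 / 4 * 2^d], whereas
    [testing_bound] with [packing_count] allows strictly less. The exponent [k / 96] is [2 k e^2 N]
    with [N e^2 <= 1 / 192]. *)
Lemma signP_separation (g : cube -> n.-tuple Ub -> bool) :
  (forall b, measurable [set x | g b x]) ->
  (forall b, ((3 / 4)%:E <= signP b [set x | g b x])%E) ->
  (Ncount lam t)%:R * e ^+ 2 <= 1 / 192 -> k * e ^+ 2 <= 1 / 8 ->
  ~ (forall x b b', g b x -> g b' x -> (200 * ham J b b' <= #|J|)%N).
Proof.
move=> mg g34 Ne ke sep.
(* Close to the square root of [(53 / 100)^k], which balances [a * E] and [(53 / 100)^k / a]; each
   is then below [3 / 4], already for [k = 1]. *)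
pose a : R := (73 / 100) ^+ #|J|; have a0 : 0 < a by rewrite exprn_gt0//; lra.
pose c : R := (53 / 100) ^+ #|J| * 2 ^+ d.
have c0 : 0 <= c by rewrite mulr_ge0 ?exprn_ge0//; lra.
pose E := expR (k / 96).
have E1 b : (\int[iid (gU d) n]_x (lik b x ^+ 2 * base x)%:E <= E%:E)%E.
  apply: (le_trans (lik_sq b ke)); rewrite lee_fin ler_expR.
  by have := ler_wpM2l (ler0n R #|J|) Ne; lra.
have := testing_bound a0 c0 mlik lik0 mbase base0 base1 E1 mg (fun x => @packing_count R d J (fun b => g b x) (sep x)).
apply/negP; rewrite -ltNge.
have cardc : #|{: cube}|%:R = 2 ^+ d :> R by rewrite card_ffun card_bool card_ord natrX.
apply: (@lt_le_trans _ _ (\sum_(b : cube) (3 / 4)%:E)%E); last first.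
  apply: lee_sum => b _; apply: (le_trans (g34 b)); rewrite le_eqVlt; apply/orP; left; apply/eqP.
  apply: (etrans (densp_setb _ _ _ (mg b))); apply: eq_integral => x _; congr (_ * _)%:E.
  rewrite /lik /base -big_split; apply: eq_bigr => i _.
  rewrite /= /block_density /lik_block /base_block; by case: (lam i <= t); rewrite ?mulr1 ?mul1r.
rewrite sumEFin sumr_const lte_fin cardc -[(3 / 4) *+ _]mulr_natl cardc.
have d0 : 0 < 2 ^+ d :> R by rewrite exprn_gt0.
rewrite (_ : _ + _ = 2 ^+ d * ((a * E + (53 / 100) ^+ #|J| / a) / 2)); last first.
  by rewrite /c; field; rewrite gt_eqF.
rewrite ltr_pM2l//.
have pow1 (x : R) : 0 <= x -> x <= 1 -> x ^+ #|J| <= x.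
  by move=> x0 x1; rewrite -[leRHS]expr1; apply: ler_wiXn2l.
have h1 : (53 / 100) ^+ #|J| / a <= 53 / 73.
  rewrite /a -expr_div_n; apply: le_trans (pow1 _ _ _) _; lra.
have h2 : a * E <= 73 / 100 * (96 / 95).
  have -> : E = expR (1 / 96) ^+ #|J| by rewrite /E -expRM_natr; congr expR; field.
  have l1' : 1 / 96 < 1 :> R by lra.
  have h3 : expR (1 / 96) <= 96 / 95 :> R.
    by apply: (le_trans (expR_le_inv l1')); rewrite (_ : 1 - 1 / 96 = 95 / 96) ?invf_div//; lra.
  have p := expR_ge0 (1 / 96 : R).
  have h4 : 73 / 100 * expR (1 / 96) <= 73 / 100 * (96 / 95) :> R by apply: ler_wpM2l => //; lra.
  rewrite /a -exprMn; apply: le_trans (pow1 _ _ _) h4; first by apply: mulr_ge0 => //; lra.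
  by lra.
by lra.
Qed.

End sign_family.

(** * Choice of parameters for the lower bound *)

Section lower_bound.
Context {R : realType}.

Lemma exists_sqrt_bracket (d : nat) : (1 <= d)%N ->
  exists k : nat, [/\ (1 <= k)%N, (k <= d)%N, (d <= k ^ 2)%N & (k ^ 2 <= 4 * d)%N].
Proof.
move=> d1; have ex : exists k : nat, (d <= k ^ 2)%N by exists d; rewrite -mulnn leq_pmulr.
exists (ex_minn ex); case: ex_minnP => k dk kmin.
have k1 : (1 <= k)%N by case: k dk {kmin} => //; rewrite exp0n//; case: d d1 {ex}.
split=> //; first by apply: kmin; rewrite -mulnn leq_pmulr.
have : (k.-1 ^ 2 < d)%N by rewrite ltnNge; apply/negP => /kmin; case: k k1 {dk kmin} => //= k _; rewrite ltnn.
case: k k1 {dk kmin} => //= -[|k] _; first by rewrite exp1n; lia.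
by rewrite -!mulnn; nia.
Qed.

Lemma card_ord_lt (d k : nat) : (k <= d)%N -> #|finset (fun j : 'I_d => (j < k)%N)| = k.
Proof.
move=> kd; rewrite -sum1_card (eq_bigl (fun j : 'I_d => (j < k)%N)); last by move=> j; rewrite inE.
by rewrite (big_ord_narrow kd) sum1_card card_ord.
Qed.

Lemma factor_unit (d : nat) (Sigma S : 'M[R]_d) : posdef Sigma -> S *m S^T = Sigma -> S \in unitmx.
Proof.
move=> pd SS; rewrite -row_free_unit; apply: inj_row_free => v vS.
apply/eqP/negPn/negP => v0; have := nrm2_mulS_gt0 SS pd v0.
by rewrite vS /nrm2 big1 ?ltxx// => j _; rewrite /rowf mxE expr0n.
Qed.

Lemma le_twice_sqrt (x y : R) : 0 <= y -> y ^+ 2 <= 4 * x -> y <= 2 * Num.sqrt x.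
Proof.
move=> y0 yx; have x0 : 0 <= x by have := sqr_ge0 y; lra.
have s0 := sqrtr_ge0 x; rewrite -(@ler_pXn2r _ 2)// ?nnegrE ?mulr_ge0//.
by rewrite exprMn sqr_sqrtr//; lra.
Qed.

Lemma nrm2B_le (d : nat) (v w : 'I_d -> R) :
  nrm2 (fun j => v j - w j) <= 2 * nrm2 v + 2 * nrm2 w.
Proof.
rewrite /nrm2 !mulr_sumr -big_split/=; apply: ler_sum => j _.
by have := sqr_ge0 (v j + w j); rewrite sqrrD sqrrB; lra.
Qed.

(** From [4 t^2 = m <= t^2 + d / N]: few samples have rate at most half of [sqrt m], otherwise [t]
    would beat the minimum. *)
Lemma mobj_count (d n : nat) (lam : 'I_n -> R) (m t : R) : t ^+ 2 = m / 4 ->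
  (m%:E <= mobj d lam t)%E -> (Ncount lam t)%:R * t ^+ 2 <= d%:R / 3.
Proof.
move=> t2; rewrite /mobj; case: ifPn => [/eqP-> _|N0]; first by rewrite mul0r.
have Np : 0 < (Ncount lam t)%:R :> R by rewrite ltr0n lt0n.
rewrite -EFinD lee_fin => h.
have h2 : 3 * t ^+ 2 <= d%:R / (Ncount lam t)%:R by lra.
by move: h2; rewrite ler_pdivlMr//; lra.
Qed.

Lemma Lreg_lower (d n : nat) (Sigma : 'M[R]_d) (sigma : R) (lam : 'I_n -> R) (m : R) :
  (1 <= d)%N -> posdef Sigma -> 0 < sigma -> (forall i, 0 <= lam i <= 1) ->
  md d lam = m%:E -> 0 < m -> m <= 1 ->
  ((1 / 500 / 500 * sigma ^+ 2 / Num.sqrt (d%:R : R) * m)%:E <= Lreg Sigma sigma lam)%E.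
Proof.
move=> d1 pd sg l01 mdm m0 m1.
have [S SS] := cholesky pd.
have uS := factor_unit pd SS.
have [k [k1 kd dk kd4]] := exists_sqrt_bracket d1.
pose J := finset (fun j : 'I_d => (j < k)%N).
have cJ : #|J| = k by exact: card_ord_lt.
have J0 : (0 < #|J|)%N by rewrite cJ.
pose t := Num.sqrt m / 2.
have t0 : 0 < t by rewrite divr_gt0// sqrtr_gt0.
have t2 : t ^+ 2 = m / 4 by rewrite /t expr_div_n sqr_sqrtr ?ltW//; congr (_ / _); ring.
have t1 : t <= 1 / 2.
  by rewrite -(@ler_pXn2r _ 2)// ?nnegrE; lra.
have kp : 0 < k%:R :> R by rewrite ltr0n.
have kge1 : 1 <= k%:R :> R by rewrite ler1n.
(* Then [2 k e = t / 4 <= t], and [N e^2 = N t^2 / (64 k^2) <= d / (192 k^2) <= 1 / 192], by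
   [N t^2 <= d / 3] and [d <= k^2]. *)
pose e := t / (8 * k%:R).
have e0 : 0 < e by rewrite divr_gt0// mulr_gt0.
have sE : 2 * #|J|%:R * e = t / 4 by rewrite cJ /e; field; rewrite gt_eqF.
have e2 : e ^+ 2 = m / (256 * k%:R ^+ 2).
  by rewrite /e expr_div_n t2; field; rewrite gt_eqF.
have st : 2 * #|J|%:R * e <= t by rewrite sE; lra.
have s12 : 2 * #|J|%:R * e <= 1 / 2 by rewrite sE; lra.
have mt : (m%:E <= mobj d lam t)%E.
  rewrite -mdm; apply: ereal_inf_lbound; exists t => //=; rewrite in_itv/= ltW//=; lra.
have Nt := mobj_count t2 mt.
have dkR : d%:R <= k%:R ^+ 2 :> R by rewrite -natrX ler_nat.
have kdR : k%:R ^+ 2 <= 4 * d%:R :> R by rewrite -natrX -natrM ler_nat.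
have Ne : (Ncount lam t)%:R * e ^+ 2 <= 1 / 192.
  rewrite /e expr_div_n mulrA ler_pdivrMr ?exprn_gt0 ?mulr_gt0//.
  by rewrite (_ : (8 * k%:R) ^+ 2 = 64 * k%:R ^+ 2); [lra|ring].
have ke : #|J|%:R * e ^+ 2 = m / (256 * k%:R).
  by rewrite cJ e2; field; rewrite gt_eqF.
have ke8 : #|J|%:R * e ^+ 2 <= 1 / 8.
  have p : 0 < 256 * k%:R :> R by apply: mulr_gt0; [rewrite ltr0n|exact: kp].
  by rewrite ke ler_pdivrMr; [clear -m1 kge1; lra|exact: p].
apply: le_ereal_inf_tmp => _ [s hs <-]; rewrite lee_fin leNgt; apply/negP => slt.
(* The infimum over estimators need not be attained; relaxing [1 / 5] to [1 / 4] yields an actual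
   [M], and leaves the success level [3 / 4] of [signP_separation]. *)
have /ereal_inf_lt[_ [M _ <-] wM] :
    (ereal_inf [set worst_risk Sigma sigma lam M s | M in [set: sample n d -> 'rV[R]_d]] < (1 / 4)%:E)%E.
  by apply: (le_lt_trans hs); rewrite lte_fin; clear; lra.
pose beta (b : {ffun 'I_d -> bool}) : 'rV[R]_d := (\row_j (sigma * signs J e b j)) *m invmx S.
have betaS b j : rowf (beta b *m S) j = sigma * signs J e b j.
  by rewrite /beta mulmxKV// /rowf mxE.
pose P b := signP J0 e0 st s12 l01 b.
(* [M] is an arbitrary function, so its error event is replaced by a measurable cover of probability
   below [1 / 4]. *)
have /choice[E hE] : forall b, exists E, [/\ measurable E, (P b E < (1 / 4)%:E)%E &
    [set x | s < sqnormS Sigma (M (observed S sigma x) - beta b)] `<=` E].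
  move=> b; have : (outerP (P b) [set x | (s < sqnormS Sigma (M (observed S sigma x) - beta b))%R] < (1 / 4)%:E)%E.
    apply: le_lt_trans wM; apply: ereal_sup_ubound.
    exists (beta b), _, _, (P b), (observed S sigma); split=> //.
    by apply: advP_contam => // j.
  by move=> /ereal_inf_lt[_ [E [mE sE'] <-] PE]; exists E.
pose g b (x : n.-tuple (Ub d)) := x \notin E b.
have gE b : [set x | g b x] = ~` E b.
  by apply/seteqP; split=> x /=; rewrite /g notin_setE.
have mE b : measurable (E b) by have [] := hE b.
apply: (@signP_separation R d n J e t lam J0 e0 st s12 l01 g _ _ Ne ke8).
- by move=> b; rewrite gE; exact: measurableC.
- move=> b; rewrite gE; have [_ Pb _] := hE b.
  rewrite (_ : signP _ _ _ _ _ _ _ = 1 - P b (E b))%E; last exact: (probability_setC (P b) (mE b)).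
  rewrite (_ : 3 / 4 = 1 - 1 / 4); last by field.
  by rewrite EFinB; apply: leeB => //; exact: ltW.
move=> x b b' gb gb'.
have close c : g c x -> nrm2 (fun j => rowf (M (observed S sigma x) *m S) j - sigma * signs J e c j) <= s.
  move=> gc; have [_ _ sub] := hE c.
  rewrite leNgt; apply/negP => h; move: gc; rewrite /g notin_setE; apply; apply: sub => /=.
  rewrite (sqnormS_nrm2 _ SS) mulmxBl.
  rewrite (_ : rowf _ = fun j => rowf (M (observed S sigma x) *m S) j - sigma * signs J e c j)//.
  by apply/funext => j; rewrite -betaS /rowf !mxE.
have hb := close b gb; have hb' := close b' gb'.
have hs4 : sigma ^+ 2 * ((ham J b b')%:R * (4 * e ^+ 2)) <= 4 * s.
  rewrite -nrm2_signsB -nrm2Z; apply: (@le_trans _ _ (2 * s + 2 * s)); last by clear; lra.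
  apply: le_trans (lerD (ler_wpM2l _ hb') (ler_wpM2l _ hb)) => //.
  have := nrm2B_le (fun j => rowf (M (observed S sigma x) *m S) j - sigma * signs J e b' j)
                   (fun j => rowf (M (observed S sigma x) *m S) j - sigma * signs J e b j).
  apply: le_trans; rewrite le_eqVlt; apply/orP; left; apply/eqP; congr nrm2.
  by apply/funext => j; ring.
have sg2 : 0 < sigma ^+ 2 by rewrite exprn_gt0.
have dp : 0 < Num.sqrt (d%:R : R) by rewrite sqrtr_gt0 ltr0n.
have kd2 := le_twice_sqrt (ltW kp) kdR.
(* Here [k e^2 = m / (256 k)] and [k <= 2 sqrt d], so [256 * 200 * 2 <= 500 * 500] suffices. The
   factor 200 matches the radius in [packing_count]. *)
have ss : s < sigma ^+ 2 * (k%:R * e ^+ 2) / 200.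
  apply: (lt_le_trans slt).
  rewrite e2 (_ : _ * m = sigma ^+ 2 * m * (1 / 500 / 500 / Num.sqrt d%:R)); last by ring.
  rewrite (_ : _ / 200 = sigma ^+ 2 * m * (1 / (256 * 200 * k%:R))); last first.
    by field; rewrite gt_eqF.
  apply: ler_wpM2l; first by rewrite mulr_ge0// ltW.
  have p : 0 < 256 * 200 * k%:R :> R by do 2! [apply: mulr_gt0; last by [rewrite ltr0n|exact: kp]]; rewrite ltr0n.
  rewrite ler_pdivrMr; last exact: dp.
  rewrite [leRHS]mulrAC mul1r ler_pdivlMr; last exact: p.
  by clear -kd2 dp; lra.
rewrite cJ -(ler_nat R) natrM.
have se2 : 0 < sigma ^+ 2 * e ^+ 2 by rewrite mulr_gt0// exprn_gt0.
rewrite -(ler_pM2r se2).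
move: hs4 ss; clear; set p := sigma ^+ 2; set q := e ^+ 2 => h1 h2.
have e1 : p * ((ham J b b')%:R * (4 * q)) = 4 * ((ham J b b')%:R * (p * q)) by ring.
have e2 : p * (k%:R * q) = k%:R * (p * q) by ring.
have e3 : 200 * (ham J b b')%:R * (p * q) = 200 * ((ham J b b')%:R * (p * q)) by rewrite -mulrA.
move: h1 h2; rewrite e1 e2 e3; clear; set A := _%:R * (p * q); set B := _%:R * (p * q); lra.
Qed.

End lower_bound.

(** * Existence of depth maximisers and conclusion *)

Section selectors.
Context {R : realType} (d n : nat).

(** Every depth is a fraction [j / N] with [0 <= j <= N], so the infimum over directions and the
    supremum over candidates are attained on finitely many values. If no sample is kept, all depths
    are 0. *)
Lemma exists_TC (lam : 'I_n -> R) (t : R) (z : sample n d) : (1 <= d)%N ->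
  exists eta : 'rV[R]_d, is_TC (wthr lam t) z eta.
Proof.
move=> d1; set N := #|clean_set lam t|.
have dvalE eta v : exists2 j : nat, (j <= N)%N & dval lam t eta v z = j%:R / N%:R.
  exists (\sum_(i in clean_set lam t) nat_of_bool (0 <= ((z i).2 - dotv eta (z i).1) * dotv v (z i).1)%R)%N.
    by rewrite /N -sum1_card; apply: leq_sum => i _; case: (0 <= _).
  by rewrite /dval natr_sum.
have depthE eta : exists2 j : nat, (j <= N)%N & depthw (wthr lam t) eta z = j%:R / N%:R.
  pose Q j := `[< exists2 v, dotv v v = 1 & dval lam t eta v z = j%:R / N%:R >].
  have exQ : exists j, Q j.
    have [v v1] := @exists_unit R d d1; have [j _ h] := dvalE eta v.
    by exists j; apply/asboolP; exists v.
  case: (ex_minnP exQ) => j /asboolP[v v1 vE] jmin.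
  have dE : depthw (wthr lam t) eta z = j%:R / N%:R.
    apply/eqP; rewrite eq_le; apply/andP; split; first by rewrite -vE; exact: depthw_le.
    apply: depthw_ge => // u u1; have [i _ uE] := dvalE eta u.
    rewrite uE ler_wpM2r ?invr_ge0// ler_nat; apply: jmin; apply/asboolP; by exists u.
  exists j => //; have [i iN iE] := dvalE eta v.
  by apply: leq_trans iN; apply: jmin; apply/asboolP; exists v.
pose Q j := `[< exists eta, depthw (wthr lam t) eta z = j%:R / N%:R >] && (j <= N)%N.
have exQ : exists j, Q j.
  by have [j jN h] := depthE 0; exists j; rewrite /Q jN andbT; apply/asboolP; exists 0.
have bQ j : Q j -> (j <= N)%N by case/andP.
case: (ex_maxnP exQ bQ) => j /andP[/asboolP[eta etaE] jN] jmax.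
exists eta => eta'; have [i iN iE] := depthE eta'.
rewrite iE etaE ler_wpM2r ?invr_ge0// ler_nat; apply: jmax.
by rewrite /Q iN andbT; apply/asboolP; exists eta'.
Qed.

Lemma outerP_le d0 (T : measurableType d0) (mu : probability T R) (A B : set T) :
  A `<=` B -> (outerP mu A <= outerP mu B)%E.
Proof.
by move=> AB; apply: le_ereal_inf => _ [E [mE BE] <-]; exists E => //; split=> //; exact: subset_trans BE.
Qed.

(** At most [n] samples are kept, hence [m_d >= d / n > 0]; positivity leaves room for a
    near-minimiser below [2 m]. *)
Lemma mobj_ge (lam : 'I_n -> R) (t : R) : ((d%:R / n%:R)%:E <= mobj d lam t)%E.
Proof.
rewrite /mobj; case: ifPn => [_|N0]; first by rewrite addey// leey.
have NN : (Ncount lam t <= n)%N by rewrite NcountE -[leqRHS](card_ord n) max_card.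
rewrite -EFinD lee_fin; apply: (@le_trans _ _ (d%:R / (Ncount lam t)%:R)).
  rewrite ler_wpM2l// lef_pV2 ?posrE ?ltr0n ?ler_nat// ?lt0n//.
  by rewrite -lt0n; apply: leq_trans NN; rewrite lt0n.
by rewrite lerDr sqr_ge0.
Qed.

End selectors.

Theorem mainTheorem9 :
  exists c C1 C2 : Rdefinitions.R, 0 < c /\ 0 < C1 /\ 0 < C2 /\
  forall (d n : nat) (Sigma : 'M[Rdefinitions.R]_d) (sigma : Rdefinitions.R) (lam : 'I_n -> Rdefinitions.R),
    (1 <= d)%N -> posdef Sigma -> 0 < sigma -> (1 <= n)%N ->
    (forall i, 0 <= lam i <= 1) ->
    (md d lam <= c%:E)%E ->
    let m := fine (md d lam) in
    [/\ ((C1 * sigma ^+ 2 / Num.sqrt (d%:R : Rdefinitions.R) * m)%:E <= Lreg Sigma sigma lam)%E,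
        (Lreg Sigma sigma lam <= (C2 * sigma ^+ 2 * m)%:E)%E
      & forall tstar : Rdefinitions.R, 0 <= tstar <= 1 -> mobj d lam tstar = md d lam ->
        forall sel : sample n d -> 'rV[Rdefinitions.R]_d,
          (forall z, is_TC (wthr lam tstar) z (sel z)) ->
        forall (beta : 'rV[Rdefinitions.R]_d) (d0 : measure_display) (T : measurableType d0)
               (mu : probability T Rdefinitions.R) (Z : T -> sample n d),
          contam_model Sigma sigma lam beta mu Z ->
          (outerP mu [set w | (C2 * sigma ^+ 2 * m <= sqnormS Sigma (sel (Z w) - beta))%R]
             <= (1 / 5 : Rdefinitions.R)%:E)%E].
Proof.
have [c [C [c0 c1 C0 up]]] := @TC_upper Rdefinitions.R.
(* Both factors 2 come from bounding the minimax risk with a threshold whose objective may be as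
   large as [2 m]. *)
exists (c / 2), (1 / 500 / 500), (2 * C); split; first by rewrite divr_gt0.
split.
  have h : 0 < 500 :> Rdefinitions.R by rewrite ltr0n.
  by apply: divr_gt0; last exact: h; apply: divr_gt0; last exact: h; exact: ltr01.
split; first by rewrite mulr_gt0.
move=> d n Sigma sigma lam d1 pd sg n1 l01 mdc m.
have mdge : ((d%:R / n%:R)%:E <= md d lam)%E.
  by apply: le_ereal_inf_tmp => _ [t _ <-]; exact: mobj_ge.
have dn0 : 0 < d%:R / n%:R :> Rdefinitions.R by rewrite divr_gt0// ltr0n.
have mdE : md d lam = m%:E.
  rewrite /m fineK// fin_numE; apply/andP; split.
    by apply/eqP => h; rewrite h in mdge.
  by apply/eqP => h; rewrite h in mdc.
have m0 : 0 < m by apply: lt_le_trans dn0 _; rewrite -lee_fin -mdE.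
have mc : m <= c / 2 by rewrite -lee_fin -mdE.
have sg2 : 0 < sigma ^+ 2 by rewrite exprn_gt0.
split.
- by apply: Lreg_lower => //; lra.
- have /ereal_inf_lt[_ [t t01 <-] tm] : (md d lam < (2 * m)%:E)%E.
    by rewrite mdE lte_fin; lra.
  have [m' m'E] : exists m', mobj d lam t = m'%:E.
    by case: (mobj d lam t) tm (mobj_ge d lam t) => // m' _ _; exists m'.
  have m'm : m' <= 2 * m by rewrite -lee_fin -m'E ltW.
  have [sel hsel] := boolp.choice (fun z : sample n d => exists_TC lam t z d1).
  apply: (@le_trans _ _ (C * sigma ^+ 2 * m')%:E); last first.
    rewrite lee_fin (_ : 2 * C * _ * m = C * sigma ^+ 2 * (2 * m)); last by ring.
    by apply: ler_wpM2l => //; rewrite mulr_ge0// ltW.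
  apply: ereal_inf_lbound; exists (C * sigma ^+ 2 * m') => //=.
  apply: (@le_trans _ _ (worst_risk Sigma sigma lam sel (C * sigma ^+ 2 * m'))).
    by apply: ereal_inf_lbound; exists sel.
  apply: ge_ereal_sup => _ [beta [d0 [T [mu [Z [cm ->]]]]]].
  have m'c : m' <= c by lra.
  apply: le_trans (up d n Sigma sigma lam d1 pd sg l01 t _ m' m'c m'E sel hsel beta d0 T mu Z cm).
    by apply: outerP_le => w /=; exact: ltW.
  by move: t01; rewrite /= in_itv.
move=> t t01 tE sel hsel beta d0 T mu Z cm.
have mc' : m <= c by lra.
have tm : mobj d lam t = m%:E by rewrite tE.
apply: le_trans (up d n Sigma sigma lam d1 pd sg l01 t t01 m mc' tm sel hsel beta d0 T mu Z cm).
apply: outerP_le => w /=; apply: le_trans.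
rewrite -!mulrA mulrDl mul1r lerDl !mulr_ge0//; exact: ltW.
Qed.
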